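(* Let $\Theta$ be a gamma process on $\Psi$, i.e. a completely random measure with fixed-location atoms whose weights have densities $\mathrm{Gamma}(\theta\mid\xi_{fix,k}+1,\lambda_{fix,k})$, $k=1,\dots,K_{prior,fix}$, and with an ordinary component having weight rate measure $\nu(d\theta)=\gamma\,\theta^{\xi}e^{-\lambda\theta}\,d\theta$ on $\mathbb{R}_+$ and location distribution $G$, where $\gamma>0$, $\xi\in(-2,-1]$, $\lambda>0$, and $\xi_{fix,k}>-1$, $\lambda_{fix,k}>0$ for all $k$. Then we may write $$\Theta=\sum_{m=1}^\infty\sum_{x=1}^\infty\sum_{j=1}^{\rho_{m,x}}\theta_{m,x,j}\,\delta_{\psi_{m,x,j}},$$ where - $\psi_{m,x,j}\sim G$, i.i.d. across $m,x,j$; - $M_{m,x}=\gamma\cdot\frac{1}{x!}\cdot\Gamma(\xi+x+1)\cdot(\lambda+m)^{-(\xi+x+1)}$ across $m,x$; - $\rho_{m,x}\sim\mathrm{Poisson}(M_{m,x})$, independently across $m,x$; - $\theta_{m,x,j}\sim\mathrm{Gamma}(\xi+x+1,\lambda+m)$, i.i.d. across $j$ and independently across $m,x$; and the families $(\psi_{m,x,j})$, $(\rho_{m,x})$, $(\theta_{m,x,j})$ are mutually independent.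
   Context: $\Psi$ is a measurable space whose $\sigma$-algebra contains all singletons; $\mathbb{R}_+$ denotes the non-negative reals. $\mathrm{Gamma}(a,b)$ is the gamma distribution with shape $a>0$ and rate $b>0$. A completely random measure (CRM) on $\Psi$ is a random measure taking independent values on disjoint measurable sets. The gamma process is the CRM that is the independent sum of (a) a fixed-location component $\sum_{k=1}^{K_{prior,fix}}\theta_{fix,k}\delta_{\psi_{fix,k}}$, $K_{prior,fix}<\infty$, with deterministic distinct locations and independent weights $\theta_{fix,k}\sim\mathrm{Gamma}(\xi_{fix,k}+1,\lambda_{fix,k})$; and (b) an ordinary component $\sum_k\theta_{ord,k}\delta_{\psi_{ord,k}}$, where $\{(\theta_{ord,k},\psi_{ord,k})\}$ are the points of a Poisson point process on $\mathbb{R}_+\times\Psi$ with rate (mean) measure $\gamma\theta^{\xi}e^{-\lambda\theta}d\theta\cdot G(d\psi)$, with $G$ a diffuse probability distribution on $\Psi$.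
   Formalization: With fixed-location atoms the displayed identity fails, since G is diffuse and the triple sum has no mass at those locations; what is proved is Θ = fixed-location component + triple sum a.s. (on an extended probability space), the fixed weights being independent of the three families. *)

(* Defs.v *)
From HB Require Import structures.
From mathcomp Require Import all_boot all_order all_algebra finmap.
From mathcomp Require Import all_classical all_reals all_analysis.
From mathcomp Require Import measurable_realfun.

Set Implicit Arguments.
Unset Strict Implicit.
Unset Printing Implicit Defensive.

Import Order.TTheory GRing.Theory Num.Theory.
Import numFieldNormedType.Exports.

Local Open Scope classical_set_scope.
Local Open Scope ring_scope.

Section independence.
Context d (T : measurableType d) (R : realType) (P : probability T R).

(* Indices outside [D] play no role. *)
Definition mutually_independent (I : choiceType) (D : set I)
    (F : I -> set_system T) : Prop :=
  forall J : {fset I}, [set` J] `<=` D ->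
  forall A : I -> set T, (forall i, i \in J -> F i (A i)) ->
  P (\bigcap_(i in [set` J]) A i) = (\prod_(i <- J) P (A i))%E.

Definition sigma_rv d' (T' : measurableType d') (X : T -> T') : set_system T :=
  preimage_set_system setT X measurable.

Definition sigma_family (I : Type) (D : set I) d' (T' : measurableType d')
    (X : I -> T -> T') : set_system T :=
  <<s \bigcup_(i in D) sigma_rv (X i) >>.

Definition has_law d' (T' : measurableType d') (X : {mfun T >-> T'})
    (mu : set T' -> \bar R) : Prop :=
  forall A, measurable A -> distribution P X A = mu A.

End independence.

Section gamma_distribution.
Context {R : realType}.

Definition Gamma_fun (a : R) : R :=
  \int[lebesgue_measure]_(t in `[0, +oo[) (t `^ (a - 1) * expR (- t)).

(* [a] is the shape and [b] the rate. *)
Definition gamma_pdf (a b : R) : R -> R :=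
  (fun t => b `^ a / Gamma_fun a * t `^ (a - 1) * expR (- b * t))
    \_ `[0, +oo[.

Definition gamma_prob (a b : R) (A : set R) : \bar R :=
  (\int[lebesgue_measure]_(t in A) (gamma_pdf a b t)%:E)%E.

End gamma_distribution.

Section poisson_process.
Context d (T : measurableType d) (R : realType) (P : probability T R).
Context dE (E : measurableType dE).
Local Open Scope ereal_scope.

Definition point_count (X : nat -> T -> E) (B : set E) (w : T) : \bar R :=
  \sum_(k <oo) \d_(X k w) B.

(* A Poisson variable of infinite mean is almost surely infinite.  The second
   explicit argument of [poisson_prob] is a dummy: the rate is the first. *)
Definition has_poisson_law (N : T -> \bar R) (m : \bar R) : Prop :=
  match m with
  | r%:E => forall n, P [set w | N w = n%:R%:E] = poisson_prob r 0 [set n]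
  | +oo => P [set w | N w = +oo] = 1
  | -oo => False
  end.

Definition poisson_point_process (X : nat -> T -> E) (mu : set E -> \bar R) :
    Prop :=
  [/\ forall k, measurable_fun setT (X k),
      forall B, measurable B -> has_poisson_law (point_count X B) (mu B)
    & forall n (B : 'I_n -> set E),
        (forall i, measurable (B i)) -> trivIset setT B ->
        mutually_independent P setT (fun i => sigma_rv (point_count X (B i)))].

End poisson_process.

Section gamma_process.
Context d (T : measurableType d) (R : realType) (P : probability T R).
Context dPsi (Psi : measurableType dPsi).
Local Open Scope ereal_scope.

(* A random measure on [Psi] is a kernel from the sample space to [Psi]. *)
Definition completely_random (Theta : R.-ker T ~> Psi) : Prop :=
  forall n (A : 'I_n -> set Psi),
    (forall i, measurable (A i)) -> trivIset setT A ->
    mutually_independent P setT (fun i => sigma_rv (Theta ^~ (A i))).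

Definition gamma_weight_rate (gam xi lam t : R) : R :=
  (gam * t `^ xi * expR (- lam * t))%R.

(* The product of the measure [gamma_weight_rate gam xi lam t dt] on
   [0, +oo[ with [G], evaluated at [B] by integrating its sections. *)
Definition gamma_mean_measure (gam xi lam : R) (G : probability Psi R)
    (B : set (R * Psi)) : \bar R :=
  \int[lebesgue_measure]_(t in `[0%R, +oo[)
    ((gamma_weight_rate gam xi lam t)%:E * G (xsection B t)).

Definition fixed_part (K : nat) (psi_fix : 'I_K -> Psi)
    (theta_fix : 'I_K -> T -> R) (w : T) (A : set Psi) : \bar R :=
  \sum_(k < K) (theta_fix k w)%:E * \d_(psi_fix k) A.

Definition ordinary_part (theta_ord : nat -> T -> R) (psi_ord : nat -> T -> Psi)
    (w : T) (A : set Psi) : \bar R :=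
  \sum_(k <oo) (theta_ord k w)%:E * \d_(psi_ord k w) A.

(* The fixed component is independent of the ordinary one in the sense that
   its weights are independent of all the counts of the Poisson process. *)
Definition gamma_process (K : nat) (psi_fix : 'I_K -> Psi)
    (xi_fix lam_fix : 'I_K -> R) (gam xi lam : R) (G : probability Psi R)
    (Theta : R.-ker T ~> Psi) : Prop :=
  completely_random Theta /\
  exists (theta_fix : 'I_K -> {RV P >-> R}) (theta_ord : nat -> {RV P >-> R})
         (psi_ord : nat -> {RV P >-> Psi}),
    let point k w := (theta_ord k w, psi_ord k w) in
    [/\ (forall k,
           has_law P (theta_fix k) (gamma_prob (xi_fix k + 1)%R (lam_fix k))) /\
        mutually_independent P setT (fun k => sigma_rv (theta_fix k)),
        forall k w, (0 <= theta_ord k w)%R,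
        poisson_point_process P point (gamma_mean_measure gam xi lam G),
        mutually_independent P setT (fun i : 'I_2 => tnth [tuple
          sigma_family setT theta_fix;
          sigma_family measurable (point_count R point)] i)
      & {ae P, forall w, forall A, measurable A ->
          Theta w A = fixed_part psi_fix theta_fix w A
                      + ordinary_part theta_ord psi_ord w A}].

End gamma_process.

(* The families of the representation are 1-based: variables with a null index
   are irrelevant. *)
Definition pos_index2 : set (nat * nat) :=
  [set p | (0 < p.1)%N /\ (0 < p.2)%N].

Definition pos_index3 : set (nat * nat * nat) :=
  [set p | [/\ (0 < p.1.1)%N, (0 < p.1.2)%N & (0 < p.2)%N]].

Definition size_biased_mean {R : realType} (gam xi lam : R) (m x : nat) : R :=
  gam * (x`!%:R)^-1 * Gamma_fun (xi + x%:R + 1)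
    * (lam + m%:R) `^ (- (xi + x%:R + 1)).

(* Main.v *)
Require Import Defs.
From HB Require Import structures.
From mathcomp Require Import all_boot all_order all_algebra all_fingroup finmap.
From mathcomp Require Import all_classical all_reals all_analysis.
From mathcomp Require Import measurable_realfun ring lra.

Set Implicit Arguments.
Unset Strict Implicit.
Unset Printing Implicit Defensive.

Import Order.TTheory GRing.Theory Num.Theory.
Import numFieldNormedType.Exports.

Local Open Scope classical_set_scope.
Local Open Scope ring_scope.

(** The functions p_(m,x)(t) = exp(- m t) t^x / x!, for m, x >= 1, sum to 1 at
    every t > 0, because \sum_x t^x / x! = exp t - 1 and
    \sum_m exp(- m t) = 1 / (exp t - 1).  So each point (t, y) of the Poisson
    process underlying the ordinary component can be put at random in a class
    (m, x), class (m, x) having probability p_(m,x)(t).  By the thinning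
    property the classes are independent Poisson processes with mean measures
    p_(m,x)(t) gam t^xi exp(- lam t) dt G(dy), and this product is M_(m,x)
    times the law Gamma(xi + x + 1, lam + m) x G: class (m, x) consists of a
    Poisson number of independent points drawn from that law.  Summing the
    atoms class by class gives the triple series.

    The hypothesis speaks of points listed in some order of which nothing is
    known, while the conclusion asks for independent variables indexed by all
    (m, x, j).  The finitely many points of each class are therefore listed
    anew in a uniformly random order, and the list is continued for ever by
    independent draws from the law of the class.  Marks, orders and draws live
    on an extension of the sample space by countable products of probability
    measures ([seqlaw]).

    The joint law of these variables is read off generating functionals.  For an
    event A independent of the process, the expectation of
    1_A \prod_k (1 - f(X_k)) is P(A) exp(- \int f dmu) ([poisson_generating]:
    for simple f this is the generating function of independent Poisson counts).
    Integrating out the marks gives the expectation of a product over classes of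
    products of f_c over the points of class c ([integral_class_prod]).  Taking
    s f in place of f and comparing the coefficients of s^n isolates the event
    that a class has n points ([expectation_size_prod]); Ryser's formula for
    permanents then turns products of one function over all the points into the
    average over the n! orders of \prod_j b_j(j-th point)
    ([expectation_perm_sum], [integral_enum_weight]).  The classes are treated
    one after the other ([integral_class_weights]), which yields the joint law
    [enum_joint_law].  The four families are independent because blocks of an
    independent family are ([mutually_independent_group]), and the almost sure
    identity is a rearrangement of a series of nonnegative terms
    ([ordinary_part_by_class]). *)

(** * Countable products of probability measures *)
Section probability_facts.
Context d (T : measurableType d) (R : realType) (P : probability T R).

Lemma integral_prob_cst (c : \bar R) : (\int[P]_x c = c)%E.
Proof.
rewrite integral_cst// [X in (_ * X)%E](_ : _ = 1%E) ?mule1//.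
exact: (@probability_setT _ _ _ P).
Qed.

End probability_facts.

Section sequence_space.
Context d (T : measurableType d).

Definition coordinate_sets : set_system (nat -> T) :=
  [set A | exists i (B : set T), measurable B /\ A = (fun x => x i) @^-1` B].

Definition seqspace : measurableType _ := g_sigma_algebraType coordinate_sets.

Lemma measurable_coord i : measurable_fun setT (fun x : seqspace => x i).
Proof.
move=> _ B mB; rewrite setTI; apply: sub_sigma_algebra.
by exists i, B.
Qed.

Lemma measurable_seqspace d' (S : measurableType d') (f : S -> seqspace) :
  (forall i, measurable_fun setT (fun s => f s i)) -> measurable_fun setT f.
Proof.
move=> mf; apply: (@measurability _ _ S seqspace setT f coordinate_sets) => //.
move=> _ [_ [i [B [mB ->]]] <-]; exact: mf.
Qed.

Definition upd (k : nat) (x : nat -> T) (t : T) : nat -> T :=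
  fun i => if i == k then t else x i.

Lemma measurable_upd k :
  measurable_fun setT (fun z : seqspace * T => upd k z.1 z.2 : seqspace).
Proof.
apply: measurable_seqspace => i; rewrite /upd /=; case: (i == k).
  exact: measurable_snd.
exact: (measurableT_comp (measurable_coord i) measurable_fst).
Qed.

Lemma measurable_upd1 k (x : seqspace) :
  measurable_fun setT (fun t : T => upd k x t : seqspace).
Proof.
by apply: measurable_seqspace => i; rewrite /upd /=; case: (i == k).
Qed.

End sequence_space.

Section cylinders.
Context d (T : measurableType d).

Definition depends_on_first (U : Type) (n : nat) (f : (nat -> T) -> U) :=
  forall x y, (forall i, (i < n)%N -> x i = y i) -> f x = f y.

Lemma depends_on_first_le (U : Type) m n (f : (nat -> T) -> U) :
  (m <= n)%N -> depends_on_first m f -> depends_on_first n f.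
Proof. by move=> mn h x y xy; apply: h => i im; apply: xy; exact: leq_trans mn. Qed.

Definition cylinder : set_system (nat -> T) :=
  [set A | exists n, measurable (A : set (seqspace T)) /\ depends_on_first n A].

Lemma cylinder0 : cylinder set0.
Proof. by exists 0%N; split. Qed.

Lemma cylinderU : setU_closed cylinder.
Proof.
move=> A B [m [mA dA]] [n [mB dB]]; exists (maxn m n); split.
  exact: (@measurableU _ (seqspace T)).
move=> x y xy; congr (_ \/ _).
  by apply: dA => i im; apply: xy; rewrite leq_max im.
by apply: dB => i im; apply: xy; rewrite leq_max im orbT.
Qed.

Lemma cylinderC : setC_closed cylinder.
Proof.
move=> A [m [mA dA]]; exists m; split; first exact: (@measurableC _ (seqspace T)).
by move=> x y xy; rewrite /setC/= (dA x y).
Qed.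

(** A copy of the space of sequences, to carry the algebra of cylinders: the
    product measure is the Caratheodory extension of its content there. *)
Definition cylspace := nat -> T.
HB.instance Definition _ := Pointed.on cylspace.
HB.instance Definition _ := isAlgebraOfSets.Build default_measure_display
  cylspace cylinder0 cylinderU cylinderC.

Lemma coordinate_cylinder : @coordinate_sets _ T `<=` cylinder.
Proof.
move=> _ [i [B [mB ->]]]; exists i.+1; split.
  by apply: sub_sigma_algebra; exists i, B.
by move=> x y /(_ i (ltnSn i)) xy; rewrite /preimage/= xy.
Qed.

Lemma sigma_cylinder : <<s cylinder >> = @measurable _ (seqspace T).
Proof.
apply/seteqP; split.
  apply: smallest_sub; first exact: sigma_algebra_measurable.
  by move=> A [n []].
apply: smallest_sub; first exact: smallest_sigma_algebra.
by move=> A /coordinate_cylinder; exact: sub_sigma_algebra.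
Qed.

End cylinders.

Section iterated_integral.
Context d (T : measurableType d) (R : realType) (P : nat -> probability T R).
Local Open Scope ereal_scope.
Implicit Types (f g : seqspace T -> \bar R).

Definition integrate_coord k f (x : seqspace T) := \int[P k]_t f (upd k x t).

(** Integration over the coordinates k, ..., k + n - 1, the last one first. *)
Fixpoint iter_int k n f : seqspace T -> \bar R :=
  if n is n'.+1 then integrate_coord k (iter_int k.+1 n' f) else f.

Lemma integrate_coord_ge0 k f : (forall x, 0 <= f x) ->
  forall x, 0 <= integrate_coord k f x.
Proof. by move=> f0 x; apply: integral_ge0. Qed.

Lemma measurable_integrate_coord k f : (forall x, 0 <= f x) ->
  measurable_fun setT f -> measurable_fun setT (integrate_coord k f).
Proof.
move=> f0 mf.
have mfu : measurable_fun setT (fun z : seqspace T * T => f (upd k z.1 z.2)).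
  exact: (measurableT_comp mf (@measurable_upd _ T k)).
exact: (@measurable_fun_fubini_tonelli_F _ _ (seqspace T) T R (P k) _ mfu).
Qed.

Lemma measurable_iter_int n k f : (forall x, 0 <= f x) ->
  measurable_fun setT f ->
  measurable_fun setT (iter_int k n f) /\ forall x, 0 <= iter_int k n f x.
Proof.
move=> f0 mf; elim: n k => [|n IH] k //=.
have [mI I0] := IH k.+1; split; last exact: integrate_coord_ge0.
exact: measurable_integrate_coord.
Qed.

Lemma integrate_coord_const k f : (forall x t, f (upd k x t) = f x) ->
  forall x, integrate_coord k f x = f x.
Proof.
move=> fk x; rewrite /integrate_coord; under eq_integral do rewrite fk.
rewrite integral_cst//.
rewrite [X in _ * X](_ : _ = 1); last exact: (@probability_setT _ _ _ (P k)).
by rewrite mule1.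
Qed.

Lemma iter_intS k n f :
  iter_int k n.+1 f = iter_int k n (integrate_coord (k + n) f).
Proof.
elim: n k => [|n IH] k; first by rewrite /= addn0.
by rewrite [LHS]/= -/(iter_int k.+1 n.+1 f) IH /= addSnnS.
Qed.

Lemma upd_dep n k f x t : (n <= k)%N -> depends_on_first n f ->
  f (upd k x t) = f x.
Proof.
move=> nk df; apply: df => i ni; rewrite /upd; case: eqP => // ik.
by move: ni; rewrite ik ltnNge nk.
Qed.

(** [f] does not see the coordinates from m on, and a constant is its own mean. *)
Lemma iter_int_stable m k n f : depends_on_first m f -> (m <= k + n)%N ->
  iter_int k n.+1 f = iter_int k n f.
Proof.
move=> df mkn; rewrite iter_intS; congr (iter_int _ _ _).
by apply/funext => x; apply: integrate_coord_const => y t; exact: upd_dep df.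
Qed.

Lemma iter_int_stable_le m k n n' f : depends_on_first m f ->
  (m <= k + n)%N -> (n <= n')%N -> iter_int k n' f = iter_int k n f.
Proof.
move=> df mkn /subnK <-; elim: (n' - n)%N => // j IH.
by rewrite addSn (iter_int_stable df)// (leq_trans mkn)// leq_add2l leq_addl.
Qed.

Lemma le_iter_int k n f g : (forall x, 0 <= f x) -> measurable_fun setT f ->
  measurable_fun setT g -> (forall x, f x <= g x) ->
  forall x, iter_int k n f x <= iter_int k n g x.
Proof.
move=> f0 mf mg fg; elim: n k => [|n IH] k x //=.
have g0 y : 0 <= g y by exact: le_trans (f0 y) (fg y).
have [mIf If0] := measurable_iter_int n k.+1 f0 mf.
have [mIg Ig0] := measurable_iter_int n k.+1 g0 mg.
apply: ge0_le_integral => //.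
- exact: (measurableT_comp mIf (measurable_upd1 k x)).
- exact: (measurableT_comp mIg (measurable_upd1 k x)).
Qed.

Lemma iter_intD k n f g : (forall x, 0 <= f x) -> (forall x, 0 <= g x) ->
  measurable_fun setT f -> measurable_fun setT g ->
  forall x, iter_int k n (fun y => f y + g y) x =
    iter_int k n f x + iter_int k n g x.
Proof.
move=> f0 g0 mf mg; elim: n k => [|n IH] k x //=.
have [mIf If0] := measurable_iter_int n k.+1 f0 mf.
have [mIg Ig0] := measurable_iter_int n k.+1 g0 mg.
rewrite /integrate_coord -ge0_integralD//.
- by apply: eq_integral => t _; rewrite IH.
- exact: (measurableT_comp mIf (measurable_upd1 k x)).
- exact: (measurableT_comp mIg (measurable_upd1 k x)).
Qed.

Lemma iter_intZl k n (c : \bar R) f : 0 <= c -> (forall x, 0 <= f x) ->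
  measurable_fun setT f ->
  forall x, iter_int k n (fun y => c * f y) x = c * iter_int k n f x.
Proof.
move=> c0 f0 mf; elim: n k => [|n IH] k x //=.
have [mIf If0] := measurable_iter_int n k.+1 f0 mf.
rewrite /integrate_coord -ge0_integralZl//.
  by apply: eq_integral => t _; rewrite IH.
exact: (measurableT_comp mIf (measurable_upd1 k x)).
Qed.

Lemma iter_int_cst k n c : iter_int k n (fun=> c) = fun=> c.
Proof.
elim: n k => //= n IH k; rewrite IH; apply/funext => x.
by rewrite integrate_coord_const.
Qed.

End iterated_integral.

Section product_content.
Context d (T : measurableType d) (R : realType) (P : nat -> probability T R).
Local Open Scope ereal_scope.
Implicit Types A : set (cylspace T).

Let ind A (x : seqspace T) : \bar R := (\1_A x)%:E.

Definition cyl_dim A : nat := xget 0%N [set n | depends_on_first n A].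

Lemma cyl_dimP A : measurable A -> depends_on_first (cyl_dim A) A.
Proof.
move=> [n [_ dA]]; rewrite /cyl_dim.
by case: xgetP => [m _ //|/(_ n)]; contradiction.
Qed.

(** The content of a cylinder, computed with any number of coordinates that
    determines it; [point] only fills in the coordinates that do not matter. *)
Definition product_content A : \bar R := iter_int P 0 (cyl_dim A) (ind A) point.

Let ind_dep n A : depends_on_first n A -> depends_on_first n (ind A).
Proof.
move=> dA x y xy; rewrite /ind !indicE; suff -> : (x \in A) = (y \in A) by [].
by apply/idP/idP; rewrite !inE (dA _ _ xy).
Qed.

Let ind_ge0 A x : 0 <= ind A x.
Proof. by rewrite lee_fin. Qed.

Let measurable_ind A : measurable A -> measurable_fun setT (ind A).
Proof.
move=> [n [mA _]]; apply/measurable_EFinP.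
exact: (@measurable_indic _ (seqspace T) R).
Qed.

Lemma product_contentE n A : measurable A -> depends_on_first n A ->
  product_content A = iter_int P 0 n (ind A) point.
Proof.
move=> mA dA; have dA' := cyl_dimP mA.
rewrite /product_content.
have [nA|/ltnW nA] := leqP n (cyl_dim A).
  by rewrite (iter_int_stable_le P (ind_dep dA) (k := 0) (n := n)).
by rewrite (iter_int_stable_le P (ind_dep dA') (k := 0) (n := cyl_dim A) (n' := n)).
Qed.

Lemma product_content_ge0 A : 0 <= product_content A.
Proof.
rewrite /product_content; have : forall x, 0 <= ind A x by [].
elim: (cyl_dim A) 0%N point => [|n IH] k x ind0 //=.
by apply: integral_ge0 => t _; exact: IH.
Qed.

Lemma product_contentU A B : measurable A -> measurable B -> A `&` B = set0 ->
  product_content (A `|` B) = product_content A + product_content B.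
Proof.
move=> mA mB AB.
pose n := maxn (cyl_dim A) (cyl_dim B).
have dA : depends_on_first n A.
  by apply: (depends_on_first_le _ (cyl_dimP mA)); exact: leq_maxl.
have dB : depends_on_first n B.
  by apply: (depends_on_first_le _ (cyl_dimP mB)); exact: leq_maxr.
have dAB : depends_on_first n (A `|` B).
  by move=> x y xy; rewrite /setU/= (dA _ _ xy) (dB _ _ xy).
rewrite (product_contentE mA dA) (product_contentE mB dB).
rewrite (product_contentE (measurableU _ _ mA mB) dAB) -iter_intD//; last 2 first.
- exact: measurable_ind.
- exact: measurable_ind.
congr (iter_int _ _ _ _ _); apply/funext => x; rewrite /ind.
have : x \notin A `&` B by rewrite AB notin_setE.
by rewrite !indicE in_setU in_setI -EFinD; case: (x \in A); case: (x \in B);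
  rewrite ?addr0 ?add0r.
Qed.

Lemma product_contentT : product_content setT = 1.
Proof.
rewrite (@product_contentE 0%N setT measurableT)//=.
by rewrite /ind indicT.
Qed.

Lemma product_content0 : product_content set0 = 0.
Proof.
rewrite (@product_contentE 0)//=.
by rewrite /ind indic0.
Qed.

Lemma le_product_content A B : measurable A -> measurable B -> A `<=` B ->
  product_content A <= product_content B.
Proof.
move=> mA mB AB; rewrite -(setDUK AB) product_contentU//.
- by rewrite leeDl// product_content_ge0.
- exact: measurableD.
- by rewrite setDIK.
Qed.

(** If the contents of a decreasing sequence of cylinders stay above a positive
   number, a point of the intersection is built one coordinate at a time:
   the conditional contents given the coordinates already chosen are kept
   bounded below. *)
Section continuity.
Variables (A : nat -> set (cylspace T)).
Hypothesis mA : forall j, measurable (A j).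
Hypothesis ndA : forall j, A j.+1 `<=` A j.

Let cond k j : seqspace T -> \bar R :=
  iter_int P k (cyl_dim (A j) - k) (ind (A j)).

Let condE k l j : (cyl_dim (A j) <= k + l)%N ->
  cond k j = iter_int P k l (ind (A j)).
Proof.
move=> kl; rewrite /cond.
apply/esym/(iter_int_stable_le _ (ind_dep (cyl_dimP (mA j)))).
  by rewrite -leq_subLR.
by rewrite leq_subLR.
Qed.

Let condS k j : cond k j = integrate_coord P k (cond k.+1 j).
Proof.
rewrite (@condE k (cyl_dim (A j)).+1) ?(leq_trans _ (leq_addl _ _))//.
by rewrite (@condE k.+1 (cyl_dim (A j)))// leq_addl.
Qed.

Let measurable_cond k j : measurable_fun setT (cond k j).
Proof. by apply: (measurable_iter_int P _ _ _ _).1 => //; exact: measurable_ind. Qed.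

Let cond_decr k j x : cond k j.+1 x <= cond k j x.
Proof.
pose l := maxn (cyl_dim (A j)) (cyl_dim (A j.+1)).
rewrite (@condE k l j) ?(leq_trans (leq_maxl _ _) (leq_addl _ _))//.
rewrite (@condE k l j.+1) ?(leq_trans (leq_maxr _ _) (leq_addl _ _))//.
apply: le_iter_int => //; try exact: measurable_ind.
move=> y; rewrite lee_fin !indicE ler_nat.
by case: (boolP (y \in A j.+1)); rewrite // !inE => /ndA Ay; rewrite mem_set.
Qed.

Let cond_le1 k j x : cond k j x <= 1.
Proof.
have -> : 1 = iter_int P k (cyl_dim (A j) - k) (fun=> 1) x by rewrite iter_int_cst.
apply: le_iter_int => //; first exact: measurable_ind.
by move=> y; rewrite lee_fin indicE lern1 leq_b1.
Qed.

Let bounded_below k (x : seqspace T) :=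
  exists2 e : R, (0 < e)%R & forall j, e%:E <= cond k j x.

Let extend_point k x : bounded_below k x ->
  exists t, bounded_below k.+1 (upd k x t).
Proof.
move=> [e e0 he]; pose c := (e / 2)%R.
have c0 : (0 < c)%R by rewrite divr_gt0.
pose S j := [set t | c%:E <= cond k.+1 j (upd k x t)].
have mcu j : measurable_fun setT (fun t => cond k.+1 j (upd k x t)).
  exact: (measurableT_comp (measurable_cond k.+1 j) (measurable_upd1 k x)).
have mS j : measurable (S j).
  by rewrite -[S j]setTI; apply: emeasurable_fun_c_infty.
have PS j : c%:E <= P k (S j).
  have : e%:E <= P k (S j) + c%:E.
    apply: (le_trans (he j)); rewrite condS /integrate_coord.
    have -> : P k (S j) = \int[P k]_t (\1_(S j) t)%:E.
      by rewrite integral_indic// setIT.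
    have -> : c%:E = \int[P k]_t (cst c%:E t).
      rewrite integral_cst// [X in _ * X](_ : _ = 1) ?mule1//.
      exact: (@probability_setT _ _ _ (P k)).
    rewrite -ge0_integralD//; last 2 first.
    - exact/measurable_EFinP/measurable_indic.
    - by move=> t _; rewrite lee_fin ltW.
    apply: ge0_le_integral => //.
    - by move=> t _; apply: (measurable_iter_int P _ _ _ _).2 => //; exact: measurable_ind.
    - apply: emeasurable_funD => //; apply/measurable_EFinP; exact: measurable_indic.
    - move=> t _; rewrite indicE; case: (boolP (t \in S j)) => [_|].
        by rewrite (le_trans (cond_le1 _ _ _))// leeDl// lee_fin ltW.
      by rewrite notin_setE /S/= add0e => /negP; rewrite -ltNge => /ltW.
  set p := (X in _ <= X + _) => h.
  suff : c%:E <= p by [].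
  have : p \is a fin_num by exact: fin_num_measure.
  move: h; case: p => // p h _; move: h.
  by rewrite -EFinD !lee_fin /c; lra.
have [t St] : \bigcap_j S j !=set0.
  apply/set0P/negP => /eqP S0.
  have : P k (S n) @[n --> \oo] --> P k (\bigcap_j S j).
    apply: nonincreasing_cvg_mu => //.
    - by rewrite (le_lt_trans (probability_le1 _ _))// ltry.
    - exact: bigcap_measurable.
    - apply/nonincreasing_seqP => j; apply/subsetPset => t; rewrite /S/= => h.
      exact: le_trans h (cond_decr _ _ _).
  rewrite S0 measure0 => /cvg_lim P0.
  have : c%:E <= 0.
    rewrite -P0//; apply: lime_ge => //; last exact: nearW.
    apply: ereal_nonincreasing_is_cvgn; apply/nonincreasing_seqP => j.
    apply: le_measure; rewrite ?inE// => t; rewrite /S/= => h.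
    exact: le_trans h (cond_decr _ _ _).
  by rewrite lee_fin leNgt c0.
by exists t, c => // j; exact: St.
Qed.

(** Continuity at the empty set, the heart of the extension theorem: the
    content being positive, good values of the coordinates exist one after the
    other. *)
Lemma decreasing_cylinders_neq0 (e : R) : (0 < e)%R ->
  (forall j, e%:E <= product_content (A j)) -> \bigcap_j A j !=set0.
Proof.
move=> e0 he.
pose pick k (x : seqspace T) : seqspace T :=
  if pselect (bounded_below k x) is left h
  then upd k x (projT1 (cid (extend_point h))) else x.
pose fix xs k := if k is k'.+1 then pick k' (xs k') else point : seqspace T.
have bx k : bounded_below k (xs k).
  elim: k => [|k IH] /=.
    exists e => // j; apply: (le_trans (he j)).
    by rewrite /product_content /cond subn0.
  rewrite /pick; case: pselect => // h.
  exact: (projT2 (cid (extend_point h))).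
have xsS k i : (i < k)%N -> xs k i = xs k.+1 i.
  move=> ik /=; rewrite /pick; case: pselect => // h.
  by rewrite /upd ltn_eqF.
have xs_le k l i : (i < k)%N -> (k <= l)%N -> xs k i = xs l i.
  move=> ik /subnK <-; elim: (l - k)%N => // m IH.
  by rewrite addSn -xsS// (leq_trans ik)// leq_addl.
exists (fun i => xs i.+1 i) => j _.
have dj := cyl_dimP (mA j).
rewrite (dj _ (xs (cyl_dim (A j)))); last by move=> i ij; rewrite (xs_le i.+1 _ _ _ ij).
have [c c0 /(_ j)] := bx (cyl_dim (A j)).
rewrite /cond subnn /= /ind indicE; case: (boolP (_ \in A j)); first by rewrite inE.
by rewrite lee_fin leNgt c0.
Qed.

End continuity.

(** What is left of a countable disjoint union after n terms decreases to the
    empty set, so its content tends to 0. *)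
Lemma product_content_sigma_additive : semi_sigma_additive product_content.
Proof.
move=> F mF tF mUF.
pose G n := \bigcup_k F k `\` \big[setU/set0]_(i < n) F i.
have mbig n : measurable (\big[setU/set0]_(i < n) F i).
  exact: bigsetU_measurable.
have mG n : measurable (G n) by exact: measurableD.
have ndG n : G n.+1 `<=` G n.
  by apply: setDS; rewrite big_ord_recr/=; exact: subsetUl.
have cF n : product_content (\big[setU/set0]_(i < n) F i) =
    \sum_(0 <= i < n) product_content (F i).
  elim: n => [|n IH]; first by rewrite big_ord0 big_nil product_content0.
  rewrite big_ord_recr big_nat_recr//= (product_contentU (mbig n) (mF n)) ?IH//.
  by rewrite (@trivIset_bigsetUI _ predT _ _ n n)//; exact: sub_trivIset tF.
have cG n : product_content (\bigcup_k F k) =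
    \sum_(0 <= i < n) product_content (F i) + product_content (G n).
  rewrite -cF -product_contentU ?setDIK// setDUK//.
  exact: bigsetU_bigcup.
have G_le1 n : product_content (G n) <= 1.
  by rewrite -product_contentT; apply: le_product_content => //; exact: measurableT.
have G_fin n : product_content (G n) \is a fin_num.
  by rewrite ge0_fin_numE ?product_content_ge0// (le_lt_trans (G_le1 n)) ?ltry.
have G0 : product_content (G n) @[n --> \oo] --> 0.
  have Gni : nonincreasing_seq (product_content \o G).
    by apply/nonincreasing_seqP => n; exact: le_product_content.
  have := ereal_nonincreasing_cvgn Gni; set l := ereal_inf _ => Gl.
  suff -> : 0 = l by [].
  have l0 : 0 <= l by apply: le_ereal_inf_tmp => _ [n _ <-]; exact: product_content_ge0.
  apply/eqP; rewrite eq_le l0/= leNgt; apply/negP => l0'.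
  have lfin : l \is a fin_num.
    rewrite ge0_fin_numE//; apply: le_lt_trans (ltry 1).
    by apply: le_trans (G_le1 0%N); apply: ereal_inf_lbound; exists 0%N.
  have [] := @decreasing_cylinders_neq0 G mG ndG (fine l).
  - by rewrite -lte_fin fineK.
  - by move=> j; rewrite fineK//; apply: ereal_inf_lbound; exists j.
  - move=> x Gx; have [[k _ Fkx] _] := Gx 0%N I.
    have [_] := Gx k.+1 I; apply.
    by rewrite big_ord_recr/=; right.
have -> : (fun n => \sum_(0 <= i < n) product_content (F i)) =
    (fun n => product_content (\bigcup_k F k) - product_content (G n)).
  by apply/funext => n; rewrite (cG n) addeK.
rewrite -[X in _ --> X]sube0; apply: cvgeB => //; last exact: cvg_cst.
by rewrite fin_num_adde_defl.
Qed.

HB.instance Definition _ := isMeasure.Build _ (cylspace T) R product_content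
  product_content0 product_content_ge0 product_content_sigma_additive.

End product_content.

Section product_of_sequence.
Context d (T : measurableType d) (R : realType) (P : nat -> probability T R).
Local Open Scope ereal_scope.

Lemma measurable_cylE (A : set (seqspace T)) : measurable A ->
  <<s @measurable _ (cylspace T) >> A.
Proof. by rewrite -sigma_cylinder. Qed.

Definition seqlaw (A : set (seqspace T)) : \bar R :=
  measure_extension (product_content P) A.

Let seqlaw0 : seqlaw set0 = 0.
Proof. by rewrite /seqlaw measure0. Qed.

Let seqlaw_ge0 A : 0 <= seqlaw A.
Proof. exact: measure_ge0. Qed.

Let seqlaw_sigma_additive : semi_sigma_additive seqlaw.
Proof.
move=> F mF tF mUF; apply: measure_semi_sigma_additive => //.
  by move=> i; exact: measurable_cylE.
exact: measurable_cylE.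
Qed.

HB.instance Definition _ := isMeasure.Build _ (seqspace T) R seqlaw
  seqlaw0 seqlaw_ge0 seqlaw_sigma_additive.

Lemma seqlaw_cylinder (A : set (seqspace T)) : cylinder A ->
  seqlaw A = product_content P A.
Proof. by move=> cA; rewrite /seqlaw /measure_extension measurable_mu_extE. Qed.

Let seqlaw_setT : seqlaw setT = 1.
Proof.
by rewrite seqlaw_cylinder ?product_contentT//; exact: (@measurableT _ (cylspace T)).
Qed.

HB.instance Definition _ := Measure_isProbability.Build _ _ _ seqlaw seqlaw_setT.

Definition box n (B : nat -> set T) : set (seqspace T) :=
  [set x | forall i, (i < n)%N -> B i (x i)].

Lemma measurable_box n B : (forall i, measurable (B i)) -> measurable (box n B).
Proof.
move=> mB.
have -> : box n B = \bigcap_(i in [set i | (i < n)%N]) ((fun x : seqspace T => x i) @^-1` B i).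
  by apply/seteqP; split.
apply: bigcap_measurableType => i _.
by rewrite -[X in measurable X]setTI; exact: measurable_coord.
Qed.

Lemma box_cylinder n B : (forall i, measurable (B i)) -> cylinder (box n B).
Proof.
move=> mB; exists n; split; first exact: measurable_box.
move=> x y xy; rewrite /box/=; apply/propext; split => h i ni.
  by rewrite -xy//; exact: h.
by rewrite xy//; exact: h.
Qed.

Lemma seqlaw_box n B : (forall i, measurable (B i)) ->
  seqlaw (box n B) = \prod_(i < n) P i (B i).
Proof.
move=> mB; rewrite seqlaw_cylinder; last exact: box_cylinder.
have [_ [_ _]] := box_cylinder n mB.
rewrite (@product_contentE _ _ _ _ n)//; last 2 first.
- exact: box_cylinder.
- move=> x y xy; rewrite /box/=; apply/propext; split => h i ni.
    by rewrite -xy//; exact: h.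
  by rewrite xy//; exact: h.
suff H m : (m <= n)%N -> forall x,
    iter_int P 0 m (fun x : seqspace T => (\1_(box m B) x)%:E) x =
    \prod_(i < m) P i (B i) by exact: H.
elim: m => [|m IH] mn x.
  rewrite /= big_ord0 indicE mem_set//.
rewrite iter_intS add0n big_ord_recr/= muleC.
have -> : integrate_coord P m (fun x : seqspace T => (\1_(box m.+1 B) x)%:E) =
    fun x => P m (B m) * (\1_(box m B) x)%:E.
  apply/funext => y; rewrite /integrate_coord.
  under eq_integral => t _.
    have -> : \1_(box m.+1 B) (upd m y t) = (\1_(B m) t * \1_(box m B) y)%R :> R.
      rewrite !indicE -natrM mulnb; congr (_%:R); congr nat_of_bool.
      apply/idP/andP; rewrite !inE /box/= /upd.
        move=> h; split; first by have := h m (ltnSn m); rewrite eqxx.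
        by move=> i im; have := h i (ltnW im); rewrite ltn_eqF.
      move=> [Bt By] i; rewrite ltnS leq_eqVlt => /orP[/eqP ->|im].
        by rewrite eqxx.
      by rewrite ltn_eqF//; exact: By.
    rewrite EFinM; over.
  by rewrite ge0_integralZr// ?integral_indic ?setIT//; exact/measurable_EFinP/measurable_indic.
rewrite iter_intZl//; first by rewrite IH// ltnW.
by apply/measurable_EFinP/measurable_indic; exact: measurable_box.
Qed.

Definition boxes : set_system (seqspace T) :=
  [set A | exists n (B : nat -> set T), (forall i, measurable (B i)) /\ A = box n B].

Lemma boxes_setI : setI_closed boxes.
Proof.
move=> _ _ [n [B [mB ->]]] [m [C [mC ->]]].
pose D i := (if (i < n)%N then B i else setT) `&` (if (i < m)%N then C i else setT).
exists (maxn n m), D; split.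
  by move=> i; apply: measurableI; case: ifP.
apply/seteqP; split => x; rewrite /box /D/=.
  by move=> [xB xC] i _; split; case: ifP => // ?; [exact: xB|exact: xC].
move=> xD; split => i h; have := xD i; rewrite leq_max h ?orbT => /(_ isT)[].
  by [].
by [].
Qed.

Lemma sigma_boxes : @measurable _ (seqspace T) = <<s boxes >>.
Proof.
apply/seteqP; split; last first.
  apply: smallest_sub; first exact: sigma_algebra_measurable.
  by move=> _ [n [B [mB ->]]]; exact: measurable_box.
apply: smallest_sub; first exact: smallest_sigma_algebra.
move=> _ [i [B [mB ->]]]; apply: sub_sigma_algebra.
exists i.+1, (fun j => if j == i then B else setT); split.
  by move=> j; case: ifP.
apply/seteqP; split => x; rewrite /box/=.
  by move=> xB j _; case: eqP => // ->.
by move=> /(_ i (ltnSn i)); rewrite eqxx.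
Qed.

(** The law of a sequence whose k-th term is redrawn: it is again the product law,
    and this is how integrals over sequences get factorized. *)
Let resampled k : {measure set (seqspace T) -> \bar R} :=
  measure_function_pushforward__canonical__measure_function_Measure
    (seqlaw \x P k) (@measurable_upd _ T k).

Let seqlaw_resample k (A : set (seqspace T)) : measurable A ->
  seqlaw A = resampled k A.
Proof.
apply: (@measure_unique _ _ _ boxes (fun=> setT) sigma_boxes boxes_setI _ _
  seqlaw (resampled k)).
- by move=> _; exists 0%N, (fun=> setT); split => //; apply/seteqP; split.
- by rewrite bigcup_const//; exists 0%N.
- move=> _ [n [B [mB ->]]].
  pose C i := if i == k then setT else B i.
  have mC i : measurable (C i) by rewrite /C; case: ifP.
  transitivity ((seqlaw \x P k) (box n C `*` (if (k < n)%N then B k else setT))); last first.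
    congr (product_measure1 _ _ _); apply/seteqP; split => -[x t]; rewrite /box/= /upd /C.
      move=> [h1 h2] i ni; have := h1 i ni; case: eqP => // ik _.
      by move: h2; rewrite -ik ni.
    move=> h; split; last first.
      by case: ifPn => // kn; have := h k kn; rewrite eqxx.
    by move=> i ni; have := h i ni; case: eqP.
  rewrite product_measure1E//; [|exact: measurable_box|by case: ifP].
  rewrite [LHS](seqlaw_box n mB) [X in X * _](seqlaw_box n mC); case: ifPn => kn.
    rewrite (bigD1 (Ordinal kn))//= [in RHS](bigD1 (Ordinal kn))//=.
    rewrite {1}/C eqxx [X in X * _ * _](_ : _ = 1); last exact: (@probability_setT _ _ _ (P k)).
    rewrite mul1e muleC.
    congr (_ * _); apply: eq_bigr => i ik; rewrite /C ifN//.
  rewrite [X in _ * X](_ : _ = 1) ?mule1; last exact: (@probability_setT _ _ _ (P k)).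
  apply: eq_bigr => i _; rewrite /C ifN//; apply: contraNneq kn => <-.
  exact: ltn_ord.
- by move=> _; rewrite (le_lt_trans (probability_le1 _ _))// ltry.
Qed.

Lemma integral_seqlaw_resample k (f : seqspace T -> \bar R) :
  measurable_fun setT f -> (forall x, 0 <= f x) ->
  \int[seqlaw]_x f x = \int[seqlaw]_x \int[P k]_t f (upd k x t).
Proof.
move=> mf f0.
rewrite (@eq_measure_integral _ _ _ setT (resampled k)); last first.
  by move=> A mA _; exact: (seqlaw_resample k mA).
have mu := @measurable_upd _ T k.
rewrite ge0_integral_pushforward// preimage_setT.
rewrite (@fubini_tonelli1 _ _ (seqspace T) T R seqlaw (P k))//.
  exact: (measurableT_comp mf mu).
by move=> z; exact: f0.
Qed.

(** Redrawing the coordinates of [s] one by one splits off their factors. *)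
Lemma integral_seqlaw_prod (s : seq nat) (f : nat -> T -> R) : uniq s ->
  (forall i, measurable_fun setT (f i)) -> (forall i t, (0 <= f i t)%R) ->
  \int[seqlaw]_x (\prod_(i <- s) f i (x i))%:E =
  \prod_(i <- s) \int[P i]_t (f i t)%:E.
Proof.
move=> us mf f0; elim: s us => [_|k s IH /andP[ks us]].
  rewrite big_nil; under eq_integral do rewrite big_nil.
  by rewrite integral_prob_cst.
have mprod (s' : seq nat) : measurable_fun setT
    (fun x : seqspace T => (\prod_(i <- s') f i (x i))%:E).
  apply/measurable_EFinP; apply: measurable_prod => i _.
  exact: (measurableT_comp (mf i) (measurable_coord i)).
have prod0 (s' : seq nat) (x : seqspace T) : 0 <= (\prod_(i <- s') f i (x i))%:E.
  by rewrite lee_fin; exact: prodr_ge0.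
rewrite big_cons (integral_seqlaw_resample k)// -IH// -ge0_integralZl//; last first.
  by apply: integral_ge0 => t _; rewrite lee_fin.
apply: eq_integral => x _.
rewrite -ge0_integralZr//; [|exact/measurable_EFinP|by move=> t _; rewrite lee_fin].
apply: eq_integral => t _; rewrite big_cons EFinM /upd eqxx; congr (_ * _%:E).
apply: eq_big_seq => i si; rewrite ifN//; by apply: contraNneq ks => <-.
Qed.

End product_of_sequence.

(** * The generating functional of a Poisson process *)
Section nneseries_facts.
Context {R : realType}.

Lemma nneseries_expR (x : R) : 0 <= x ->
  (\sum_(n <oo) (x ^+ n / n`!%:R)%:E = (expR x)%:E)%E.
Proof.
move=> x0; rewrite -EFin_lim; last exact: is_cvg_series_exp_coeff.
by apply/congr_lim/funext => n; rewrite /= /series/= -sumEFin.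
Qed.

Lemma nneseries_single (f : nat -> \bar R) m :
  (forall n, n != m -> f n = 0%E) -> (\sum_(n <oo) f n = f m)%E.
Proof.
move=> fm; apply: cvg_lim => //; apply: cvg_near_cst.
exists m.+1 => // K /= mK; rewrite big_mkord (bigD1 (Ordinal mK))//=.
by rewrite big1 ?adde0// => i /fm.
Qed.

Lemma nneseries_const0 (f : nat -> \bar R) :
  (forall n, f n = 0%E) -> (\sum_(n <oo) f n = 0)%E.
Proof. by move=> f0; rewrite (nneseries_single (m := 0)). Qed.

End nneseries_facts.

Section counting.
Context d (Om : measurableType d) (R : realType).
Context dE (E : measurableType dE) (X : nat -> Om -> E).
Hypothesis mX : forall k, measurable_fun setT (X k).

Definition count_upto (B : set E) K w : nat := \sum_(k < K) (X k w \in B).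

Definition count_event (B : set E) n : set Om :=
  [set w | point_count R X B w = n%:R%:E].

Lemma count_upto_nd B w m n : (m <= n)%N -> (count_upto B m w <= count_upto B n w)%N.
Proof.
by move=> mn; rewrite /count_upto -(subnKC mn) big_split_ord/= leq_addr.
Qed.

Lemma point_countE B w :
  point_count R X B w = limn (fun K => (count_upto B K w)%:R%:E : \bar R).
Proof.
apply/congr_lim/funext => K; rewrite big_mkord /count_upto natr_sum -sumEFin.
by apply: eq_bigr => k _; rewrite diracE.
Qed.

(** Partial counts are nondecreasing integers: if bounded they stabilize. *)
Lemma count_dichotomy B w :
  (exists n K0, (forall K, (K0 <= K)%N -> count_upto B K w = n) /\
     point_count R X B w = n%:R%:E) \/
  ((forall n, point_count R X B w <> n%:R%:E) /\
     forall m, exists K0, forall K, (K0 <= K)%N -> (m <= count_upto B K w)%N).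
Proof.
have [[M hM]|/forallNP hM] := pselect (exists M, forall K, (count_upto B K w <= M)%N).
  left.
  have ex : exists n, [exists K : 'I_1, true] && `[< exists K, count_upto B K w = n >].
    by exists (count_upto B 0 w); apply/andP; split; [apply/existsP; exists ord0|apply/asboolP; exists 0%N].
  have bd n : [exists K : 'I_1, true] && `[< exists K, count_upto B K w = n >] -> (n <= M)%N.
    by move=> /andP[_ /asboolP[K <-]].
  case: (ex_maxnP ex bd) => n /andP[_ /asboolP[K0 cK0]] nmax.
  have cK K : (K0 <= K)%N -> count_upto B K w = n.
    move=> K0K; apply/eqP; rewrite eqn_leq -{2}cK0 count_upto_nd// andbT.
    by apply: nmax; apply/andP; split; [apply/existsP; exists ord0|apply/asboolP; exists K].
  exists n, K0; split => //.
  rewrite point_countE; apply: cvg_lim => //; apply: cvg_near_cst.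
  by exists K0 => // K /= /cK ->.
right.
have unb m : exists K0, forall K, (K0 <= K)%N -> (m <= count_upto B K w)%N.
  have /existsNP[K0 /negP] := hM m; rewrite -ltnNge => mK0.
  by exists K0 => K K0K; rewrite (leq_trans (ltnW mK0))// count_upto_nd.
split => // n; rewrite point_countE => h.
have [K0 hK0] := unb n.+1.
have : (n.+1%:R%:E <= (n%:R%:E : \bar R))%E.
  rewrite -h; apply: lime_ge; last first.
    by exists K0 => // K /= /hK0 nK; rewrite lee_fin ler_nat.
  apply: ereal_nondecreasing_is_cvgn => a b ab.
  by rewrite lee_fin ler_nat count_upto_nd.
by rewrite lee_fin ler_nat ltnn.
Qed.

Lemma measurable_point_count B : measurable B ->
  measurable_fun setT (point_count R X B).
Proof.
move=> mB; rewrite /point_count.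
have -> : (fun w => \sum_(k <oo) \d_(X k w) B)%E =
    (fun w => \sum_(0 <= k <oo | k \in predT) (\1_B (X k w))%:E : \bar R)%E.
  by apply/funext => w; apply: eq_eseriesl.
apply: ge0_emeasurable_sum => // k _; apply/measurable_EFinP.
have mI : measurable_fun setT (\1_B : E -> R) by exact: measurable_indic.
exact: (measurableT_comp mI (mX k)).
Qed.

Lemma measurable_count_eq B x : measurable B ->
  measurable [set w | point_count R X B w = x].
Proof.
move=> mB.
rewrite [X in measurable X](_ : _ =
  setT `&` point_count R X B @^-1` [set x]); last by rewrite setTI.
exact: measurable_point_count.
Qed.

Lemma measurable_count_event B n : measurable B -> measurable (count_event B n).
Proof. exact: measurable_count_eq. Qed.

(** At each sample point the series has at most one nonzero term, s^n for the
    final count n; when the count is infinite it has none, and s^K tends to 0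
    with K. *)
Lemma cvg_expr_count B w (s : R) : 0 <= s < 1 ->
  ((s ^+ count_upto B K w)%:E @[K --> \oo] -->
     \sum_(n <oo) (s ^+ n * \1_(count_event B n) w)%:E)%E.
Proof.
move=> /andP[s0 s1].
have [[n [K0 [cK pc]]]|[pc unb]] := count_dichotomy B w.
  rewrite (nneseries_single (m := n)); last first.
    move=> m mn; rewrite indicE memNset ?mulr0//.
    rewrite /count_event/= pc => -[] /eqP; rewrite eqr_nat => /eqP nm.
    by move: mn; rewrite nm eqxx.
  rewrite indicE mem_set// mulr1.
  by apply: cvg_near_cst; exists K0 => // K /= /cK ->.
rewrite nneseries_const0; last first.
  by move=> n; rewrite indicE memNset ?mulr0//; exact: pc.
apply/fine_cvgP; split; first exact: nearW.
have := @cvg_expr R s; rewrite ger0_norm// => /(_ s1) /cvgrPdist_lt sn.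
apply/cvgrPdist_lt => e e0; have [m _ /= hm] := sn _ e0.
have [K0 hK0] := unb m; exists K0 => // K /= /hK0 /hm.
by rewrite /comp/=.
Qed.

(** The limit of s^K as the number K of points counted grows: s^N, or 0 for
    infinite N. *)
Definition count_gen (s : R) B w : R :=
  fine (\sum_(n <oo) (s ^+ n * \1_(count_event B n) w)%:E)%E.

Lemma count_genP B (s : R) w : 0 <= s < 1 ->
  [/\ 0 <= count_gen s B w,
   (count_gen s B w)%:E = (\sum_(n <oo) (s ^+ n * \1_(count_event B n) w)%:E)%E &
   s ^+ count_upto B K w @[K --> \oo] --> count_gen s B w].
Proof.
move=> s01; have := cvg_expr_count (B := B) (w := w) s01.
have /andP[s0 s1] := s01.
rewrite /count_gen; set l := (X in _ --> X) => cl.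
have l0 : (0 <= l)%E.
  by apply: nneseries_ge0 => n _ _; rewrite lee_fin mulr_ge0// exprn_ge0.
have l1 : (l <= 1)%E.
  rewrite -(cvg_lim _ cl)//; apply: lime_le; first by apply/cvg_ex; exists l.
  by apply: nearW => K; rewrite lee_fin exprn_ile1// ltW.
have lf : l \is a fin_num by rewrite ge0_fin_numE// (le_lt_trans l1)// ltry.
split; [exact: fine_ge0|by rewrite fineK|].
by move: cl; rewrite -[X in _ --> X](fineK lf) => /fine_cvgP[].
Qed.

Lemma measurable_count_gen B (s : R) : 0 <= s -> measurable B ->
  measurable_fun setT (count_gen s B).
Proof.
move=> s0 mB; apply: measurableT_comp => //.
apply: (ge0_emeasurable_sum (P := predT)) => [n w _ _|n _].
  by rewrite lee_fin mulr_ge0// exprn_ge0.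
apply/measurable_EFinP/measurable_funM => //.
by apply: measurable_indic; exact: measurable_count_event.
Qed.

End counting.

Section limits01.
Context d (Om : measurableType d) (R : realType) (P : probability Om R).

Lemma cvg_integral01 (F : nat -> Om -> R) (G : Om -> R) :
  (forall n, measurable_fun setT (F n)) ->
  (forall n w, 0 <= F n w <= 1) -> (forall w, F n w @[n --> \oo] --> G w) ->
  (\int[P]_w (F n w)%:E @[n --> \oo] --> \int[P]_w (G w)%:E)%E.
Proof.
move=> mF F01 FG.
apply: (@dominated_cvg _ _ _ P setT measurableT (fun n w => (F n w)%:E) _ (cst 1%E)) => //.
- by move=> n; exact/measurable_EFinP.
- by move=> w _; apply: cvg_EFin; [exact: nearW|exact: FG].
- exact: finite_measure_integrable_cst.
- by move=> n w _ /=; have /andP[F0 F1] := F01 n w; rewrite lee_fin ger0_norm.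
Qed.

Lemma cvg_prod_seq (I : Type) (J : seq I) (u : I -> nat -> R) (l : I -> R) :
  (forall i, u i n @[n --> \oo] --> l i) ->
  \prod_(i <- J) u i n @[n --> \oo] --> \prod_(i <- J) l i.
Proof.
move=> ul; elim: J => [|i J IH].
  by rewrite big_nil; under eq_fun do rewrite big_nil; exact: cvg_cst.
by rewrite big_cons; under eq_fun do rewrite big_cons; apply: cvgM.
Qed.

Lemma mul_indic (A B : set Om) w : \1_A w * \1_B w = \1_(A `&` B) w :> R.
Proof. by rewrite !indicE in_setI -natrM mulnb. Qed.

Lemma prod_indic (I : choiceType) (J : seq I) (ev : I -> set Om) w :
  \prod_(i <- J) \1_(ev i) w = \1_(\bigcap_(i in [set` J]) ev i) w :> R.
Proof.
elim: J => [|i J IH].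
  by rewrite big_nil indicE mem_set// => i; rewrite /= in_nil.
rewrite big_cons IH !indicE -natrM mulnb; congr (_%:R); congr nat_of_bool.
apply/andP/idP; rewrite !inE.
  move=> [wi wJ] j /=; rewrite inE => /orP[/eqP ->//|jJ]; exact: wJ.
move=> wJ; split; first by apply: wJ; rewrite /= mem_head.
by move=> j jJ; apply: wJ; rewrite /= inE jJ orbT.
Qed.

(** The limits in n and in K of a doubly indexed array exchange when the array
    dominates both its limits: the lower bound comes from n, the upper one from
    a fixed large n. *)
Lemma cvg_exchange_squeeze (a : nat -> nat -> R) (b e : nat -> R) (l : R) :
  (forall n, a n K @[K --> \oo] --> e n) -> (forall n K, b K <= a n K) ->
  (forall n K, e n <= a n K) -> (forall K, a n K @[n --> \oo] --> b K) ->
  e n @[n --> \oo] --> l -> b K @[K --> \oo] --> l.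
Proof.
move=> ae ba ea ab el.
have lb K : l <= b K.
  by apply: (ler_cvg_to el (ab K)); exact: nearW.
apply/cvgrPdist_lt => eps eps0.
have eps2 : 0 < eps / 2 by rewrite divr_gt0.
have /cvgrPdist_lt/(_ _ eps2)[N _ /(_ N (leqnn _)) eN] := el.
have /cvgrPdist_lt/(_ _ eps2) := ae N; apply: filterS => K aK.
rewrite distrC ger0_norm ?subr_ge0//.
have := ba N K; move: eN aK; rewrite !ltr_norml => /andP[h1 h2] /andP[h3 h4].
lra.
Qed.

End limits01.

Section expm.
Context {R : realType}.
Local Open Scope ereal_scope.

(* exp(-x) for x in [0, +oo] *)
Definition expm (x : \bar R) : R := if x is r%:E then expR (- r) else 0.

Lemma expm_ge0 x : (0 <= expm x)%R.
Proof. by case: x => //= r; exact: expR_ge0. Qed.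

Lemma expm0 : expm 0 = 1%R. Proof. by rewrite /= oppr0 expR0. Qed.

Lemma expmD x y : 0 <= x -> 0 <= y -> expm (x + y) = (expm x * expm y)%R.
Proof.
case: x => [r| |]; case: y => [s| |] //= _ _; rewrite ?mulr0 ?mul0r//.
by rewrite opprD expRD.
Qed.

Lemma expm_sum (I : Type) (s : seq I) (P : pred I) (x : I -> \bar R) :
  (forall i, 0 <= x i) ->
  expm (\sum_(i <- s | P i) x i) = (\prod_(i <- s | P i) expm (x i))%R.
Proof.
move=> x0; elim: s => [|i s IH]; first by rewrite !big_nil expm0.
by rewrite !big_cons; case: ifP => _//; rewrite expmD ?IH// sume_ge0.
Qed.

Lemma cvg_expm (u : nat -> \bar R) x : (forall n, 0 <= u n) ->
  u n @[n --> \oo] --> x -> expm (u n) @[n --> \oo] --> expm x.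
Proof.
move=> u0 ux.
have x0 : 0 <= x by rewrite -(cvg_lim _ ux)//; apply: lime_ge; [apply/cvg_ex; exists x|exact: nearW].
case: x ux x0 => [r| |]//.
  move=> /fine_cvgP[fu ufr] _ /=.
  apply: (@cvg_trans _ (expR (- fine (u n)) @[n --> \oo])).
    apply: near_eq_cvg; near=> n.
    have : u n \is a fin_num by near: n; exact: fu.
    by case: (u n).
  apply: continuous_cvg; last exact: cvgN.
  exact: continuous_expR.
move=> /cvgeyPge uoo _ /=.
apply/cvgrPdist_le => e e0.
have := uoo (- ln e)%R; apply: filterS => n hn.
rewrite sub0r normrN ger0_norm ?expm_ge0//.
move: (u0 n) hn; case: (u n) => [s| |]//= _; last by move=> _; exact: ltW.
by rewrite lee_fin lerNl => hs; rewrite -(lnK e0) ler_expR.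
Unshelve. all: by end_near. Qed.

End expm.

Section generating_functional.
Import HBNNSimple.
Context d (Om : measurableType d) (R : realType) (P : probability Om R).
Local Open Scope ereal_scope.

(** A weighted product formula for events {N_i = n} passes to generating
    functions: one index is summed at a time, the weight absorbing the
    generating series already formed. *)
Lemma weighted_generating (I : eqType) (ev : I -> nat -> set Om)
    (s : I -> R) (pi : I -> nat -> R) (psi : I -> R) (H : I -> Om -> R) :
  (forall i n, measurable (ev i n)) -> (forall i, 0 <= s i)%R ->
  (forall i n, 0 <= pi i n)%R ->
  (forall i, \sum_(n <oo) (s i ^+ n * pi i n)%:E = (psi i)%:E) ->
  (forall i, measurable_fun setT (H i)) -> (forall i w, 0 <= H i w)%R ->
  (forall i w, (H i w)%:E = \sum_(n <oo) (s i ^+ n * \1_(ev i n) w)%:E) ->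
  forall (J : seq I), uniq J -> forall (W : Om -> R) (c : R),
  measurable_fun setT W -> (forall w, 0 <= W w)%R -> (0 <= c)%R ->
  (forall n : I -> nat,
    \int[P]_w (W w * \prod_(i <- J) \1_(ev i (n i)) w)%:E =
    (c * \prod_(i <- J) pi i (n i))%:E) ->
  \int[P]_w (W w * \prod_(i <- J) H i w)%:E = (c * \prod_(i <- J) psi i)%:E.
Proof.
move=> mev s0 pi0 psiE mH H0 HE; elim => [_|i J IH /andP[iJ uJ]] W c mW W0 c0 hW.
  have := hW (fun=> 0%N); rewrite !big_nil => <-.
  by apply: eq_integral => w _; rewrite !big_nil.
rewrite big_cons mulrA -(IH uJ (fun w => W w * H i w)%R).
- by apply: eq_integral => w _; rewrite big_cons mulrA.
- exact: measurable_funM.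
- by move=> w; exact: mulr_ge0.
- rewrite mulr_ge0// -lee_fin -psiE; apply: nneseries_ge0 => n _ _.
  by rewrite lee_fin mulr_ge0// exprn_ge0.
move=> n.
pose Z m w : R := (W w * \1_(ev i m) w * \prod_(j <- J) \1_(ev j (n j)) w)%R.
have mZ m : measurable_fun setT (Z m).
  apply: measurable_funM; last by apply: measurable_prod => j _; exact: measurable_indic.
  by apply: measurable_funM => //; exact: measurable_indic.
have Z0 m w : (0 <= Z m w)%R.
  by rewrite /Z !mulr_ge0//; apply: prodr_ge0 => j _.
have intZ m : \int[P]_w (Z m w)%:E = (c * (pi i m * \prod_(j <- J) pi j (n j)))%:E.
  pose n' j := if j == i then m else n j.
  have n'J j : j \in J -> n' j = n j.
    by rewrite /n'; case: eqP => // -> iJ'; rewrite iJ' in iJ.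
  have n'i : n' i = m by rewrite /n' eqxx.
  have := hW n'; rewrite big_cons n'i.
  rewrite (eq_big_seq (fun j => pi j (n j))); last by move=> j jJ; rewrite n'J.
  move=> <-; apply: eq_integral => w _; rewrite big_cons n'i /Z mulrA.
  by congr (_ * _)%:E; apply: eq_big_seq => j jJ; rewrite n'J.
transitivity (\int[P]_w \sum_(m <oo) (s i ^+ m * Z m w)%:E).
  apply: eq_integral => w _.
  rewrite -mulrA mulrCA EFinM HE muleC -nneseriesZl; last first.
    by move=> m _; rewrite lee_fin mulr_ge0// exprn_ge0.
  by apply: eq_eseriesr => m _; rewrite -EFinM /Z; congr (_%:E); ring.
rewrite integral_nneseries//; last 2 first.
- by move=> m; apply/measurable_EFinP; exact: measurable_funM.
- by move=> m w _; rewrite lee_fin mulr_ge0// exprn_ge0.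
transitivity (\sum_(m <oo) ((c * \prod_(j <- J) pi j (n j))%:E * (s i ^+ m * pi i m)%:E)).
  apply: eq_eseriesr => m _; under eq_integral do rewrite EFinM.
  rewrite ge0_integralZl//; last 3 first.
  - exact/measurable_EFinP.
  - by move=> w _; rewrite lee_fin.
  - by rewrite lee_fin exprn_ge0.
  by rewrite intZ -!EFinM; congr (_%:E); ring.
rewrite nneseriesZl; last first.
  by move=> m _; rewrite lee_fin mulr_ge0// exprn_ge0.
by rewrite psiE -EFinM; congr (_%:E); ring.
Qed.

Context dE (E : measurableType dE) (X : nat -> Om -> E).
Variable (mu : {measure set E -> \bar R}).
Hypothesis mX : forall k, measurable_fun setT (X k).
Variable A : set Om.
Hypothesis mA : measurable A.
Hypothesis poissonX :
  forall B, measurable B -> has_poisson_law P (point_count R X B) (mu B).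
(* the counts of disjoint sets are independent of one another and of A *)
Hypothesis indepX : forall (L : nat) (B : 'I_L -> set E) (n : 'I_L -> nat)
  (J : seq 'I_L), uniq J ->
  (forall i, measurable (B i)) -> trivIset setT B ->
  P (A `&` \bigcap_(i in [set` J]) count_event R X (B i) (n i)) =
  P A * \prod_(i <- J) P (count_event R X (B i) (n i)).

Lemma poisson_probE (r : R) k n : (0 <= r)%R ->
  poisson_prob r k [set n] = (r ^+ n / n`!%:R * expR (- r))%:E.
Proof.
rewrite le_eqVlt /poisson_prob => /orP[/eqP <-|r0].
  rewrite ltxx diracE oppr0 expR0 mulr1 expr0n.
  have [->|n0] := eqVneq n 0%N; first by rewrite mem_set// fact0 divr1.
  by rewrite mul0r memNset//= => /esym/eqP; rewrite (negbTE n0).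
by rewrite r0 esum_set1 /poisson_pmf ?r0// lee_fin !mulr_ge0// ?expR_ge0// exprn_ge0// ltW.
Qed.

Let count_pmf B n : R := fine (P (count_event R X B n)).

Let PcountE B n : measurable B -> P (count_event R X B n) = (count_pmf B n)%:E.
Proof. by move=> mB; rewrite fineK// fin_num_measure//; exact: measurable_count_event. Qed.

Let count_pgf B (s : R) : measurable B -> (0 <= s < 1)%R ->
  \sum_(n <oo) (s ^+ n * count_pmf B n)%:E = (expm ((1 - s)%:E * mu B))%:E.
Proof.
move=> mB /andP[s0 s1]; have := poissonX mB.
have : 0 <= mu B by [].
rewrite /has_poisson_law; case E1 : (mu B) => [r| |]//= r0 hP.
  rewrite lee_fin in r0.
  transitivity (\sum_(n <oo) ((expR (- r))%:E * ((s * r) ^+ n / n`!%:R)%:E)).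
    apply: eq_eseriesr => n _; rewrite /count_pmf hP poisson_probE//= -EFinM exprMn.
    by congr (_%:E); ring.
  rewrite nneseriesZl; last by move=> n _; rewrite lee_fin divr_ge0// exprn_ge0// mulr_ge0.
  rewrite nneseries_expR ?mulr_ge0// -EFinM -expRD.
  by congr (expR _)%:E; ring.
rewrite nneseries_const0 => [|n].
  by rewrite gt0_muley ?lte_fin ?subr_gt0.
suff -> : count_pmf B n = 0%R by rewrite mulr0.
rewrite /count_pmf; have -> : P (count_event R X B n) = 0 => //.
apply: (@subset_measure0 _ _ _ P _ (~` [set w | point_count R X B w = +oo])).
- exact: measurable_count_event.
- by apply: measurableC; exact: measurable_count_eq.
- by move=> w; rewrite /count_event/= => ->.
- have mN : measurable [set w | point_count R X B w = +oo].
    exact: measurable_count_eq.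
  by have := probability_setC P mN; rewrite hP subee// => <-.
Qed.

(* The generating functional at 1 - h with h simple: the points are grouped by
   the value of h, and the groups with value 0 contribute the factor 1. *)
Let generating_simple (h : {nnsfun E >-> R}) : (forall e, h e <= 1)%R ->
  \int[P]_w (\1_A w * \prod_(k < K) (1 - h (X k w)))%:E @[K --> \oo] -->
  P A * (expm (\int[mu]_e (h e)%:E))%:E.
Proof.
move=> h1.
have fr : finite_set (range h) by [].
pose r : seq R := fset_set (range h).
have ur : uniq r by exact: fset_uniq.
have hr e : h e \in r by rewrite in_fset_set// mem_set//; exists e.
pose L := size r.
pose x (i : 'I_L) : R := nth 0%R r i.
have x_inj : injective x.
  by move=> i j /eqP; rewrite nth_uniq ?ltn_ord// => /eqP ij; exact: val_inj.
have xr i : exists e, h e = x i.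
  have : x i \in r by exact: mem_nth.
  by rewrite in_fset_set// inE => -[e _ <-]; exists e.
have x0 i : (0 <= x i <= 1)%R by have [e <-] := xr i; rewrite h1 andbT.
pose B (i : 'I_L) : set E := h @^-1` [set x i].
have mB i : measurable (B i) by exact: measurable_funPTI.
have tB : trivIset setT B.
  apply/trivIsetP => i j _ _ ij; apply/seteqP; split => // e [/= he he'].
  by move: ij; rewrite (x_inj i j) ?eqxx// -he.
have hx (F : R -> R) e : F (h e) = (\prod_(i < L) F (x i) ^+ (e \in B i))%R.
  have ih : (index (h e) r < L)%N by rewrite index_mem.
  rewrite (bigD1 (Ordinal ih))//= big1 ?mulr1.
    by rewrite mem_set ?expr1 /B/= /x/= nth_index.
  move=> i ii; rewrite memNset ?expr0// => hi; move/eqP : ii; apply; apply: x_inj.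
  by rewrite -hi /x/= nth_index.
pose J := [seq i <- enum 'I_L | (0 < x i)%R].
have uJ : uniq J by apply: filter_uniq; exact: enum_uniq.
pose s i : R := if (0 < x i)%R then (1 - x i)%R else 0%R.
have s01 i : (0 <= s i < 1)%R.
  have /andP[xi0 xi1] := x0 i; rewrite /s; case: ifPn => xi; last by rewrite lexx ltr01.
  by rewrite subr_ge0 xi1/= ltrBlDr ltrDl.
have s0 i : (0 <= s i)%R by have /andP[] := s01 i.
have xJ i : i \in J -> (1 - s i = x i)%R.
  by rewrite mem_filter => /andP[xi _]; rewrite /s xi; ring.
have prodE K w : (\prod_(k < K) (1 - h (X k w)) = \prod_(i <- J) s i ^+ count_upto X (B i) K w)%R.
  rewrite (eq_bigr (fun k : 'I_K => \prod_(i < L) (1 - x i) ^+ (X k w \in B i))%R); last first.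
    by move=> k _; rewrite -(hx (fun y => 1 - y)%R).
  rewrite exchange_big/= big_filter [RHS]big_mkcond/= big_enum/=.
  apply: eq_bigr => i _; rewrite prodrXr -/(count_upto X (B i) K w) /s.
  have /andP[xi0 _] := x0 i; have [//|xi] := ltP 0%R (x i).
  suff -> : x i = 0%R by rewrite subr0 expr1n.
  by apply/eqP; rewrite eq_le xi0 xi.
have Glim w : (\prod_(k < K) (1 - h (X k w)))%R @[K --> \oo] -->
    (\prod_(i <- J) count_gen X (s i) (B i) w)%R.
  under eq_fun do rewrite prodE; apply: cvg_prod_seq => i.
  by have [] := count_genP X (B i) w (s01 i).
have -> : P A * (expm (\int[mu]_e (h e)%:E))%:E =
   \int[P]_w (\1_A w * \prod_(i <- J) count_gen X (s i) (B i) w)%:E.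
  have PA : P A = (fine (P A))%:E by rewrite fineK// fin_num_measure.
  rewrite (@weighted_generating 'I_L (fun i n => count_event R X (B i) n) s
    (fun i n => count_pmf (B i) n) (fun i => expm ((1 - s i)%:E * mu (B i)))
    (fun i => count_gen X (s i) (B i)) _ s0 _ _ _ _ _ J uJ (\1_A) (fine (P A)))//.
  - rewrite EFinM -PA; congr (_ * _%:E).
    have -> : \int[mu]_e (h e)%:E = \sum_(i <- J) (1 - s i)%:E * mu (B i).
      transitivity (\int[mu]_e (\sum_(i <- J) (x i)%:E * (\1_(B i) e)%:E)).
        apply: eq_integral => e _.
        under eq_bigr do rewrite -EFinM; rewrite sumEFin; congr (_%:E).
        have ih : (index (h e) r < L)%N by rewrite index_mem.
        rewrite big_filter big_mkcond big_enum/= (bigD1 (Ordinal ih))//= big1 ?addr0.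
          rewrite indicE mem_set ?mulr1 /B/= /x/= nth_index//.
          by case: ifPn => //; rewrite -leNgt => h0; apply/eqP; rewrite eq_le h0/=.
        move=> i ii; case: ifPn => // _; rewrite indicE memNset ?mulr0//= => hi.
        by move/eqP : ii; apply; apply: x_inj; rewrite -hi /x/= nth_index.
      rewrite ge0_integral_sum//.
      + apply: eq_big_seq => i iJ; rewrite ge0_integralZl//.
        * by rewrite integral_indic// setIT xJ.
        * exact/measurable_EFinP/measurable_indic.
        * by rewrite lee_fin; have /andP[] := x0 i.
      + by move=> i; apply/measurable_EFinP/measurable_funM => //; exact: measurable_indic.
      + by move=> i e _; rewrite mule_ge0// lee_fin//; have /andP[] := x0 i.
    apply: expm_sum => i; rewrite mule_ge0// lee_fin subr_ge0 ltW//.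
    by have /andP[] := s01 i.
  - by move=> i n; exact: measurable_count_event.
  - by move=> i n; rewrite /count_pmf fine_ge0.
  - by move=> i; exact: count_pgf.
  - by move=> i; exact: measurable_count_gen.
  - by move=> i w; have [] := count_genP X (B i) w (s01 i).
  - by move=> i w; have [] := count_genP X (B i) w (s01 i).
  - by rewrite fine_ge0.
  - move=> n; under eq_integral do rewrite prod_indic mul_indic.
    have mAB : measurable (A `&` \bigcap_(i in [set` J]) count_event R X (B i) (n i)).
      apply: measurableI => //; apply: fin_bigcap_measurable => // i _.
      exact: measurable_count_event.
    rewrite integral_indic// setIT.
    rewrite [LHS](indepX n uJ mB tB) EFinM -PA -prodEFin; congr (_ * _).
    by apply: eq_bigr => i _; exact: PcountE.
apply: cvg_integral01.
- move=> K; apply: measurable_funM => //.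
  apply: measurable_prod => k _; apply: measurable_funB => //.
  exact: measurableT_comp.
- move=> K w; have p01 : (0 <= \prod_(k < K) (1 - h (X k w)) <= 1)%R.
    apply/andP; split; first by apply: prodr_ge0 => k _; rewrite subr_ge0.
    by apply: prodr_ile1 => k _; rewrite subr_ge0 h1/= gerBl.
  rewrite indicE; case: (w \in A); rewrite ?mul1r// mul0r lexx ler01//.
- by move=> w; apply: cvgMr; exact: Glim.
Qed.

(** Simple functions increase to f; the limits in the approximation and in the
    number of points are exchanged by [cvg_exchange_squeeze]. *)
Theorem poisson_generating (f : E -> R) : measurable_fun setT f ->
  (forall e, 0 <= f e <= 1)%R ->
  \int[P]_w (\1_A w * \prod_(k < K) (1 - f (X k w)))%:E @[K --> \oo] -->
  P A * (expm (\int[mu]_e (f e)%:E))%:E.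
Proof.
move=> mf f01.
have f0 e : (0 <= f e)%R by have /andP[] := f01 e.
have f1 e : (f e <= 1)%R by have /andP[] := f01 e.
have mEf : measurable_fun setT (EFin \o f) by exact/measurable_EFinP.
pose h n : {nnsfun E >-> R} := nnsfun_approx measurableT mEf n.
have h_cvg e : h n e @[n --> \oo] --> f e.
  have := @cvg_nnsfun_approx _ _ _ setT measurableT _ mEf (fun x _ => f0 x) e I.
  by move=> /fine_cvgP[].
have h_nd e : {homo (fun n => h n e) : m n / (m <= n)%N >-> (m <= n)%R}.
  by move=> m n mn; have /lefP := nd_nnsfun_approx measurableT mEf mn; exact.
have hf n e : (h n e <= f e)%R.
  rewrite -(cvg_lim _ (h_cvg e))//; apply: nondecreasing_cvgn_le; first exact: h_nd.
  by apply/cvg_ex; exists (f e).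
have h0 n e : (0 <= h n e)%R by [].
have h1 n e : (h n e <= 1)%R by exact: le_trans (hf n e) (f1 e).
pose Z (g : E -> R) K w : R := (\1_A w * \prod_(k < K) (1 - g (X k w)))%R.
have Z01 (g : E -> R) K w : (forall e, 0 <= g e)%R -> (forall e, g e <= 1)%R -> (0 <= Z g K w <= 1)%R.
  move=> g0 g1; have p01 : (0 <= \prod_(k < K) (1 - g (X k w)) <= 1)%R.
    apply/andP; split; first by apply: prodr_ge0 => k _; rewrite subr_ge0.
    by apply: prodr_ile1 => k _; rewrite subr_ge0 g1/= gerBl.
  by rewrite /Z indicE; case: (w \in A); rewrite ?mul1r// mul0r lexx ler01//.
have mZ (g : E -> R) K : measurable_fun setT g -> measurable_fun setT (Z g K).
  move=> mg; apply: measurable_funM => //.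
  apply: measurable_prod => k _; apply: measurable_funB => //.
  exact: measurableT_comp.
have mEZ (g : E -> R) K : measurable_fun setT g -> measurable_fun setT (EFin \o Z g K).
  by move=> mg; apply/measurable_EFinP; exact: mZ.
have Zfin (g : E -> R) K : measurable_fun setT g -> (forall e, 0 <= g e)%R -> (forall e, g e <= 1)%R ->
    \int[P]_w (Z g K w)%:E \is a fin_num.
  move=> mg g0 g1; rewrite ge0_fin_numE.
    apply: (@le_lt_trans _ _ (\int[P]_w (cst 1 w))); last by rewrite integral_prob_cst ltry.
    apply: ge0_le_integral => //.
    - by move=> w _; rewrite lee_fin; have /andP[] := Z01 g K w g0 g1.
    - exact: mEZ.
    - by move=> w _; rewrite lee_fin; have /andP[] := Z01 g K w g0 g1.
  by apply: integral_ge0 => w _; rewrite lee_fin; have /andP[] := Z01 g K w g0 g1.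
have leZ (g g' : E -> R) K K' : measurable_fun setT g -> measurable_fun setT g' ->
    (forall e, 0 <= g e)%R -> (forall e, g e <= 1)%R ->
    (forall e, 0 <= g' e)%R -> (forall e, g' e <= 1)%R ->
    (forall w, Z g K w <= Z g' K' w)%R ->
    (fine (\int[P]_w (Z g K w)%:E) <= fine (\int[P]_w (Z g' K' w)%:E))%R.
  move=> mg mg' g0 g1 g'0 g'1 ZZ; apply: fine_le; [exact: Zfin|exact: Zfin|].
  apply: ge0_le_integral => //; [|exact: mEZ|exact: mEZ|by move=> w _; rewrite lee_fin].
  by move=> w _; rewrite lee_fin; have /andP[] := Z01 g K w g0 g1.
have mh n : measurable_fun setT (h n) by [].
have PA : P A = (fine (P A))%:E by rewrite fineK// fin_num_measure.
suff : fine (\int[P]_w (Z f K w)%:E) @[K --> \oo] -->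
    (fine (P A) * expm (\int[mu]_e (f e)%:E))%R.
  move=> ?; rewrite PA -EFinM; apply: cvg_EFin => //.
  by apply: nearW => K; exact: Zfin.
apply: (@cvg_exchange_squeeze _ (fun n K => fine (\int[P]_w (Z (h n) K w)%:E)) _
  (fun n => fine (P A) * expm (\int[mu]_e (h n e)%:E))%R).
- move=> n; have := generating_simple (h1 n).
  by rewrite PA -EFinM => /fine_cvgP[].
- move=> n K; apply: leZ => // w; rewrite /Z ler_wpM2l//.
  by apply: ler_prod => k _; rewrite subr_ge0 f1 lerB.
- move=> n K.
  have Znd : nonincreasing_seq (fun K => fine (\int[P]_w (Z (h n) K w)%:E)).
    apply/nonincreasing_seqP => K'; apply: leZ => // w; rewrite /Z ler_wpM2l//.
    rewrite big_ord_recr/= ler_piMr ?gerBl//.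
    by apply: prodr_ge0 => k _; rewrite subr_ge0.
  have cv : fine (\int[P]_w (Z (h n) K w)%:E) @[K --> \oo] -->
     (fine (P A) * expm (\int[mu]_e (h n e)%:E))%R.
    have := generating_simple (h1 n).
    by rewrite PA -EFinM => /fine_cvgP[].
  rewrite -(cvg_lim _ cv)//; apply: nonincreasing_cvgn_ge => //.
  by apply/cvg_ex; eexists; exact: cv.
- move=> K.
  suff : \int[P]_w (Z (h n) K w)%:E @[n --> \oo] --> (fine (\int[P]_w (Z f K w)%:E))%:E.
    by move=> /fine_cvgP[].
  rewrite fineK; last exact: Zfin.
  apply: cvg_integral01 => [n|n w|w]; [exact: mZ|exact: Z01|].
  apply: cvgMr; apply: cvg_prod_seq => k; apply: cvgB; first exact: cvg_cst.
  exact: h_cvg.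
- apply: cvgMr; apply: cvg_expm => [n|].
    by apply: integral_ge0 => e _; rewrite lee_fin.
  have -> : \int[mu]_e (f e)%:E = \int[mu]_e limn (fun n => (h n e)%:E).
    apply: eq_integral => e _; apply/esym/cvg_lim => //.
    by apply: cvg_EFin; [exact: nearW|exact: h_cvg].
  apply: cvg_monotone_convergence => //.
  - by move=> n; exact/measurable_EFinP.
  - by move=> n e _; rewrite lee_fin.
  - by move=> e _ m n mn; rewrite lee_fin; exact: h_nd.
Qed.

End generating_functional.

(** * Random marks and the classes of points *)
Section discrete_measurability.
Context d (Om : measurableType d) (C : countType).

Definition measurable_fibers (h : Om -> C) := forall c, measurable [set w | h w = c].

Lemma measurable_fibers_preimage (h : Om -> C) (D : set C) : measurable_fibers h ->
  measurable [set w | D (h w)].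
Proof.
move=> mh.
rewrite [X in measurable X](_ : _ =
  \bigcup_c (if pselect (D c) then [set w | h w = c] else set0)); last first.
  apply/seteqP; split => [w Dw|w [c _]]; last by case: pselect => //= Dc ->.
  by exists (h w) => //; case: pselect.
by apply: countable_bigcupT_measurable => [|c]; [exact: countableP|case: pselect => Dc; [exact: mh|exact: measurable0]].
Qed.

Lemma measurable_fibers_comp d' (S : measurableType d') (h : Om -> C)
    (g : C -> Om -> S) : measurable_fibers h ->
  (forall c, measurable_fun setT (g c)) ->
  measurable_fun setT (fun w => g (h w) w).
Proof.
move=> mh mg _ B mB; rewrite setTI.
rewrite [X in measurable X](_ : _ =
  \bigcup_c ([set w | h w = c] `&` g c @^-1` B)); last first.
  apply/seteqP; split => [w /= Bw|w [c _ [/= hc]]]; last by rewrite hc.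
  by exists (h w).
apply: countable_bigcupT_measurable => [|c]; first exact: countableP.
apply: measurableI; first exact: mh.
by rewrite -[X in measurable X]setTI; exact: mg.
Qed.

End discrete_measurability.

Section limits_ae.
Context d (Om : measurableType d) (R : realType) (P : probability Om R).

Lemma cvg_integral01_ae (F : nat -> Om -> R) (G : Om -> R) :
  (forall n, measurable_fun setT (F n)) -> measurable_fun setT G ->
  (forall n w, 0 <= F n w <= 1) ->
  {ae P, forall w, F n w @[n --> \oo] --> G w} ->
  (\int[P]_w (F n w)%:E @[n --> \oo] --> \int[P]_w (G w)%:E)%E.
Proof.
move=> mF mG F01 FG.
have [|||||_ _] := @dominated_convergence _ _ _ P setT measurableT
  (fun n w => (F n w)%:E) (fun w => (G w)%:E) (cst 1%E).
- by move=> n; exact/measurable_EFinP.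
- exact/measurable_EFinP.
- apply: filterS FG => w FGw _; apply: cvg_EFin => //; exact: nearW.
- exact: finite_measure_integrable_cst.
- apply: aeW => w n _ /=; have /andP[F0 F1] := F01 n w.
  by rewrite lee_fin ger0_norm.
- by [].
Qed.

End limits_ae.

Section hits.
Context d (Om : measurableType d) dS (S : measurableType dS).
Variables (Z : nat -> Om -> S) (B : set S).
Hypothesis mZ : forall k, measurable_fun setT (Z k).
Hypothesis mB : measurable B.

Definition fin_hits : set Om := [set w | exists K, forall k, (K <= k)%N -> ~ B (Z k w)].

(** The increasing list of the indices of the points in B; empty when there are
    infinitely many, an event that will have probability 0. *)
Definition hits (w : Om) : seq nat :=
  if pselect (fin_hits w) is left h
  then [seq k <- iota 0 (projT1 (cid h)) | Z k w \in B] else [::].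

Lemma mem_hits w k : fin_hits w -> (k \in hits w) = (Z k w \in B).
Proof.
move=> fw; rewrite /hits; case: pselect => // h.
case: (cid h) => K hK /=; rewrite mem_filter mem_iota add0n /=.
case: (boolP (Z k w \in B)) => //= /set_mem Bk.
by rewrite ltnNge; apply/negP => /hK.
Qed.

Lemma sorted_hits w : sorted ltn (hits w).
Proof.
rewrite /hits; case: pselect => // h.
by apply: sorted_filter; [exact: ltn_trans|exact: iota_ltn_sorted].
Qed.

Lemma uniq_hits w : uniq (hits w).
Proof. exact: (sorted_uniq ltn_trans ltnn (sorted_hits w)). Qed.

Lemma hits_eqP w s : fin_hits w -> sorted ltn s ->
  (forall k, (Z k w \in B) = (k \in s)) -> hits w = s.
Proof.
move=> fw ss h; apply: (irr_sorted_eq ltn_trans ltnn (sorted_hits w) ss) => k.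
by rewrite mem_hits.
Qed.

Let mZB k : measurable [set w | B (Z k w)].
Proof. by rewrite -[X in measurable X]setTI; exact: mZ. Qed.

Lemma measurable_fin_hits : measurable fin_hits.
Proof.
rewrite [X in measurable X](_ : _ =
  \bigcup_K \bigcap_(k in [set k | (K <= k)%N]) ~` [set w | B (Z k w)]).
  apply: bigcupT_measurable => K; apply: bigcap_measurableType => k _.
  exact: measurableC.
by apply/seteqP; split => w [K]; [move=> h; exists K|move=> _ h; exists K].
Qed.

Lemma measurable_hits : measurable_fibers hits.
Proof.
move=> s.
pose D := [set w | forall k, (Z k w \in B) = (k \in s)].
have mD : measurable D.
  rewrite [X in measurable X](_ : _ = \bigcap_k
     (if k \in s then [set w | B (Z k w)] else ~` [set w | B (Z k w)])).
    by apply: bigcap_measurableType => k _; case: ifP => _ //; exact: measurableC.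
  apply/seteqP; split => w h.
    move=> k _; have := h k; case: ifP => _ e /=; first by apply: set_mem; rewrite e.
    by move=> /mem_set; rewrite e.
  move=> k; have := h k I; case: ifP => _ /=; first by move/mem_set.
  by move=> nB; exact: memNset.
have [ss|ss] := boolP (sorted ltn s); last first.
  rewrite [X in measurable X](_ : _ = set0)//; apply/seteqP; split => // w /= hs.
  by move: ss; rewrite -hs sorted_hits.
have [->|s0] := eqVneq s [::].
  rewrite [X in measurable X](_ : _ = ~` fin_hits `|` \bigcap_k ~` [set w | B (Z k w)]).
    apply: measurableU; first by apply: measurableC; exact: measurable_fin_hits.
    by apply: bigcap_measurableType => k _; exact: measurableC.
  apply/seteqP; split => w /=.
    have [fw|fw] := pselect (fin_hits w); last by left.
    by move=> h; right => k _ /= /mem_set; rewrite -mem_hits// h.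
  move=> [fw|h]; first by rewrite /hits; case: pselect.
  apply: hits_eqP => //; first by exists 0%N => k _; exact: (h k I).
  by move=> k; rewrite in_nil; apply: memNset; exact: (h k I).
rewrite [X in measurable X](_ : _ = fin_hits `&` D).
  by apply: measurableI => //; exact: measurable_fin_hits.
apply/seteqP; split => w /=.
  have [fw|fw] := pselect (fin_hits w).
    by move=> hs; split => // k; rewrite -hs mem_hits.
  by rewrite /hits; case: pselect => // _ /esym/eqP; rewrite (negbTE s0).
by move=> [fw Dw]; exact: hits_eqP.
Qed.

(** Beyond the last hit every factor is 1. *)
Lemma prod_hits (R : realType) w (u : nat -> R) : fin_hits w ->
  \prod_(k < K) (if Z k w \in B then u k else 1) @[K --> \oo] -->
  \prod_(k <- hits w) u k.
Proof.
move=> fw; have [K hK] := fw; apply: cvg_near_cst; exists K => // L /= KL.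
rewrite -(big_mkord predT (fun k => if Z k w \in B then u k else 1)) -big_mkcond/=.
rewrite -big_filter /index_iota subn0.
rewrite (_ : [seq _ <- _ | _] = hits w)//; apply/esym/hits_eqP => //.
  by apply: sorted_filter; [exact: ltn_trans|exact: iota_ltn_sorted].
move=> k; rewrite mem_filter mem_iota add0n/=.
case: (boolP (Z k w \in B)) => //= /set_mem Bk.
by rewrite (leq_trans _ KL)// ltnNge; apply/negP => /hK.
Qed.

End hits.

Section marking.
Context d (Om : measurableType d) (R : realType) (P : probability Om R).
Context dE (E : measurableType dE) (X : nat -> Om -> E).
Context dT (T : measurableType dT) (lam : probability T R).
Hypothesis mX : forall k, measurable_fun setT (X k).
Local Open Scope ereal_scope.

Definition marks : probability (seqspace T) R := seqlaw (fun=> lam).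

Definition marked_space : measurableType _ := (Om * seqspace T)%type.

Definition marked_prob : probability marked_space R := P \x marks.

Definition marked_point k (w : marked_space) : E * T := (X k w.1, w.2 k).

Lemma measurable_marked_point k : measurable_fun setT (marked_point k).
Proof.
apply/measurable_fun_pairP; split.
  exact: (measurableT_comp (mX k) measurable_fst).
exact: (measurableT_comp (measurable_coord k) measurable_snd).
Qed.

Definition mark_mean (g : E * T -> R) (e : E) : R := fine (\int[lam]_t (g (e, t))%:E).

Section mark_mean_facts.
Variable g : E * T -> R.
Hypothesis mg : measurable_fun setT g.
Hypothesis g01 : forall z, (0 <= g z <= 1)%R.

Let g0 z : (0 <= g z)%R. Proof. by have /andP[] := g01 z. Qed.

Let mg1 e : measurable_fun setT (fun t => g (e, t)).
Proof. by apply: measurableT_comp => //; exact: measurable_pair1. Qed.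

Lemma mark_meanE e : (mark_mean g e)%:E = \int[lam]_t (g (e, t))%:E.
Proof.
rewrite fineK// ge0_fin_numE; last by apply: integral_ge0 => t _; rewrite lee_fin.
apply: (@le_lt_trans _ _ (\int[lam]_t (cst 1 t))); last by rewrite integral_prob_cst ltry.
apply: ge0_le_integral => //.
- by move=> t _; rewrite lee_fin.
- exact/measurable_EFinP.
- by move=> t _; rewrite lee_fin; have /andP[] := g01 (e, t).
Qed.

Lemma mark_mean01 e : (0 <= mark_mean g e <= 1)%R.
Proof.
rewrite -!lee_fin mark_meanE; apply/andP; split.
  by apply: integral_ge0 => t _; rewrite lee_fin.
rewrite -[leRHS](integral_prob_cst lam); apply: ge0_le_integral => //.
- by move=> t _; rewrite lee_fin.
- exact/measurable_EFinP.
- by move=> t _; rewrite lee_fin; have /andP[] := g01 (e, t).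
Qed.

Lemma measurable_mark_mean : measurable_fun setT (mark_mean g).
Proof.
apply: measurableT_comp => //.
apply: (@measurable_fun_fubini_tonelli_F _ _ E T R lam (fun z => (g z)%:E)).
  exact/measurable_EFinP.
by move=> z; rewrite lee_fin.
Qed.

(** Given the points, the marks are independent and can be integrated out. *)
Lemma integral_marked_prod (A : set Om) K : measurable A ->
  \int[marked_prob]_w (\1_A w.1 * \prod_(k < K) g (marked_point k w))%:E =
  \int[P]_w (\1_A w * \prod_(k < K) mark_mean g (X k w))%:E.
Proof.
move=> mA.
pose F (w : Om * seqspace T) := (\1_A w.1 * \prod_(k < K) g (marked_point k w))%:E : \bar R.
have mF : measurable_fun setT F.
  apply/measurable_EFinP; apply: measurable_funM.
    have mI : measurable_fun setT (\1_A : Om -> R) by exact: measurable_indic.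
    exact: (measurableT_comp mI measurable_fst).
  apply: measurable_prod => k _.
  exact: (measurableT_comp mg (measurable_marked_point k)).
have F0 w : 0 <= F w by rewrite lee_fin mulr_ge0// prodr_ge0.
rewrite [LHS](@fubini_tonelli1 _ _ Om (seqspace T) R P marks F mF F0).
apply: eq_integral => w _; rewrite /fubini_F /F/=.
under eq_integral do rewrite EFinM.
have mG k : measurable_fun setT (fun t : T => g (X k w, t)) by exact: mg1.
rewrite ge0_integralZl//; last 2 first.
- apply/measurable_EFinP/measurable_prod => k _.
  exact: (measurableT_comp (mG k) (measurable_coord k)).
- by move=> x _; rewrite lee_fin prodr_ge0.
rewrite EFinM; congr (_ * _).
transitivity (\int[marks]_x (\prod_(k <- iota 0 K) g (X k w, x k))%:E).
  apply: eq_integral => x _; congr (_%:E).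
  by rewrite -(big_mkord predT (fun k => g (X k w, x k))) /index_iota subn0.
rewrite [LHS](@integral_seqlaw_prod _ T R (fun=> lam) (iota 0 K) (fun k t => g (X k w, t)) (iota_uniq 0 K) mG)//.
rewrite -(big_mkord predT (fun k => mark_mean g (X k w))) /index_iota subn0 -prodEFin.
by apply: eq_bigr => k _; rewrite mark_meanE.
Qed.

End mark_mean_facts.

Variable (mu : {measure set E -> \bar R}) (I : eqType) (color : E * T -> option I).
Hypothesis mcolor : forall c, measurable [set z | color z = Some c].

Definition colored (c : I) : set (E * T) := [set z | color z = Some c].

Definition color_prob c : E -> R := mark_mean (\1_(colored c)).

Let mind c : measurable_fun setT (\1_(colored c) : E * T -> R).
Proof. by apply: measurable_indic; exact: mcolor. Qed.

Let ind01 c z : (0 <= (\1_(colored c) z : R) <= 1)%R.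
Proof. by rewrite indicE ler0n lern1 leq_b1. Qed.

Lemma color_prob01 c e : (0 <= color_prob c e <= 1)%R.
Proof. exact: mark_mean01. Qed.

Lemma measurable_color_prob c : measurable_fun setT (color_prob c).
Proof. exact: measurable_mark_mean. Qed.

(** \int (1 - f) dmu_c, where mu_c has density [color_prob c] with respect to mu:
    it is the mean measure of the points of color c. *)
Definition color_int c (f : E -> R) : \bar R := \int[mu]_e (color_prob c e * (1 - f e))%:E.

(** The factor contributed by a marked point to the product over the classes C
    of the products of f c over the points of color c. *)
Definition color_weight (C : seq I) (f : I -> E -> R) (z : E * T) : R :=
  \prod_(c <- C) (1 - \1_(colored c) z * (1 - f c z.1)).

Section color_weight.
Variables (C : seq I) (f : I -> E -> R).
Hypothesis uC : uniq C.
Hypothesis mf : forall c, measurable_fun setT (f c).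
Hypothesis f01 : forall c e, (0 <= f c e <= 1)%R.

Let f0 c e : (0 <= f c e)%R. Proof. by have /andP[] := f01 c e. Qed.
Let f1 c e : (f c e <= 1)%R. Proof. by have /andP[] := f01 c e. Qed.

(** A point has at most one color, so at most one factor differs from 1. *)
Lemma color_weightE z : (color_weight C f z =
  1 - \sum_(c <- C) \1_(colored c) z * (1 - f c z.1))%R.
Proof.
have H0 (D : seq I) c : color z = Some c -> c \notin D ->
    (\prod_(c' <- D) (1 - \1_(colored c') z * (1 - f c' z.1)) = 1 /\
     \sum_(c' <- D) \1_(colored c') z * (1 - f c' z.1) = 0 :> R)%R.
  move=> zc; elim: D => [|c' D IH]; first by rewrite !big_nil.
  rewrite inE negb_or => /andP[cc' /IH[h1 h2]]; rewrite !big_cons h1 h2.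
  rewrite indicE memNset /=; first by rewrite mul0r subr0 mul1r add0r.
  by rewrite /colored/= zc => -[] /eqP; rewrite (negbTE cc').
case Ez : (color z) => [c|]; last first.
  rewrite /color_weight; elim: (C) => [|c D IH]; first by rewrite !big_nil subr0.
  rewrite !big_cons IH indicE memNset /=; first by rewrite mul0r subr0 mul1r add0r.
  by rewrite /colored/= Ez.
rewrite /color_weight; elim: (C) uC => [|c' D IH]; first by rewrite !big_nil subr0.
move=> /= /andP[c'D uD]; rewrite !big_cons.
have [cc'|cc'] := eqVneq c c'.
  by rewrite -cc' in c'D *; have [-> ->] := H0 D c Ez c'D; ring.
rewrite IH// indicE memNset /=; first by rewrite mul0r subr0 mul1r add0r.
by rewrite /colored/= Ez => -[] /eqP; rewrite (negbTE cc').
Qed.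

Let factor01 c z : (0 <= 1 - (\1_(colored c) z : R) * (1 - f c z.1) <= 1)%R.
Proof.
rewrite indicE; case: (z \in colored c); rewrite ?mul1r ?mul0r ?subr0 ?ler01 ?lexx//.
by rewrite opprB addrC subrK f0 f1.
Qed.

Lemma color_weight01 z : (0 <= color_weight C f z <= 1)%R.
Proof.
apply/andP; split; first by apply: prodr_ge0 => c _; have /andP[] := factor01 c z.
by apply: prodr_ile1 => c _; exact: factor01.
Qed.

Lemma measurable_color_weight : measurable_fun setT (color_weight C f).
Proof.
apply: measurable_prod => c _; apply: measurable_funB => //; apply: measurable_funM => //.
apply: measurable_funB => //.
exact: (measurableT_comp (mf c) measurable_fst).
Qed.

Lemma mark_mean_color_weight e : (mark_mean (color_weight C f) e =
  1 - \sum_(c <- C) color_prob c e * (1 - f c e))%R.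
Proof.
pose s t : R := (\sum_(c <- C) \1_(colored c) (e, t) * (1 - f c e))%R.
have mind1 c : measurable_fun setT (fun t => \1_(colored c) (e, t) : R).
  by apply: measurableT_comp => //; exact: measurable_pair1.
have Is : \int[lam]_t (s t)%:E = (\sum_(c <- C) color_prob c e * (1 - f c e))%:E.
  rewrite /s; under eq_integral do rewrite -sumEFin.
  rewrite ge0_integral_sum//; last 2 first.
  - by move=> c; apply/measurable_EFinP/measurable_funM.
  - by move=> c t _; rewrite lee_fin mulr_ge0// subr_ge0.
  rewrite -sumEFin; apply: eq_bigr => c _.
  under eq_integral do rewrite EFinM.
  rewrite ge0_integralZr//; last 2 first.
  - exact/measurable_EFinP.
  - by rewrite lee_fin subr_ge0.
  by rewrite EFinM /color_prob mark_meanE.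
have h : (mark_mean (color_weight C f) e)%:E + \int[lam]_t (s t)%:E = 1.
  rewrite mark_meanE; [|exact: measurable_color_weight|exact: color_weight01].
  rewrite -ge0_integralD//.
  - rewrite -[RHS](integral_prob_cst lam); apply: eq_integral => t _.
    by rewrite -EFinD color_weightE/= subrK.
  - by move=> t _; rewrite lee_fin; have /andP[] := color_weight01 (e, t).
  - apply/measurable_EFinP; apply: measurableT_comp; first exact: measurable_color_weight.
    exact: measurable_pair1.
  - by move=> t _; rewrite lee_fin sumr_ge0// => c _; rewrite mulr_ge0// subr_ge0.
  - by apply/measurable_EFinP; apply: measurable_sum => c; exact: measurable_funM.
by move: h; rewrite Is -EFinD => -[] h; apply/eqP; rewrite eq_sym subr_eq eq_sym; exact/eqP.
Qed.

Variable A : set Om.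
Hypothesis mA : measurable A.
Hypothesis generating : forall g : E -> R, measurable_fun setT g ->
  (forall e, 0 <= g e <= 1)%R ->
  \int[P]_w (\1_A w * \prod_(k < K) (1 - g (X k w)))%:E @[K --> \oo] -->
  P A * (expm (\int[mu]_e (g e)%:E))%:E.

(** Averaging [color_weight] over the mark gives 1 - g, where
    \int g dmu = \sum_c [color_int c (f c)]. *)
Lemma colored_generating :
  \int[marked_prob]_w (\1_A w.1 * \prod_(k < K) color_weight C f (marked_point k w))%:E
    @[K --> \oo] -->
  P A * (\prod_(c <- C) expm (color_int c (f c)))%:E.
Proof.
pose g e := (\sum_(c <- C) color_prob c e * (1 - f c e))%R.
have gE e : (1 - g e = mark_mean (color_weight C f) e)%R.
  by rewrite mark_mean_color_weight.
have mg : measurable_fun setT g.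
  apply: measurable_sum => c; apply: measurable_funM; first exact: measurable_color_prob.
  exact: measurable_funB.
have g01 e : (0 <= g e <= 1)%R.
  have := mark_mean01 measurable_color_weight color_weight01 e; rewrite -gE.
  by rewrite subr_ge0 andbC lerBlDr lerDl.
have := generating mg g01.
have -> : \int[mu]_e (g e)%:E = \sum_(c <- C) color_int c (f c).
  rewrite /g; under eq_integral do rewrite -sumEFin.
  rewrite ge0_integral_sum//.
    move=> c; apply/measurable_EFinP/measurable_funM; first exact: measurable_color_prob.
    exact: measurable_funB.
  by move=> c e _; rewrite lee_fin mulr_ge0 ?subr_ge0//; have /andP[] := color_prob01 c e.
rewrite expm_sum; last first.
  move=> c; apply: integral_ge0 => e _.
  by rewrite lee_fin mulr_ge0 ?subr_ge0//; have /andP[] := color_prob01 c e.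
apply: cvg_trans; apply: near_eq_cvg; apply: nearW => K.
rewrite [RHS]integral_marked_prod//; [|exact: measurable_color_weight|exact: color_weight01].
by apply: eq_integral => w _; under eq_bigr do rewrite gE.
Qed.

End color_weight.

End marking.

Section finite_counts.
Context d (Om : measurableType d) (R : realType).
Context dS (S : measurableType dS) (Z : nat -> Om -> S).

Lemma fin_hits_count (B : set S) w n K0 :
  (forall K, (K0 <= K)%N -> count_upto Z B K w = n) -> fin_hits Z B w.
Proof.
move=> cK; exists K0 => k kK Bk.
have := cK k.+1 (leqW kK); rewrite /count_upto big_ord_recr/= -/(count_upto Z B k w).
by rewrite (cK k kK) mem_set// addn1 => /eqP; rewrite eqn_leq ltnn.
Qed.

Lemma count_gen_le1 (B : set S) (s : R) w : 0 <= s < 1 ->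
  count_gen Z s B w <= \1_(fin_hits Z B) w.
Proof.
move=> s01; rewrite indicE; case: (boolP (w \in _)) => [_|/negP nf].
  have [_ _ cv] := count_genP Z B w s01.
  rewrite -(cvg_lim _ cv)//; apply: limr_le; first by apply/cvg_ex; eexists; exact: cv.
  by apply: nearW => K; have /andP[s0 s1] := s01; rewrite exprn_ile1// ltW.
rewrite /count_gen nneseries_const0//= => n.
rewrite indicE memNset ?mulr0// => /= wn; apply: nf.
have [[m [K0 [cK _]]]|[pc _]] := count_dichotomy R Z B w; last by have := pc n wn.
by apply/mem_set/fin_hits_count; exact: cK.
Qed.

End finite_counts.

Section coloring.
Context d (Om : measurableType d) (R : realType) (P : probability Om R).
Context dE (E : measurableType dE) (X : nat -> Om -> E).
Context dT (T : measurableType dT) (lam : probability T R).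
Hypothesis mX : forall k, measurable_fun setT (X k).
Variable (mu : {measure set E -> \bar R}) (I : eqType) (color : E * T -> option I).
Hypothesis mcolor : forall c, measurable [set z | color z = Some c].
Local Open Scope ereal_scope.

Definition generating_formula (A : set Om) := forall g : E -> R,
  measurable_fun setT g -> (forall e, 0 <= g e <= 1)%R ->
  \int[P]_w (\1_A w * \prod_(k < K) (1 - g (X k w)))%:E @[K --> \oo] -->
  P A * (expm (\int[mu]_e (g e)%:E))%:E.

Hypothesis generatingT : generating_formula setT.

Local Notation P1 := (marked_prob P lam).
Local Notation Z := (@marked_point _ Om _ E X _ T).

Definition color_class (c : I) (w : marked_space Om T) : seq nat :=
  hits Z (colored color c) w.

Definition color_mass (c : I) : \bar R := \int[mu]_e (color_prob lam color c e)%:E.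

Let mZ := measurable_marked_point mX (T := T).

Let p01 c e : (0 <= color_prob lam color c e <= 1)%R.
Proof. exact: color_prob01. Qed.

Lemma color_int_cst c (s : R) : (0 <= s <= 1)%R ->
  color_int lam mu color c (fun=> s) = (1 - s)%:E * color_mass c.
Proof.
move=> /andP[s0 s1]; rewrite /color_int /color_mass -ge0_integralZl//.
- by apply: eq_integral => e _; rewrite mulrC EFinM.
- by apply/measurable_EFinP; exact: measurable_color_prob.
- by move=> e _; rewrite lee_fin; have /andP[] := p01 c e.
- by rewrite lee_fin subr_ge0.
Qed.

(** s^N has mean exp(- (1 - s) M) and is at most the indicator of N finite; let
    s tend to 1. *)
Lemma ae_fin_hits c : color_mass c < +oo ->
  {ae P1, forall w, fin_hits Z (colored color c) w}.
Proof.
move=> Moo.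
have M0 : 0 <= color_mass c.
  by apply: integral_ge0 => e _; rewrite lee_fin; have /andP[] := p01 c e.
have mF := measurable_fin_hits mZ (mcolor c).
have lb (s : R) : (0 <= s < 1)%R ->
    (expm ((1 - s)%:E * color_mass c))%:E <= P1 (fin_hits Z (colored color c)).
  move=> s01; have /andP[s0 s1] := s01.
  have s01' : (0 <= s <= 1)%R by rewrite s0 ltW.
  have cw : \int[P1]_w ((s ^+ count_upto Z (colored color c) K w)%:E) @[K --> \oo] -->
     (expm ((1 - s)%:E * color_mass c))%:E.
    have := @colored_generating _ _ R P _ E X _ T lam mX mu I color mcolor [:: c] (fun _ _ => s)
      isT (fun _ => measurable_cst _) (fun _ _ => s01') setT measurableT generatingT.
    rewrite probability_setT mul1e big_seq1 color_int_cst//.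
    apply: cvg_trans; apply: near_eq_cvg; apply: nearW => K.
    apply: eq_integral => w _; congr (_%:E).
    rewrite indicT mul1r /count_upto -prodrXr; apply: eq_bigr => k _.
    rewrite /color_weight big_seq1 indicE; case: (_ \in _) => /=.
      by rewrite mul1r expr1 subKr.
    by rewrite mul0r subr0 expr0.
  have cg : \int[P1]_w ((s ^+ count_upto Z (colored color c) K w)%:E) @[K --> \oo] -->
     \int[P1]_w (count_gen Z s (colored color c) w)%:E.
    apply: cvg_integral01.
    - move=> K; rewrite (_ : (fun _ => _) = fun w =>
        (\prod_(k < K) (s ^+ (Z k w \in colored color c)))%R); last first.
        by apply/funext => w; rewrite prodrXr.
      apply: measurable_prod => k _.
      rewrite (_ : (fun _ => _) = fun w =>
         (1 - (1 - s) * \1_(colored color c) (Z k w))%R); last first.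
        apply/funext => w; rewrite indicE; case: (_ \in _) => /=.
          by rewrite mulr1 expr1 subKr.
        by rewrite mulr0 subr0 expr0.
      apply: measurable_funB => //; apply: measurable_funM => //.
      have mI : measurable_fun setT (\1_(colored color c) : E * T -> R).
        by apply: measurable_indic; exact: mcolor.
      exact: (measurableT_comp mI (mZ k)).
    - by move=> K w; rewrite exprn_ge0//= exprn_ile1// ltW.
    - by move=> w; have [] := count_genP Z (colored color c) w s01.
  rewrite -(cvg_lim _ cw)// (cvg_lim _ cg)//.
  rewrite -[X in _ <= P1 X]setIT -integral_indic//.
  apply: ge0_le_integral => //.
  - by move=> w _; rewrite lee_fin; have [] := count_genP Z (colored color c) w s01.
  - apply/measurable_EFinP; apply: measurable_count_gen => //; exact: mcolor.
  - exact/measurable_EFinP/measurable_indic.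
  - by move=> w _; rewrite lee_fin count_gen_le1.
have P1F : P1 (fin_hits Z (colored color c)) = 1.
  apply/eqP; rewrite eq_le probability_le1//=.
  have cv : (expm ((n.+1%:R^-1)%:E * color_mass c))%:E @[n --> \oo] --> (1%:E : \bar R).
    apply: cvg_EFin; first exact: nearW.
    rewrite -[X in _ --> X]expm0; apply: cvg_expm => [n|].
      by rewrite mule_ge0// lee_fin.
    rewrite -[X in _ --> X](mul0e (color_mass c)).
    rewrite -(fineK (x := color_mass c)) ?ge0_fin_numE//.
    under eq_fun do rewrite -EFinM; rewrite -EFinM.
    apply: cvg_EFin; first exact: nearW.
    by apply: cvgMl; exact: cvg_harmonic.
  rewrite -(cvg_lim _ cv)//; apply: lime_le; first by apply/cvg_ex; eexists; exact: cv.
  apply: nearW => n.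
  have := lb (1 - n.+1%:R^-1)%R; rewrite subKr; apply.
  by rewrite subr_ge0 invf_le1// ler1n/= ltrBlDr ltrDl invr_gt0.
apply/negligibleP; first exact: measurableC.
by have := probability_setC P1 mF; rewrite P1F subee.
Qed.

Definition class_prod c (f : E -> R) (w : marked_space Om T) : R :=
  \prod_(k <- color_class c w) f (X k w.1).

Lemma measurable_color_class c : measurable_fibers (color_class c).
Proof. by apply: measurable_hits => //; exact: mcolor. Qed.

Lemma measurable_class_prod c (f : E -> R) : measurable_fun setT f ->
  measurable_fun setT (class_prod c f).
Proof.
move=> mf.
pose g (s : seq nat) (w : marked_space Om T) := (\prod_(k <- s) f (X k w.1))%R.
apply: (@measurable_fibers_comp _ _ (seq nat) _ _ (color_class c) g); first exact: measurable_color_class.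
move=> s; apply: measurable_prod => k _; apply: measurableT_comp => //.
exact: (measurableT_comp (mX k) measurable_fst).
Qed.

Lemma class_prod01 c (f : E -> R) w : (forall e, 0 <= f e <= 1)%R ->
  (0 <= class_prod c f w <= 1)%R.
Proof.
move=> f01; apply/andP; split.
  by apply: prodr_ge0 => k _; have /andP[] := f01 (X k w.1).
by apply: prodr_ile1 => k _.
Qed.

(** Almost surely each color of C has finitely many points, and then the
    products over the first K points are eventually constant in K. *)
Theorem integral_class_prod (A : set Om) (C : seq I) (f : I -> E -> R) :
  measurable A -> generating_formula A -> uniq C ->
  (forall c, c \in C -> color_mass c < +oo) ->
  (forall c, measurable_fun setT (f c)) -> (forall c e, 0 <= f c e <= 1)%R ->
  \int[P1]_w (\1_A w.1 * \prod_(c <- C) class_prod c (f c) w)%:E =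
  P A * (\prod_(c <- C) expm (color_int lam mu color c (f c)))%:E.
Proof.
move=> mA genA uC Moo mf f01.
have cw := @colored_generating _ _ R P _ E X _ T lam mX mu I color mcolor C f
      uC mf f01 A mA genA.
rewrite -(cvg_lim _ cw)//; apply/esym/cvg_lim => //.
have mI : measurable_fun setT (fun w : marked_space Om T => \1_A w.1 : R).
  have mI : measurable_fun setT (\1_A : Om -> R) by exact: measurable_indic.
  exact: (measurableT_comp mI measurable_fst).
apply: cvg_integral01_ae.
- move=> K; apply: measurable_funM => //.
  apply: measurable_prod => k _; apply: measurableT_comp => //.
  exact: measurable_color_weight.
- apply: measurable_funM => //; apply: measurable_prod => c _.
  exact: measurable_class_prod.
- move=> K w; rewrite indicE; case: (_ \in A); rewrite ?mul0r ?lexx ?ler01// mul1r.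
  apply/andP; split.
    by apply: prodr_ge0 => k _; have /andP[] := color_weight01 color C f01 (Z k w).
  by apply: prodr_ile1 => k _; exact: color_weight01.
have : {ae P1, forall w, forall c, c \in C -> fin_hits Z (colored color c) w}.
  elim: (C) Moo => [_|c D IH Moo]; first exact: aeW.
  have h1 := ae_fin_hits (Moo c (mem_head _ _)).
  have h2 : {ae P1, forall w, forall c, c \in D -> fin_hits Z (colored color c) w}.
    by apply: IH => c' c'D; apply: Moo; rewrite inE c'D orbT.
  apply: filterS2 h1 h2 => w w1 w2 c'; rewrite inE => /orP[/eqP ->//|]; exact: w2.
apply: filterS => w fw; apply: cvgMr.
rewrite (_ : (fun _ => _) = fun K => (\prod_(c <- C) \prod_(k < K)
   (if Z k w \in colored color c then f c (X k w.1) else 1))%R); last first.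
  apply/funext => K; rewrite exchange_big/=; apply: eq_bigr => k _.
  apply: eq_bigr => c _; rewrite indicE; case: (_ \in _) => /=.
    by rewrite mul1r subKr.
  by rewrite mul0r subr0.
elim: (C) fw => [|c D IH] fw.
  by rewrite big_nil; under eq_fun do rewrite big_nil; exact: cvg_cst.
rewrite big_cons; under eq_fun do rewrite big_cons; apply: cvgM.
  by apply: (prod_hits (Z := Z)); exact: fw c (mem_head _ _).
by apply: IH => c' c'D; apply: fw; rewrite inE c'D orbT.
Qed.

End coloring.

(** * Ryser's formula and uniqueness of power series *)
Section permanent.
Context {R : numDomainType} (n : nat).

(** Adding or removing i, a value that f misses, pairs the sets J containing the
    values of f with opposite signs. *)
Lemma alternating_supersets (f : {ffun 'I_n -> 'I_n}) (i : 'I_n) :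
  (forall k, f k != i) ->
  \sum_(J : {set 'I_n} | f \in ffun_on (mem J)) (-1) ^+ #|~: J| = 0 :> R.
Proof.
move=> fi; pose h (J : {set 'I_n}) := if i \in J then J :\ i else i |: J.
have hK : involutive h.
  move=> J; rewrite /h; case: (boolP (i \in J)) => iJ.
    by rewrite setD11 finset.setD1K.
  by rewrite setU11 finset.setU1K.
have hf J : (f \in ffun_on (mem (h J))) = (f \in ffun_on (mem J)).
  apply/ffun_onP/ffun_onP => fJ k; have := fJ k; rewrite /h; case: ifP => _.
  - by rewrite !inE => /andP[].
  - by rewrite !inE (negbTE (fi k)).
  - by rewrite !inE fi.
  - by rewrite !inE => ->; rewrite orbT.
have hs J : (-1) ^+ #|~: h J| = - (-1) ^+ #|~: J| :> R.
  rewrite /h; case: (boolP (i \in J)) => iJ.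
    have -> : ~: (J :\ i) = i |: ~: J by rewrite finset.setDE finset.setCI finset.setCK finset.setUC.
    by rewrite cardsU1 inE negbK iJ exprS mulN1r.
  have -> : ~: (i |: J) = ~: J :\ i by rewrite finset.setCU finset.setIC finset.setDE.
  by rewrite [in RHS](cardsD1 i (~: J)) inE iJ exprS mulN1r opprK.
set S := (X in X = 0).
suff : S = - S by move/eqP; rewrite -addr_eq0 -mulr2n mulrn_eq0 /= => /eqP.
rewrite {1}/S (reindex_inj (inv_inj hK)) -sumrN.
by apply: eq_big => [J|J _]; [exact: hf|exact: hs].
Qed.

(** Ryser's formula: inclusion-exclusion over the set of rows that are used
    turns a permanent into an alternating sum of products of row sums. *)
Lemma permanent_Ryser (a : 'I_n -> 'I_n -> R) :
  \sum_(s : 'S_n) \prod_j a j (s j) =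
  \sum_(J : {set 'I_n}) (-1) ^+ #|~: J| * \prod_k \sum_(j in J) a j k.
Proof.
symmetry.
transitivity (\sum_(f : {ffun 'I_n -> 'I_n})
   (\prod_k a (f k) k) * \sum_(J : {set 'I_n} | f \in ffun_on (mem J)) (-1) ^+ #|~: J|).
  under eq_bigr => J _.
    rewrite (bigA_distr_big (mem J) (fun k j => a j k)) big_distrr/= big_mkcond; over.
  rewrite exchange_big/=; apply: eq_bigr => f _.
  rewrite big_distrr/= [RHS]big_mkcond; apply: eq_bigr => J _.
  by case: ifP => // _; rewrite mulrC.
rewrite (bigID (fun f : {ffun 'I_n -> 'I_n} => injectiveb f)) /= addrC big1 ?add0r => [|f Uf]; last first.
  have /existsP[i /forallP fi] : [exists i, [forall k, f k != i]].
    apply: contraR Uf => /existsPn h.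
    have sf : codom f =i predT.
      move=> i; have := h i; rewrite negb_forall => /existsP[k]; rewrite negbK => /eqP <-.
      by rewrite codom_f.
    apply/injectiveP => x y; apply: (@image_injP _ _ f predT) => //.
    by rewrite (eq_card sf).
  by rewrite (alternating_supersets fi) mulr0.
rewrite (reindex (@pval _)) /=; last first.
  pose in_Sn := insubd (1%g : 'S_n).
  by exists in_Sn => /= f Uf; first apply: val_inj; apply: insubdK.
rewrite [RHS](reindex_inj invg_inj)/=.
apply: eq_big => /= [s | s _]; first by rewrite (valP s).
rewrite (big_pred1 finset.setT) ?finset.setCT ?cards0 ?expr0 ?mulr1.
  rewrite [RHS](reindex_perm s)/=; apply: eq_bigr => i _.
  by rewrite permK pvalE.
move=> J; apply/ffun_onP/eqP => [fJ|-> k]; last by rewrite inE.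
apply/setP => i; rewrite inE.
by have := fJ (s^-1 i)%g; rewrite pvalE permKV.
Qed.

End permanent.

Section power_series.
Context {R : realType}.
Local Open Scope ereal_scope.

Let geo_le2 (s : R) m : (0 <= s)%R -> (s <= 2^-1)%R -> (\sum_(i < m) s ^+ i <= 2)%R.
Proof.
move=> s0 s1; have := subrX1 s m; rewrite -opprB -[X in (_ = X * _)%R]opprB mulNr => /oppr_inj h.
have : ((1 - s) * \sum_(i < m) s ^+ i <= 1)%R by rewrite -h gerBl exprn_ge0.
move=> h2.
have sg0 : (0 <= \sum_(i < m) s ^+ i)%R by apply: sumr_ge0 => i _; exact: exprn_ge0.
by nra.
Qed.

Let coef_le (a b : nat -> R) (c : R) n : (forall n, 0 <= a n)%R ->
  (forall n, 0 <= b n <= c)%R -> (forall i, (i < n)%N -> a i = b i) ->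
  (forall s : R, (0 <= s < 1)%R ->
    \sum_(n <oo) (s ^+ n * a n)%:E = \sum_(n <oo) (s ^+ n * b n)%:E) ->
  (a n <= b n)%R.
Proof.
move=> a0 b0 ab H.
have c0 : (0 <= c)%R by have /andP[/le_trans h1 /h1] := b0 0%N.
have key (s : R) : (0 < s)%R -> (s <= 2^-1)%R -> (a n <= b n + 2 * c * s)%R.
  move=> s0 s1.
  have s01 : (0 <= s < 1)%R by rewrite ltW//= (le_lt_trans s1)// invf_lt1// ltr1n.
  have lo : (\sum_(i < n.+1) s ^+ i * a i)%:E <= \sum_(i <oo) (s ^+ i * a i)%:E.
    rewrite -sumEFin -(big_mkord predT (fun i => (s ^+ i * a i)%:E)).
    by apply: nneseries_lim_ge => i _ _; rewrite lee_fin mulr_ge0// exprn_ge0// ltW.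
  have hi : \sum_(i <oo) (s ^+ i * b i)%:E <=
      (\sum_(i < n.+1) s ^+ i * b i + 2 * c * s ^+ n.+1)%:E.
    apply: lime_le.
      apply: is_cvg_nneseries => i _ _; rewrite lee_fin mulr_ge0//.
        by rewrite exprn_ge0// ltW.
      by have /andP[] := b0 i.
    exists n.+1 => // K /= nK; rewrite -(subnKC nK) sumEFin lee_fin.
    rewrite big_mkord big_split_ord/= lerD2l.
    apply: (@le_trans _ _ (\sum_(i < K - n.+1) (c * s ^+ n.+1) * s ^+ i)%R).
      apply: ler_sum => i _; rewrite exprD mulrC -mulrA ler_wpM2r//.
        by rewrite mulr_ge0// exprn_ge0// ltW.
      by have /andP[] := b0 (n.+1 + i)%N.
    rewrite -mulr_sumr.
    rewrite [leRHS](_ : _ = c * s ^+ n.+1 * 2)%R; last by ring.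
    by rewrite ler_wpM2l ?mulr_ge0 ?exprn_ge0 ?geo_le2// ltW.
  rewrite (H s s01) in lo; have := le_trans lo hi.
  rewrite lee_fin !big_ord_recr/=.
  have -> : (\sum_(i < n) s ^+ i * a i = \sum_(i < n) s ^+ i * b i)%R.
    by apply: eq_bigr => i _; rewrite ab.
  rewrite -addrA lerD2l exprS => h.
  rewrite -(ler_pM2l (exprn_gt0 n s0)) mulrDr (le_trans h)// lerD2l.
  by rewrite [leLHS](_ : _ = s ^+ n * (2 * c * s))%R//; ring.
apply/ler_addgt0Pr => e e0.
pose s : R := Num.min (2^-1)%R (e / (2 * c + 1))%R.
have d0 : (0 < 2 * c + 1)%R by rewrite ltr_wpDl// mulr_ge0.
have s0 : (0 < s)%R by rewrite lt_min invr_gt0 ltr0n/= divr_gt0.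
apply: (le_trans (key s s0 _)); first by rewrite ge_min lexx.
rewrite lerD2l; apply: (@le_trans _ _ ((2 * c + 1) * s)%R).
  by rewrite ler_wpM2r ?ltW// ltrDl.
by rewrite -ler_pdivlMl// mulrC ge_min lexx orbT.
Qed.

(** By induction on n: once the earlier coefficients agree, dividing by s^n and
    letting s tend to 0 compares the n-th ones. *)
Lemma power_series_unique (a b : nat -> R) (c : R) :
  (forall n, 0 <= a n <= c)%R -> (forall n, 0 <= b n <= c)%R ->
  (forall s : R, (0 <= s < 1)%R ->
    \sum_(n <oo) (s ^+ n * a n)%:E = \sum_(n <oo) (s ^+ n * b n)%:E) ->
  forall n, a n = b n.
Proof.
move=> ac bc H n; have [m] := ubnP n; elim: m n => // m IH n; rewrite ltnS => nm.
have ab i : (i < n)%N -> a i = b i by move=> ni; apply: IH; exact: leq_trans ni nm.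
apply/eqP; rewrite eq_le; apply/andP; split.
  by apply: (@coef_le a b c) => // i; have /andP[] := ac i.
apply: (@coef_le b a c) => //; first by move=> i; have /andP[] := bc i.
  by move=> i /ab.
by move=> s /H.
Qed.

Lemma expR_coeff_le (x : R) n : (0 <= x)%R -> (x ^+ n / n`!%:R <= expR x)%R.
Proof.
move=> x0; rewrite -lee_fin -nneseries_expR//.
have h i : 0 <= (x ^+ i / i`!%:R)%:E by rewrite lee_fin divr_ge0// exprn_ge0.
apply: (@le_trans _ _ (\sum_(0 <= i < n.+1) (x ^+ i / i`!%:R)%:E)).
  by rewrite big_nat_recr//= leeDr// sume_ge0.
by apply: nneseries_lim_ge.
Qed.

End power_series.

(** * Random enumeration of the points of a class *)
Section bounded_expectation.
Context d (Om : measurableType d) (R : realType) (P : probability Om R).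

Lemma integrable_bounded (F : Om -> R) (c : R) : measurable_fun setT F ->
  (forall w, `|F w| <= c) -> P.-integrable setT (EFin \o F).
Proof.
move=> mF Fc; apply: (@le_integrable _ _ _ P setT measurableT _ (cst c%:E)).
- exact/measurable_EFinP.
- move=> w _ /=; rewrite lee_fin (le_trans (Fc w))//.
  by rewrite ler_norm.
- exact: finite_measure_integrable_cst.
Qed.

Lemma EFin_expectation (F : Om -> R) (c : R) : measurable_fun setT F ->
  (forall w, `|F w| <= c) -> ((\int[P]_w F w)%R%:E = \int[P]_w (F w)%:E)%E.
Proof.
move=> mF Fc; rewrite /Rintegral fineK//.
exact: integrable_fin_num (integrable_bounded mF Fc).
Qed.

Lemma Rintegral_prob_cst (c : R) : \int[P]_w c = c.
Proof. by rewrite /Rintegral integral_prob_cst. Qed.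

Lemma expectation_lincomb (I : Type) (s : seq I) (u : I -> R) (F : I -> Om -> R)
    (c : I -> R) : (forall i, measurable_fun setT (F i)) ->
  (forall i w, `|F i w| <= c i) ->
  \int[P]_w (\sum_(i <- s) u i * F i w) = \sum_(i <- s) u i * \int[P]_w F i w.
Proof.
move=> mF Fc; elim: s => [|i s IH].
  by rewrite big_nil; under eq_Rintegral do rewrite big_nil; rewrite Rintegral_prob_cst.
rewrite big_cons -IH -RintegralZl//; last exact: integrable_bounded (Fc i).
rewrite -RintegralD//.
- by apply: eq_Rintegral => w _; rewrite big_cons.
- apply: (@integrable_bounded _ (`|u i| * c i)); first exact: measurable_funM.
  by move=> w; rewrite normrM ler_wpM2l.
- apply: (@integrable_bounded _ (\sum_(j <- s) `|u j| * c j)).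
    by apply: measurable_sum => j; exact: measurable_funM.
  move=> w; apply: (le_trans (ler_norm_sum _ _ _)); apply: ler_sum => j _.
  by rewrite normrM ler_wpM2l.
Qed.

Lemma expectation_sum (I : Type) (s : seq I) (F : I -> Om -> R) (c : I -> R) :
  (forall i, measurable_fun setT (F i)) -> (forall i w, `|F i w| <= c i) ->
  \int[P]_w (\sum_(i <- s) F i w) = \sum_(i <- s) \int[P]_w F i w.
Proof.
move=> mF Fc; transitivity (\int[P]_w (\sum_(i <- s) 1 * F i w)).
  by apply: eq_Rintegral => w _; apply: eq_bigr => i _; rewrite mul1r.
by rewrite (expectation_lincomb s _ mF Fc); apply: eq_bigr => i _; rewrite mul1r.
Qed.

Lemma mean01 (f : Om -> R) : measurable_fun setT f -> (forall e, 0 <= f e <= 1) ->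
  0 <= \int[P]_e f e <= 1.
Proof.
move=> mf f01; have fb e : `|f e| <= 1.
  by have /andP[f0 f1] := f01 e; rewrite ger0_norm.
apply/andP; split; first by apply: Rintegral_ge0 => e _; have /andP[] := f01 e.
rewrite -[leRHS](Rintegral_prob_cst 1); apply: le_Rintegral => //.
- exact: integrable_bounded fb.
- by apply: (@integrable_bounded _ 1) => // w; rewrite normr1.
- by move=> e _; have /andP[] := f01 e.
Qed.

End bounded_expectation.

(** One class [cl] of points, in the presence of a bounded weight [W] that stands
    for everything else.  The hypothesis [generating] says that under W the class
    is a Poisson(M) number of independent points with law m, r being the mean
    of W. *)
Section single_class.
Context d (Om : measurableType d) (R : realType) (P : probability Om R).
Context dE (E : measurableType dE) (x : nat -> Om -> E) (m : probability E R).
Variables (cl : Om -> seq nat) (W : Om -> R) (M r : R).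
Hypothesis mx : forall k, measurable_fun setT (x k).
Hypothesis mcl : measurable_fibers cl.
Hypothesis mW : measurable_fun setT W.
Hypothesis W01 : forall w, 0 <= W w <= 1.
Hypotheses (M0 : 0 < M) (r0 : 0 <= r).
Hypothesis generating : forall f : E -> R, measurable_fun setT f ->
  (forall e, 0 <= f e <= 1) ->
  (\int[P]_w (W w * \prod_(k <- cl w) f (x k w))%:E =
   (r * expR (- (M * (1 - \int[m]_e f e)%R)))%:E)%E.

Definition size_event n : set Om := [set w | size (cl w) = n].

Let msize n : measurable (size_event n).
Proof. exact: (measurable_fibers_preimage [set s | size s = n] mcl). Qed.

Let mind n : measurable_fun setT (\1_(size_event n) : Om -> R).
Proof. by apply: measurable_indic; exact: msize. Qed.

Let mprod (f : E -> R) : measurable_fun setT f ->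
  measurable_fun setT (fun w => \prod_(k <- cl w) f (x k w)).
Proof.
move=> mf; pose g (s : seq nat) w := \prod_(k <- s) f (x k w).
apply: (@measurable_fibers_comp _ _ (seq nat) _ _ cl g) => // s.
by apply: measurable_prod => k _; apply: measurableT_comp.
Qed.

Let prod01 (f : E -> R) w : (forall e, 0 <= f e <= 1) ->
  0 <= \prod_(k <- cl w) f (x k w) <= 1.
Proof.
move=> f01; apply/andP; split; last by apply: prodr_ile1.
by apply: prodr_ge0 => k _; have /andP[] := f01 (x k w).
Qed.

Let W0 w : 0 <= W w. Proof. by have /andP[] := W01 w. Qed.
Let W1 w : W w <= 1. Proof. by have /andP[] := W01 w. Qed.

(** Replacing f by s f multiplies the product over n points by s^n; both sides
    are then coefficients of equal power series in s. *)
Lemma expectation_size_prod n (f : E -> R) : measurable_fun setT f ->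
  (forall e, 0 <= f e <= 1) ->
  \int[P]_w (W w * \1_(size_event n) w * \prod_(k <- cl w) f (x k w)) =
  r * expR (- M) * ((M * \int[m]_e f e) ^+ n / n`!%:R).
Proof.
move=> mf f01; have /andP[mf0 mf1] := mean01 m mf f01.
pose F n w := W w * \1_(size_event n) w * \prod_(k <- cl w) f (x k w).
have mF k : measurable_fun setT (F k).
  by apply: measurable_funM; [exact: measurable_funM|exact: mprod].
have F01 k w : 0 <= F k w <= 1.
  have /andP[p0 p1] := prod01 w f01.
  rewrite /F indicE; case: (_ \in _); last by rewrite mulr0 mul0r lexx ler01.
  by rewrite mulr1 mulr_ge0//= mulr_ile1.
have Fb k w : `|F k w| <= 1 by have /andP[h0 h1] := F01 k w; rewrite ger0_norm.
have Mf0 : 0 <= M * \int[m]_e f e by rewrite mulr_ge0// ltW.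
pose a n := \int[P]_w F n w.
pose b n := r * expR (- M) * ((M * \int[m]_e f e) ^+ n / n`!%:R).
apply: (@power_series_unique _ a b (1 + r)) => [k|k|s /andP[s0 s1]].
- have /andP[h0 h1] := mean01 P (mF k) (F01 k).
  by rewrite h0/= (le_trans h1)// lerDl.
- rewrite /b !mulr_ge0 ?expR_ge0 ?invr_ge0 ?exprn_ge0//=.
  apply: (@le_trans _ _ r); last by rewrite lerDr.
  rewrite -mulrA ler_piMr//; apply: (@le_trans _ _ (expR (- M) * expR (M * \int[m]_e f e))).
    by rewrite ler_wpM2l ?expR_ge0// expR_coeff_le.
  rewrite -expRD -expR0 ler_expR addrC subr_le0 -[leRHS]mulr1.
  by rewrite ler_wpM2l// ltW.
have s01 : 0 <= s <= 1 by rewrite s0 ltW.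
transitivity (\int[P]_w (W w * \prod_(k <- cl w) (s * f (x k w)))%:E)%E.
  transitivity (\int[P]_w \sum_(k <oo) (s ^+ k * F k w)%:E)%E.
    rewrite integral_nneseries//; last 2 first.
    - by move=> k; apply/measurable_EFinP; exact: measurable_funM.
    - by move=> k w _; rewrite lee_fin mulr_ge0 ?exprn_ge0//; have /andP[] := F01 k w.
    apply: eq_eseriesr => k _; rewrite EFinM (EFin_expectation P (mF k) (Fb k)).
    rewrite -ge0_integralZl//.
    - exact/measurable_EFinP.
    - by move=> w _; rewrite lee_fin; have /andP[] := F01 k w.
    - by rewrite lee_fin exprn_ge0.
  apply: eq_integral => w _; rewrite (nneseries_single (m := size (cl w))).
    rewrite /F indicE mem_set// mulr1; congr (_%:E).
    by rewrite big_split/= big_const_seq count_predT iter_mulr_1 mulrCA.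
  move=> k ks; rewrite /F indicE memNset ?mulr0 ?mul0r ?mulr0// => sk.
  by move: ks; rewrite -sk eqxx.
rewrite (generating (f := fun e => s * f e)); last 2 first.
- exact: measurable_funM.
- move=> e; have /andP[h0 h1] := f01 e; rewrite mulr_ge0//=.
  by rewrite mulr_ile1// ltW.
transitivity (\sum_(k <oo) ((r * expR (- M))%:E * ((s * (M * \int[m]_e f e)) ^+ k / k`!%:R)%:E))%E.
  rewrite nneseriesZl; last first.
    by move=> k _; rewrite lee_fin divr_ge0// exprn_ge0// mulr_ge0.
  rewrite nneseries_expR; last exact: mulr_ge0.
  rewrite -EFinM -mulrA -expRD; congr (_ * expR _)%:E.
  rewrite RintegralZl//; last first.
    apply: (@integrable_bounded _ _ _ m _ 1) => // e.
    by have /andP[h0 h1] := f01 e; rewrite ger0_norm.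
  by ring.
by apply: eq_eseriesr => k _; rewrite -EFinM /b exprMn; congr (_%:E); ring.
Qed.

(** The sum over the n! orders of the first n points of the class; only used on
    the event that the class has n points. *)
Definition perm_sum n (b : nat -> E -> R) (w : Om) : R :=
  \sum_(s : 'S_n) \prod_(j < n) b j (x (nth 0%N (cl w) (s j)) w).

Section perm_sum.
Variable b : nat -> E -> R.
Hypothesis mb : forall j, measurable_fun setT (b j).
Hypothesis b01 : forall j e, 0 <= b j e <= 1.

Let b0 j e : 0 <= b j e. Proof. by have /andP[] := b01 j e. Qed.
Let b1 j e : b j e <= 1. Proof. by have /andP[] := b01 j e. Qed.

Lemma measurable_perm_sum n : measurable_fun setT (perm_sum n b).
Proof.
pose g (s : seq nat) w := \sum_(t : 'S_n) \prod_(j < n) b j (x (nth 0%N s (t j)) w).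
apply: (@measurable_fibers_comp _ _ (seq nat) _ _ cl g) => // s.
apply: measurable_sum => t; apply: measurable_prod => j _.
exact: measurableT_comp.
Qed.

Lemma perm_sum_ge0 n w : 0 <= perm_sum n b w.
Proof. by apply: sumr_ge0 => s _; exact: prodr_ge0. Qed.

Lemma perm_sum_le n w : perm_sum n b w <= n`!%:R.
Proof.
apply: (@le_trans _ _ (\sum_(s : 'S_n) 1)).
  by apply: ler_sum => s _; apply: prodr_ile1 => j _; exact: b01.
by rewrite sumr_const card_Sn.
Qed.

(** Polarization: [perm_sum] is a permanent, which Ryser's formula writes with the
    products over the points of the functions \sum_(j in J) b j.  These are
    divided by n to fall in [0, 1], where the previous lemma applies. *)
Lemma expectation_perm_sum n :
  \int[P]_w (W w * \1_(size_event n) w * perm_sum n b w) =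
  r * expR (- M) * M ^+ n * \prod_(j < n) \int[m]_e b j e.
Proof.
pose c (J : {set 'I_n}) e := n%:R^-1 * \sum_(j <- enum J) b j e.
have cn J e : n%:R * c J e = \sum_(j in J) b j e.
  rewrite /c big_enum mulrA; case: (n) J => [|n'] J; last by rewrite divff ?mul1r// pnatr_eq0.
  by rewrite mul0r mul0r big1// => -[].
have mS (J : {set 'I_n}) : measurable_fun setT (fun e => \sum_(j <- enum J) b j e).
  exact: measurable_sum.
have mc J : measurable_fun setT (c J) by exact: measurable_funM.
have c01 J e : 0 <= c J e <= 1.
  rewrite /c big_enum mulr_ge0 ?invr_ge0 ?sumr_ge0//=.
  have [n0|n0] := eqVneq n 0%N.
    have -> : n%:R^-1 = 0 :> R by rewrite n0 invr0.
    by rewrite mul0r ler01.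
  rewrite ler_pdivrMl ?mulr1 ?ltr0n ?lt0n//.
  apply: (@le_trans _ _ (\sum_(j in J) 1)); first by apply: ler_sum.
  by rewrite sumr_const ler_nat (leq_trans (max_card _))// card_ord.
pose F J w := W w * \1_(size_event n) w * \prod_(k <- cl w) c J (x k w).
have mF J : measurable_fun setT (F J).
  by apply: measurable_funM; [exact: measurable_funM|exact: mprod].
have Fb J w : `|F J w| <= 1.
  have /andP[p0 p1] := prod01 w (c01 J).
  rewrite /F indicE; case: (_ \in _); last by rewrite mulr0 mul0r normr0.
  by rewrite mulr1 ger0_norm ?mulr_ge0// mulr_ile1.
have E1 w : W w * \1_(size_event n) w * perm_sum n b w =
    \sum_(J : {set 'I_n}) ((-1) ^+ #|finset.setC J| * n%:R ^+ n) * F J w.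
  rewrite /F indicE; case: (boolP (w \in size_event n)) => [/set_mem sn|_]; last first.
    by rewrite mulr0 mul0r big1// => J _; rewrite mul0r mulr0.
  rewrite mulr1 /perm_sum.
  rewrite (permanent_Ryser (fun j k : 'I_n => b j (x (nth 0%N (cl w) k) w))).
  rewrite mulr_sumr; apply: eq_bigr => J _.
  rewrite mulrCA -[RHS]mulrA; congr (_ * _); rewrite mulrCA; congr (_ * _).
  transitivity (\prod_(k <- cl w) (n%:R * c J (x k w))).
    by rewrite (big_nth 0%N) sn big_mkord; apply: eq_bigr => k _; rewrite cn.
  by rewrite big_split/= big_const_seq count_predT iter_mulr_1 sn.
under eq_Rintegral do rewrite E1.
rewrite (expectation_lincomb P _ _ mF Fb).
under eq_bigr => J _ do rewrite /F expectation_size_prod//.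
transitivity (r * expR (- M) * M ^+ n / n`!%:R *
   \sum_(J : {set 'I_n}) (-1) ^+ #|finset.setC J| * \prod_(k < n) \sum_(j in J) \int[m]_e b j e).
  rewrite mulr_sumr; apply: eq_bigr => J _.
  rewrite prodr_const card_ord.
  have -> : \sum_(j in J) \int[m]_e b j e = n%:R * \int[m]_e c J e.
    rewrite -RintegralZl//; last first.
      apply: (@integrable_bounded _ _ _ m _ 1) => // e.
      by have /andP[h0 h1] := c01 J e; rewrite ger0_norm.
    under [RHS]eq_Rintegral do rewrite cn -big_enum.
    have bb (j : 'I_n) e : `|b j e| <= 1 by rewrite ger0_norm.
    have mb' (j : 'I_n) : measurable_fun setT (b j) by exact: mb.
    by rewrite (expectation_sum m (enum J) mb' bb) big_enum.
  by rewrite !exprMn; ring.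
rewrite -(permanent_Ryser (fun j _ => \int[m]_e b j e)) sumr_const card_Sn.
rewrite -[X in _ * X]mulr_natr mulrA mulrAC divfK// pnatr_eq0 -lt0n fact_gt0.
Qed.

End perm_sum.

(** The conditional probability, given the points of the class, that the number
   of points is in D and that the first J values of a uniformly random
   enumeration of the points, continued by independent draws from m, pass the
   tests b. *)
Definition enum_weight (D : set nat) (J : nat) (b : nat -> E -> R) (w : Om) : R :=
  \1_D (size (cl w)) * ((size (cl w))`!%:R^-1 * perm_sum (size (cl w)) b w) *
  \prod_(size (cl w) <= j < J) \int[m]_e b j e.

Section enum_weight.
Variables (D : set nat) (J : nat) (b : nat -> E -> R).
Hypothesis mb : forall j, measurable_fun setT (b j).
Hypothesis b01 : forall j e, 0 <= b j e <= 1.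
Hypothesis bJ : forall j, (J <= j)%N -> b j = cst 1.

Let mean_b01 j : 0 <= \int[m]_e b j e <= 1.
Proof. exact: mean01. Qed.

Let tail n := \prod_(n <= j < J) \int[m]_e b j e.

Let tail01 n : 0 <= tail n <= 1.
Proof.
apply/andP; split; last by apply: prodr_ile1 => j _.
by apply: prodr_ge0 => j _; have /andP[] := mean_b01 j.
Qed.

Lemma enum_weight01 w : 0 <= enum_weight D J b w <= 1.
Proof.
rewrite /enum_weight; set n := size _.
have /andP[t0 t1] := tail01 n.
have f0 : 0 < (n`!%:R : R) by rewrite ltr0n fact_gt0.
have p0 : 0 <= n`!%:R^-1 * perm_sum n b w.
  by rewrite mulr_ge0 ?invr_ge0 ?(ltW f0)// perm_sum_ge0.
have p1 : n`!%:R^-1 * perm_sum n b w <= 1.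
  by rewrite ler_pdivrMl// mulr1 perm_sum_le.
rewrite indicE; case: (_ \in _); last by rewrite !mul0r lexx ler01.
by rewrite mul1r mulr_ge0//= mulr_ile1.
Qed.

Lemma measurable_enum_weight : measurable_fun setT (enum_weight D J b).
Proof.
pose g (s : seq nat) w := \1_D (size s) * ((size s)`!%:R^-1 * perm_sum (size s) b w) * tail (size s).
apply: (@measurable_fibers_comp _ _ (seq nat) _ _ cl g) => // s.
apply: measurable_funM => //; apply: measurable_funM => //; apply: measurable_funM => //.
exact: measurable_perm_sum.
Qed.

Let mean_tail n : \prod_(j < n) \int[m]_e b j e * tail n = \prod_(j < J) \int[m]_e b j e.
Proof.
have b1 j : (J <= j)%N -> \int[m]_e b j e = 1.
  by move=> /bJ ->; rewrite Rintegral_prob_cst.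
rewrite -!(big_mkord predT (fun j => \int[m]_e b j e)) /tail.
have [nJ|/ltnW Jn] := leqP n J; first by rewrite -big_cat_nat.
rewrite [X in _ * X]big_geq// mulr1 (big_cat_nat (n := J))//= [X in _ * X](_ : _ = 1) ?mulr1//.
by rewrite big_nat_cond big1// => j /andP[/andP[Jj _] _]; exact: b1.
Qed.

(** Sum over the number n of points: the first n tests are paid for by
    [expectation_perm_sum], the others by independent draws. *)
Theorem integral_enum_weight :
  (\int[P]_w (W w * enum_weight D J b w)%:E =
   r%:E * poisson_prob M 0 D * (\prod_(j < J) \int[m]_e b j e)%:E)%E.
Proof.
set B := \prod_(j < J) _.
have B0 : 0 <= B by apply: prodr_ge0 => j _; have /andP[] := mean_b01 j.
pose F n w := W w * \1_(size_event n) w * perm_sum n b w.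
have mF n : measurable_fun setT (F n).
  by apply: measurable_funM; [exact: measurable_funM|exact: measurable_perm_sum].
have F0 n w : 0 <= F n w by rewrite /F !mulr_ge0// perm_sum_ge0.
have Fb n w : `|F n w| <= n`!%:R.
  rewrite ger0_norm// /F indicE; case: (_ \in _); last by rewrite mulr0 mul0r.
  rewrite mulr1 -[leRHS]mul1r ler_pM// ?perm_sum_ge0//.
  exact: perm_sum_le.
pose k n := \1_D n * n`!%:R^-1 * tail n.
have k0 n : 0 <= k n by rewrite /k !mulr_ge0 ?invr_ge0//; have /andP[] := tail01 n.
transitivity (\int[P]_w \sum_(n <oo) (k n * F n w)%:E)%E.
  apply: eq_integral => w _; rewrite (nneseries_single (m := size (cl w))).
    by rewrite /F indicE mem_set// mulr1 /k /enum_weight /tail; congr (_%:E); ring.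
  move=> n ns; rewrite /F indicE memNset ?mulr0 ?mul0r ?mulr0// => sk.
  by move: ns; rewrite -sk eqxx.
rewrite integral_nneseries//; last 2 first.
- by move=> n; apply/measurable_EFinP; exact: measurable_funM.
- by move=> n w _; rewrite lee_fin mulr_ge0.
transitivity (\sum_(n <oo) ((r * B)%:E * (\1_D n * poisson_pmf M n)%:E))%E.
  apply: eq_eseriesr => n _; under eq_integral do rewrite EFinM.
  rewrite ge0_integralZl//; last 3 first.
  - exact/measurable_EFinP.
  - by move=> w _; rewrite lee_fin.
  - by rewrite lee_fin.
  rewrite -(EFin_expectation P (mF n) (Fb n)) expectation_perm_sum// -!EFinM.
  by rewrite /poisson_pmf M0 /B -(mean_tail n) /k; congr (_%:E); ring.
rewrite nneseriesZl; last first.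
  by move=> n _; rewrite lee_fin mulr_ge0// poisson_pmf_ge0.
rewrite EFinM -muleA [RHS]muleAC -muleA; congr (_ * (_ * _))%E.
rewrite /poisson_prob M0 nneseries_esumT; last first.
  by move=> n; rewrite lee_fin mulr_ge0// poisson_pmf_ge0.
rewrite [RHS]esum_mkcond; apply: eq_esum => n _.
by rewrite indicE; case: ifP => _; rewrite ?mul1r// mul0r.
Qed.

End enum_weight.

End single_class.

Section enumerated_classes.
Context d (Om : measurableType d) (R : realType) (P : probability Om R).
Context dE (E : measurableType dE) (X : nat -> Om -> E).
Context dT (T : measurableType dT) (lam : probability T R).
Hypothesis mX : forall k, measurable_fun setT (X k).
Variable (mu : {measure set E -> \bar R}) (I : eqType) (color : E * T -> option I).
Hypothesis mcolor : forall c, measurable [set z | color z = Some c].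
Variables (M : I -> R) (m : I -> probability E R).
Hypothesis M0 : forall c, 0 < M c.
(* the points of color c have mean measure M c * m c *)
Hypothesis color_intE : forall c (f : E -> R), measurable_fun setT f ->
  (forall e, 0 <= f e <= 1) ->
  color_int lam mu color c f = (M c * (1 - \int[m c]_e f e))%:E.
Hypothesis generatingT : generating_formula P X mu setT.

Local Notation P1 := (marked_prob P lam).
Local Notation cls := (color_class X color).

Let color_massE c : color_mass lam mu color c = (M c)%:E.
Proof.
have h : color_int lam mu color c (fun=> 0) = ((1 - 0)%:E * color_mass lam mu color c)%E.
  by apply: color_int_cst => //; rewrite lexx ler01.
move: h; rewrite subr0 mul1e => <-; rewrite color_intE//.
  by rewrite Rintegral_prob_cst subr0 mulr1.
by move=> e; rewrite lexx ler01.
Qed.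

Variable A : set Om.
Hypothesis mA : measurable A.
Hypothesis generatingA : generating_formula P X mu A.
Variables (D : I -> set nat) (J : nat) (b : I -> nat -> E -> R).
Hypothesis mb : forall c j, measurable_fun setT (b c j).
Hypothesis b01 : forall c j e, 0 <= b c j e <= 1.
Hypothesis bJ : forall c j, (J <= j)%N -> b c j = cst 1.

Definition class_weight c : marked_space Om T -> R :=
  enum_weight (fun k w => X k w.1) (m c) (cls c) (D c) J (b c).

Let mx k : measurable_fun setT (fun w : marked_space Om T => X k w.1).
Proof. exact: (measurableT_comp (mX k) measurable_fst). Qed.

Let mcls c : measurable_fibers (cls c).
Proof. exact: measurable_color_class. Qed.

Let class_weight01 c w : 0 <= class_weight c w <= 1.
Proof. exact: enum_weight01. Qed.

Let mclass_weight c : measurable_fun setT (class_weight c).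
Proof. exact: measurable_enum_weight. Qed.

Let PA : P A = (fine (P A))%:E.
Proof. by rewrite fineK// fin_num_measure. Qed.

Let poisson_real c : poisson_prob (M c) 0 (D c) = (fine (poisson_prob (M c) 0 (D c)))%:E.
Proof. by rewrite fineK// fin_num_measure. Qed.

Let mean_b01 c j : 0 <= \int[m c]_e b c j e <= 1.
Proof. exact: mean01. Qed.

(** The classes are processed one at a time: the classes already treated act as
    a weight on the class under consideration. *)
Let integral_class_weights_rec (C1 C2 : seq I) (f : I -> E -> R) : uniq (C1 ++ C2) ->
  (forall c, measurable_fun setT (f c)) -> (forall c e, 0 <= f c e <= 1) ->
  (\int[P1]_w (\1_A w.1 * \prod_(c <- C1) class_weight c w *
      \prod_(c <- C2) class_prod X color c (f c) w)%:E =
   (fine (P A) * \prod_(c <- C1) (fine (poisson_prob (M c) 0 (D c)) * \prod_(j < J) \int[m c]_e b c j e) *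
     \prod_(c <- C2) expR (- (M c * (1 - \int[m c]_e f c e))))%:E)%E.
Proof.
elim: C1 C2 f => [|c C1 IH] C2 f uC mf f01.
  transitivity (\int[P1]_w (\1_A w.1 * \prod_(c <- C2) class_prod X color c (f c) w)%:E)%E.
    by apply: eq_integral => w _; rewrite big_nil mulr1.
  rewrite big_nil mulr1.
  rewrite (integral_class_prod mX mcolor generatingT mA generatingA uC _ mf f01).
    rewrite PA -EFinM; congr (_ * _)%:E.
    by apply: eq_bigr => c _; rewrite color_intE.
  by move=> c _; rewrite color_massE ltry.
have cC1 : c \notin C1 ++ C2 by move: uC => /= /andP[].
have uC12 : uniq (C1 ++ C2) by move: uC => /= /andP[].
pose W (w : marked_space Om T) := \1_A w.1 * \prod_(c <- C1) class_weight c w *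
      \prod_(c <- C2) class_prod X color c (f c) w.
pose r := fine (P A) * \prod_(c <- C1) (fine (poisson_prob (M c) 0 (D c)) * \prod_(j < J) \int[m c]_e b c j e) *
     \prod_(c <- C2) expR (- (M c * (1 - \int[m c]_e f c e))).
have mW : measurable_fun setT W.
  apply: measurable_funM; last by apply: measurable_prod => c' _; exact: measurable_class_prod.
  apply: measurable_funM; last exact: measurable_prod.
  have mI : measurable_fun setT (\1_A : Om -> R) by exact: measurable_indic.
  exact: (measurableT_comp mI measurable_fst).
have W01 w : 0 <= W w <= 1.
  have p1 : 0 <= \prod_(c <- C1) class_weight c w <= 1.
    apply/andP; split; last by apply: prodr_ile1.
    by apply: prodr_ge0 => c' _; have /andP[] := class_weight01 c' w.
  have p2 : 0 <= \prod_(c <- C2) class_prod X color c (f c) w <= 1.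
    have h c' := class_prod01 X color c' w (f01 c').
    apply/andP; split; last by apply: prodr_ile1.
    by apply: prodr_ge0 => c' _; have /andP[] := h c'.
  move: p1 p2 => /andP[p10 p11] /andP[p20 p21].
  rewrite /W indicE; case: (_ \in A); last by rewrite !mul0r lexx ler01.
  by rewrite mul1r mulr_ge0//= mulr_ile1.
have r0 : 0 <= r.
  rewrite /r !mulr_ge0//.
  - by rewrite fine_ge0.
  - apply: prodr_ge0 => c' _; rewrite mulr_ge0 ?fine_ge0//.
    by apply: prodr_ge0 => j _; have /andP[] := mean_b01 c' j.
  - by apply: prodr_ge0 => c' _; exact: expR_ge0.
have gen (g : E -> R) : measurable_fun setT g -> (forall e, 0 <= g e <= 1) ->
    (\int[P1]_w (W w * \prod_(k <- cls c w) g (X k w.1))%:E =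
     (r * expR (- (M c * (1 - \int[m c]_e g e))))%:E)%E.
  move=> mg g01; pose f' c' := if c' == c then g else f c'.
  have f'C2 c' : c' \in C2 -> f' c' = f c'.
    rewrite /f'; case: eqP => // -> cC2.
    by move: cC1; rewrite mem_cat cC2 orbT.
  have f'c : f' c = g by rewrite /f' eqxx.
  have uC' : uniq (C1 ++ c :: C2) by rewrite -cat1s uniq_catCA cat1s.
  have mf' c' : measurable_fun setT (f' c') by rewrite /f'; case: ifP.
  have f'01 c' e : 0 <= f' c' e <= 1 by rewrite /f'; case: ifP.
  have := IH (c :: C2) f' uC' mf' f'01.
  have -> : \prod_(c' <- c :: C2) expR (- (M c' * (1 - \int[m c']_e f' c' e))) =
      expR (- (M c * (1 - \int[m c]_e g e))) *
      \prod_(c' <- C2) expR (- (M c' * (1 - \int[m c']_e f c' e))).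
    by rewrite big_cons f'c; congr (_ * _); apply: eq_big_seq => c' /f'C2 ->.
  rewrite mulrCA [X in _ = X%:E -> _]mulrC => <-.
  apply: eq_integral => w _; rewrite big_cons f'c /W; congr (_%:E).
  have -> : \prod_(c' <- C2) class_prod X color c' (f' c') w =
      \prod_(c' <- C2) class_prod X color c' (f c') w.
    by apply: eq_big_seq => c' /f'C2 ->.
  by rewrite /class_prod; ring.
have := integral_enum_weight mx (mcls c) mW W01 (M0 c) r0 gen (D c) (mb c) (b01 c) (bJ c).
rewrite poisson_real -!EFinM => E1.
rewrite big_cons [in RHS]mulrA -[in RHS]/r.
transitivity (\int[P1]_w (W w * class_weight c w)%:E)%E.
  by apply: eq_integral => w _; rewrite big_cons /W; congr (_%:E); ring.
by rewrite E1 /r; congr (_%:E); ring.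
Qed.

Theorem integral_class_weights (C : seq I) : uniq C ->
  (\int[P1]_w (\1_A w.1 * \prod_(c <- C) class_weight c w)%:E =
   P A * \prod_(c <- C) (poisson_prob (M c) 0 (D c) * (\prod_(j < J) \int[m c]_e b c j e)%:E))%E.
Proof.
move=> uC; have := @integral_class_weights_rec C [::] (fun=> cst 0).
rewrite cats0 big_nil mulr1 => /(_ uC) h.
transitivity (\int[P1]_w (\1_A w.1 * \prod_(c <- C) class_weight c w *
   \prod_(c <- [::]) class_prod X color c (cst 0) w)%:E)%E.
  by apply: eq_integral => w _; rewrite big_nil mulr1.
rewrite h//; last by move=> c e /=; rewrite lexx ler01.
rewrite EFinM -PA; congr (_ * _)%E; rewrite -prodEFin; apply: eq_bigr => c _.
by rewrite poisson_real -EFinM.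
Qed.

End enumerated_classes.

Section uniform_on_ordinals.
Context {R : realType}.
Local Open Scope ereal_scope.

Let inv_fact_ge0 n : (0 <= n`!%:R^-1 :> R)%R.
Proof. by rewrite invr_ge0. Qed.

Let inv_fact (n : nat) : {nonneg R} := NngNum (inv_fact_ge0 n).

(** The uniform law on 0, ..., n! - 1, which codes a uniform permutation of n
    elements. *)
Definition fact_uniform (n : nat) : set nat -> \bar R :=
  mscale (inv_fact n) (msum (fun i => \d_i : {measure set nat -> \bar R}) n`!).

HB.instance Definition _ n := Measure.on (fact_uniform n).

Let fact_uniformT n : fact_uniform n setT = 1.
Proof.
rewrite /fact_uniform /mscale /= /msum.
rewrite (eq_bigr (fun=> 1%:E)); last by move=> i _; rewrite /= diracT.
rewrite sumEFin sumr_const card_ord -EFinM mulVf// pnatr_eq0 -lt0n fact_gt0//.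
Qed.

HB.instance Definition _ n := Measure_isProbability.Build _ _ _ (fact_uniform n) (fact_uniformT n).

Lemma integral_fact_uniform n (f : nat -> R) : (forall i, 0 <= f i)%R ->
  \int[fact_uniform n]_i (f i)%:E = (n`!%:R^-1 * \sum_(i < n`!) f i)%:E.
Proof.
move=> f0.
rewrite /fact_uniform ge0_integral_mscale//; last by move=> i _; rewrite lee_fin.
rewrite ge0_integral_measure_sum//; last by move=> i _; rewrite lee_fin.
rewrite /= EFinM -sumEFin; congr (_ * _); apply: eq_bigr => i _.
by rewrite integral_dirac// diracT mul1e.
Qed.

End uniform_on_ordinals.

Section enumeration_space.
Context (I : countType) (R : realType).
Context dE (E : measurableType dE) (m : I -> probability E R).

(** Codes of permutations, one for each size, and replacement values. *)
Definition aux_space : measurableType _ := (seqspace nat * seqspace E)%type.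

Definition aux_prob (c : I) : probability aux_space R :=
  (seqlaw (fun n => fact_uniform n) \x seqlaw (fun=> m c))%E.

(** The i-th factor of the product serves the class coded by i; the Dirac mass
    fills the places that code no class. *)
Definition coded_aux_prob (i : nat) : probability aux_space R :=
  if @choice.unpickle I i is Some c then aux_prob c else \d_point.

Definition aux_seq_space : measurableType _ := seqspace aux_space.

Definition aux_seq_prob : probability aux_seq_space R := seqlaw coded_aux_prob.

(** Every i gives a permutation of the numbers below n: outside the range of
    [enum] the default value is the identity. *)
Definition nth_perm n i (j : nat) : nat :=
  if insub j is Some o then (nth 1%g (enum 'S_n) i : 'S_n) o else 0%N.

Lemma sum_nth_perm n (F : (nat -> nat) -> R) :
  \sum_(i < n`!) F (nth_perm n i) =
  \sum_(s : 'S_n) F (fun j => if insub j is Some o then (s : 'S_n) o : nat else 0%N).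
Proof.
rewrite -[RHS]big_enum (big_nth 1%g) /= -cardE card_Sn big_mkord.
by [].
Qed.

End enumeration_space.

Lemma prod_natr_bool (R : comNzRingType) (I : Type) (s : seq I) (t : I -> bool) :
  \prod_(i <- s) (t i)%:R = (all t s)%:R :> R.
Proof.
elim: s => [|i s IH]; first by rewrite big_nil.
by rewrite big_cons IH -natrM mulnb.
Qed.

Section enumerated_process.
Context d (Om : measurableType d) (R : realType) (P : probability Om R).
Context dE (E : measurableType dE) (X : nat -> Om -> E).
Context dT (T : measurableType dT) (lam : probability T R).
Hypothesis mX : forall k, measurable_fun setT (X k).
Variable (mu : {measure set E -> \bar R}) (I : countType) (color : E * T -> option I).
Hypothesis mcolor : forall c, measurable [set z | color z = Some c].
Variables (M : I -> R) (m : I -> probability E R).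
Hypothesis M0 : forall c, 0 < M c.
Hypothesis color_intE : forall c (f : E -> R), measurable_fun setT f ->
  (forall e, 0 <= f e <= 1) ->
  color_int lam mu color c f = (M c * (1 - \int[m c]_e f e))%:E.
Hypothesis generatingT : generating_formula P X mu setT.

Local Notation P1 := (marked_prob P lam).
Local Notation cls := (color_class X color).

Definition ext_space : measurableType _ := (marked_space Om T * aux_seq_space E)%type.

Definition ext_prob : probability ext_space R := (P1 \x aux_seq_prob m)%E.

Definition enum_count (c : I) (w : ext_space) : nat := size (cls c w.1).

(** The j-th point of class c in a random order if there is one, and otherwise a
    fresh draw from the law of the class. *)
Definition enum_value (c : I) (j : nat) (w : ext_space) : E :=
  let s := cls c w.1 in
  let a := w.2 (choice.pickle c) in
  if (j < size s)%N then X (nth 0%N s (nth_perm (size s) (a.1 (size s)) j)) w.1.1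
  else a.2 j.

Let mcls c : measurable_fibers (cls c).
Proof. exact: measurable_color_class. Qed.

Let maux (c : I) : measurable_fun setT (fun w : ext_space => w.2 (choice.pickle c) : aux_space E).
Proof. exact: (measurableT_comp (measurable_coord _) measurable_snd). Qed.

Lemma measurable_enum_count c : measurable_fun setT (enum_count c).
Proof.
move=> _ D _; rewrite setTI.
have := measurable_fibers_preimage [set s | D (size s)] (mcls c) => mD.
rewrite [X in measurable X](_ : _ = [set: ext_space] `&` fst @^-1` [set w | D (size (cls c w))]).
  exact: (measurable_fst (T1 := marked_space Om T)).
by rewrite setTI.
Qed.

Lemma measurable_enum_value c j : measurable_fun setT (enum_value c j).
Proof.
pose h (w : ext_space) : seq nat * nat :=
  (cls c w.1, (w.2 (choice.pickle c)).1 (size (cls c w.1))).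
pose g (u : seq nat * nat) (w : ext_space) : E :=
  if (j < size u.1)%N then X (nth 0%N u.1 (nth_perm (size u.1) u.2 j)) w.1.1
  else (w.2 (choice.pickle c)).2 j.
apply: (@measurable_fibers_comp _ _ (seq nat * nat)%type _ _ h g).
  move=> [s i].
  rewrite [X in measurable X](_ : _ =
    ([set: ext_space] `&` fst @^-1` [set w | cls c w = s]) `&`
    ([set: ext_space] `&` (fun w : ext_space => (w.2 (choice.pickle c)).1 (size s)) @^-1` [set i])).
    apply: measurableI.
      by apply: (measurable_fst (T1 := marked_space Om T)) => //; exact: mcls.
    have mc : measurable_fun setT (fun w : ext_space => (w.2 (choice.pickle c)).1 : seqspace nat).
      exact: (measurableT_comp measurable_fst (maux c)).
    exact: (measurableT_comp (@measurable_coord _ nat (size s)) mc).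
  by rewrite !setTI; apply/seteqP; split => w /=; rewrite /h => -[<- <-].
move=> [s i]; rewrite /g/=; case: (j < size s)%N.
  apply: measurableT_comp => //.
  exact: (measurableT_comp measurable_fst measurable_fst).
have mc : measurable_fun setT (fun w : ext_space => (w.2 (choice.pickle c)).2 : seqspace E).
  exact: (measurableT_comp measurable_snd (maux c)).
exact: (measurableT_comp (@measurable_coord _ E j) mc).
Qed.

Variables (D : I -> set nat) (J : nat) (B : I -> nat -> set E).
Hypothesis mB : forall c j, measurable (B c j).

Let test c j (e : E) : R := if (j < J)%N then \1_(B c j) e else 1.

Let mtest c j : measurable_fun setT (test c j).
Proof. by rewrite /test; case: (j < J)%N => //; exact: measurable_indic. Qed.

Let test01 c j e : 0 <= test c j e <= 1.
Proof.
by rewrite /test; case: ifP => _; rewrite ?lexx ?ler01// indicE ler0n lern1 leq_b1.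
Qed.

Let testJ c j : (J <= j)%N -> test c j = cst 1.
Proof. by move=> Jj; apply/funext => e; rewrite /test ltnNge Jj. Qed.

Let test_mean c j : (j < J)%N -> ((\int[m c]_e test c j e)%:E = m c (B c j))%E.
Proof.
move=> jJ; have tb e : `|test c j e| <= 1 by have /andP[h0 h1] := test01 c j e; rewrite ger0_norm.
rewrite (EFin_expectation (m c) (mtest c j) tb) /test jJ.
by rewrite integral_indic// setIT.
Qed.

Let class_test c (w : marked_space Om T) (a : aux_space E) : R :=
  let s := cls c w in
  \1_(D c) (size s) *
  ((\prod_(j < size s) test c j (X (nth 0%N s (nth_perm (size s) (a.1 (size s)) j)) w.1)) *
   \prod_(size s <= j < J) test c j (a.2 j)).

Let class_test01 c w a : 0 <= class_test c w a <= 1.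
Proof.
have t0 j e : 0 <= test c j e by have /andP[] := test01 c j e.
rewrite /class_test indicE; case: (_ \in _); last by rewrite mul0r lexx ler01.
rewrite mul1r mulr_ge0 ?prodr_ge0//= mulr_ile1 ?prodr_ge0//.
- by apply: prodr_ile1 => j _; exact: test01.
- by apply: prodr_ile1 => j _; exact: test01.
Qed.

Let measurable_class_test c :
  measurable_fun setT (fun z : marked_space Om T * aux_space E => class_test c z.1 z.2).
Proof.
pose h (z : marked_space Om T * aux_space E) : seq nat * nat :=
  (cls c z.1, z.2.1 (size (cls c z.1))).
pose g (u : seq nat * nat) (z : marked_space Om T * aux_space E) : R :=
  \1_(D c) (size u.1) *
  ((\prod_(j < size u.1) test c j (X (nth 0%N u.1 (nth_perm (size u.1) u.2 j)) z.1.1)) *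
   \prod_(size u.1 <= j < J) test c j (z.2.2 j)).
apply: (@measurable_fibers_comp _ _ (seq nat * nat)%type _ _ h g).
  move=> [s i].
  rewrite [X in measurable X](_ : _ =
    ([set: marked_space Om T * aux_space E] `&` fst @^-1` [set w | cls c w = s]) `&`
    ([set: marked_space Om T * aux_space E] `&` (fun z => z.2.1 (size s)) @^-1` [set i])).
    apply: measurableI.
      by apply: (measurable_fst (T1 := marked_space Om T)) => //; exact: mcls.
    have mc : measurable_fun setT (fun z : marked_space Om T * aux_space E => z.2.1 : seqspace nat).
      exact: (measurableT_comp measurable_fst measurable_snd).
    exact: (measurableT_comp (@measurable_coord _ nat (size s)) mc).
  by rewrite !setTI; apply/seteqP; split => w /=; rewrite /h => -[<- <-].
move=> [s i]; rewrite /g/=; apply: measurable_funM => //; apply: measurable_funM.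
  apply: measurable_prod => j _; apply: measurableT_comp; first exact: mtest.
  apply: measurableT_comp => //.
  exact: (measurableT_comp measurable_fst measurable_fst).
apply: measurable_prod => j _; apply: measurableT_comp; first exact: mtest.
have mc : measurable_fun setT (fun z : marked_space Om T * aux_space E => z.2.2 : seqspace E).
  exact: (measurableT_comp measurable_snd measurable_snd).
exact: (measurableT_comp (@measurable_coord _ E j) mc).
Qed.

Let class_testE c (w : ext_space) :
  class_test c w.1 (w.2 (choice.pickle c)) =
  \1_(D c) (enum_count c w) * \prod_(j < J) \1_(B c j) (enum_value c j w).
Proof.
rewrite /class_test; congr (_ * _); rewrite /enum_value /=.
set s := cls c w.1; set a := w.2 _; set n := size s.
rewrite -(big_mkord predT (fun j => test c j (X (nth 0%N s (nth_perm n (a.1 n) j)) w.1.1))).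
rewrite -(big_mkord predT (fun j => \1_(B c j) (if (j < n)%N
  then X (nth 0%N s (nth_perm n (a.1 n) j)) w.1.1 else a.2 j))).
have [nJ|/ltnW Jn] := leqP n J.
  rewrite [RHS](big_cat_nat (n := n))//=; congr (_ * _).
    rewrite big_nat_cond [RHS]big_nat_cond; apply: eq_bigr => j /andP[/andP[_ jn] _].
    by rewrite jn /test (leq_trans jn nJ).
  rewrite big_nat_cond [RHS]big_nat_cond; apply: eq_bigr => j /andP[/andP[nj jJ] _].
  by rewrite ltnNge nj /= /test jJ.
rewrite [X in _ * X]big_geq// mulr1 (big_cat_nat (n := J))//= [X in _ * X](_ : _ = 1) ?mulr1.
  rewrite big_nat_cond [RHS]big_nat_cond; apply: eq_bigr => j /andP[/andP[_ jJ] _].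
  by rewrite (leq_trans jJ Jn) /test jJ.
rewrite big_nat_cond big1// => j /andP[/andP[Jj _] _].
by rewrite /test ltnNge Jj.
Qed.

Local Open Scope ereal_scope.

(* [class_weight] was defined as a conditional probability: here it is one *)
Let integral_class_test c w :
  \int[aux_prob m c]_a (class_test c w a)%:E =
  (class_weight X color m D J test c w)%:E.
Proof.
pose s := cls c w; pose n := size s.
pose F (t : nat) : R := (\prod_(j < n) test c j (X (nth 0%N s (nth_perm n t j)) w.1))%R.
have F0 t : (0 <= F t)%R by apply: prodr_ge0 => j _; have /andP[] := test01 c j (X (nth 0%N s (nth_perm n t j)) w.1).
have t0 j e : (0 <= test c j e)%R by have /andP[] := test01 c j e.
have mf : measurable_fun setT (fun a : aux_space E => (class_test c w a)%:E).
  apply/measurable_EFinP.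
  exact: (measurableT_comp (measurable_class_test c) (measurable_pair1 w)).
rewrite /aux_prob (@fubini_tonelli1 _ _ (seqspace nat) (seqspace E) R _ _ _ mf); last first.
  by move=> a; rewrite lee_fin; have /andP[] := class_test01 c w a.
have inner t : fubini_F (seqlaw (fun=> m c)) (fun a => (class_test c w a)%:E) t =
    (\1_(D c) n * \prod_(n <= j < J) \int[m c]_e test c j e)%:E * (F (t n))%:E.
  rewrite /fubini_F /class_test/= -/s -/n -/(F (t n)).
  under eq_integral do rewrite mulrA EFinM.
  rewrite ge0_integralZl//; last 3 first.
  - apply/measurable_EFinP; apply: measurable_prod => j _.
    by apply: measurableT_comp; [exact: mtest|exact: measurable_coord].
  - by move=> x _; rewrite lee_fin prodr_ge0.
  - by rewrite lee_fin mulr_ge0.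
  rewrite (@integral_seqlaw_prod _ E R (fun=> m c) (index_iota n J) (test c) (iota_uniq _ _))//.
  rewrite !EFinM muleAC; congr (_ * _ * _); rewrite -prodEFin; apply: eq_bigr => j _.
  rewrite (EFin_expectation (m c) (c := 1%R) (mtest c j))// => e.
  by have /andP[h0 h1] := test01 c j e; rewrite ger0_norm.
rewrite (eq_integral (fun t : seqspace nat => (\1_(D c) n * \prod_(n <= j < J) \int[m c]_e test c j e)%:E * (F (t n))%:E)); last first.
  by move=> t _; exact: inner.
have tail0 : (0 <= \prod_(n <= j < J) \int[m c]_e test c j e)%R.
  by apply: prodr_ge0 => j _; apply: Rintegral_ge0.
rewrite ge0_integralZl//; last 3 first.
- by apply/measurable_EFinP; apply: measurableT_comp => //; exact: measurable_coord.
- by move=> t _; rewrite lee_fin.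
- by rewrite lee_fin mulr_ge0.
have -> : \int[seqlaw (fun k => fact_uniform k)]_t (F (t n))%:E =
    (n`!%:R^-1 * \sum_(i < n`!) F i)%:E.
  rewrite -integral_fact_uniform//.
  have := @integral_seqlaw_prod _ nat R (fun k => fact_uniform k) [:: n] (fun=> F) isT.
  rewrite big_seq1 => <-//.
  by apply: eq_integral => t _; rewrite big_seq1.
rewrite -EFinM /class_weight /enum_weight -/s -/n; congr (_%:E).
have -> : (\sum_(i < n`!) F i = perm_sum (fun k (w : marked_space Om T) => X k w.1) (cls c) n (test c) w)%R.
  rewrite /F (@sum_nth_perm R n (fun p => (\prod_(j < n) test c j (X (nth 0%N s (p j)) w.1))%R)).
  rewrite /perm_sum; apply: eq_bigr => p _; apply: eq_bigr => j _.
  by rewrite valK.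
by ring.
Qed.

(** Integrating out the auxiliary variables, one class after the other, leaves
    the product of the [class_weight]s. *)
Theorem enum_joint_law (A : set Om) (C : seq I) : measurable A ->
  generating_formula P X mu A -> uniq C ->
  ext_prob [set w | A w.1.1 /\ forall c, c \in C ->
     D c (enum_count c w) /\ forall j, (j < J)%N -> B c j (enum_value c j w)] =
  P A * \prod_(c <- C) (poisson_prob (M c) 0 (D c) * \prod_(j < J) m c (B c j)).
Proof.
move=> mA genA uC.
transitivity (P A * \prod_(c <- C) (poisson_prob (M c) 0 (D c) *
    (\prod_(j < J) \int[m c]_e test c j e)%:E)); last first.
  congr (_ * _); apply: eq_bigr => c _; congr (_ * _); rewrite -prodEFin.
  by apply: eq_bigr => j _; rewrite test_mean.
rewrite -(integral_class_weights mX mcolor M0 color_intE generatingT mA genA D mtest test01 testJ uC).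
pose F (z : marked_space Om T * aux_seq_space E) : R :=
  (\1_A z.1.1 * \prod_(c <- C) class_test c z.1 (z.2 (choice.pickle c)))%R.
have mF : measurable_fun setT (EFin \o F).
  apply/measurable_EFinP; apply: measurable_funM.
    have mI : measurable_fun setT (\1_A : Om -> R) by exact: measurable_indic.
    exact: (measurableT_comp mI (measurableT_comp measurable_fst measurable_fst)).
  apply: measurable_prod => c _.
  have mg : measurable_fun setT (fun z : marked_space Om T * aux_seq_space E =>
      (z.1, z.2 (choice.pickle c)) : marked_space Om T * aux_space E).
    apply/measurable_fun_pairP; split; first exact: measurable_fst.
    exact: (measurableT_comp (measurable_coord _) measurable_snd).
  exact: (measurableT_comp (measurable_class_test c) mg).
have F0 z : 0 <= (EFin \o F) z.
  rewrite lee_fin mulr_ge0// prodr_ge0// => c _.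
  by have /andP[] := class_test01 c z.1 (z.2 (choice.pickle c)).
have FE (z : ext_space) : F z = \1_([set w | A w.1.1 /\ forall c, c \in C ->
     D c (enum_count c w) /\ forall j, (j < J)%N -> B c j (enum_value c j w)]) z.
  rewrite /F.
  transitivity ((\1_A z.1.1 : R) * \prod_(c <- C) ((enum_count c z \in D c) &&
      all (fun j => enum_value c j z \in B c j) (iota 0 J))%:R)%R.
    congr (_ * _)%R; apply: eq_bigr => c _; rewrite class_testE indicE -mulnb natrM.
    congr (_ * _)%R; rewrite -(big_mkord predT (fun j => \1_(B c j) (enum_value c j z))).
    by rewrite /index_iota subn0 -prod_natr_bool.
  rewrite prod_natr_bool !indicE -natrM mulnb; congr (_%:R); congr nat_of_bool.
  apply/idP/idP.
    move=> /andP[/set_mem Az /allP h]; apply/mem_set; split => // c /h /andP[/set_mem Dc /allP h'].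
    by split => // j jJ; apply: set_mem; apply: h'; rewrite mem_iota.
  move=> /set_mem[Az h]; rewrite mem_set//=; apply/allP => c /h [Dc h'].
  by rewrite mem_set//=; apply/allP => j; rewrite mem_iota add0n => /andP[_ jJ]; exact/mem_set/h'.
set S := (X in \1_X) in FE *.
have mS : measurable S.
  rewrite [X in measurable X](_ : _ = [set: ext_space] `&` F @^-1` [set 1%R]).
    by apply: (measurable_EFinP _ _).1 mF _ _ _.
  rewrite setTI; apply/seteqP; split => z; rewrite /preimage/= FE indicE.
    by move=> Sz; rewrite mem_set.
  case: (boolP (z \in S)) => [/set_mem//|_] /esym/eqP.
  by rewrite oner_eq0.
transitivity (\int[ext_prob]_z (\1_S z)%:E); first by rewrite integral_indic// setIT.
transitivity (\int[ext_prob]_z (F z)%:E); first by apply: eq_integral => z _; rewrite FE.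
rewrite [LHS](@fubini_tonelli1 _ _ (marked_space Om T) (aux_seq_space E) R P1 (aux_seq_prob m) _ mF F0).
apply: eq_integral => w _; rewrite /fubini_F/= /F/=.
under eq_integral do rewrite EFinM.
have mct c : measurable_fun setT (class_test c w).
  exact: (measurableT_comp (measurable_class_test c) (measurable_pair1 w)).
rewrite ge0_integralZl//; last 2 first.
- apply/measurable_EFinP/measurable_prod => c _.
  exact: (measurableT_comp (mct c) (measurable_coord _)).
- by move=> v _; rewrite lee_fin prodr_ge0// => c _; have /andP[] := class_test01 c w (v (choice.pickle c)).
rewrite EFinM; congr (_ * _).
pose f i (a : aux_space E) : R := if @choice.unpickle I i is Some c then class_test c w a else 1%R.
have := @integral_seqlaw_prod _ (aux_space E) R (coded_aux_prob m) (map (@choice.pickle I) C) f.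
rewrite map_inj_uniq ?uC; last exact: (pcan_inj (@choice.pickleK I)).
have mf i : measurable_fun setT (f i) by rewrite /f; case: choice.unpickle.
have f0 i a : (0 <= f i a)%R.
  by rewrite /f; case: choice.unpickle => [c|//]; have /andP[] := class_test01 c w a.
move=> /(_ isT mf f0) h.
transitivity (\int[aux_seq_prob m]_v (\prod_(i <- map (@choice.pickle I) C) f i (v i))%:E).
  apply: eq_integral => v _; rewrite big_map; congr (_%:E).
  by apply: eq_bigr => c _; rewrite /f choice.pickleK.
rewrite [LHS]h big_map -prodEFin; apply: eq_bigr => c _.
rewrite -integral_class_test /coded_aux_prob choice.pickleK.
by apply: eq_integral => a _; rewrite /f choice.pickleK.
Qed.

End enumerated_process.

(** * Independence of set systems and of blocks *)
Section independence_lemmas.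
Context d (Om : measurableType d) (R : realType) (P : probability Om R).
Local Open Scope ereal_scope.

(** It is enough to check the product formula on arbitrarily large finite index
    sets, since absent indices can be given the sure event. *)
Lemma mutually_independent_cofinal (K : choiceType) (D : set K) (F : K -> set_system Om) :
  (forall k, F k setT) ->
  (forall J : {fset K}, [set` J] `<=` D -> exists s : seq K, [/\ uniq s, {subset J <= s} &
    forall A : K -> set Om, (forall k, k \in s -> F k (A k)) ->
    P (\bigcap_(k in [set` s]) A k) = \prod_(k <- s) P (A k)]) ->
  mutually_independent P D F.
Proof.
move=> FT H J JD A FA; have [s [us Js hs]] := H J JD.
pose A' k := if k \in J then A k else setT.
have FA' k : F k (A' k) by rewrite /A'; case: ifPn => [/FA|].
have := hs A' (fun k _ => FA' k).
have -> : \bigcap_(k in [set` s]) A' k = \bigcap_(k in [set` J]) A k.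
  apply/seteqP; split => w h k /=.
    by move=> kJ; have := h k (Js k kJ); rewrite /A' kJ.
  by move=> ks; rewrite /A'; case: ifPn => // kJ; exact: h.
move=> ->; rewrite (bigID (fun k => k \in J))/= [X in _ * X]big1 ?mule1; last first.
  by move=> k kJ; rewrite /A' (negbTE kJ) probability_setT.
rewrite -big_filter.
rewrite (perm_big (enum_fset J)); last first.
  apply: uniq_perm; [exact: filter_uniq|exact: fset_uniq|].
  move=> k; rewrite mem_filter; case: (boolP (k \in J)) => //= kJ.
  exact: Js.
by apply: eq_big_seq => k kJ; rewrite /A' kJ.
Qed.

Lemma mutually_independent_seq (I : choiceType) (F : I -> set_system Om) (s : seq I) A :
  mutually_independent P setT F -> uniq s -> (forall i, i \in s -> F i (A i)) ->
  P (\bigcap_(i in [set` s]) A i) = \prod_(i <- s) P (A i).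
Proof.
move=> H us FA.
have sE : perm_eq s [fset i in s]%fset.
  by apply: uniq_perm => // i; rewrite in_fset.
have -> : \bigcap_(i in [set` s]) A i = \bigcap_(i in [set` [fset i in s]%fset]) A i.
  by congr (bigcap _ _); apply/seteqP; split => i /=; rewrite in_fset.
rewrite H// => [|i]; first by rewrite (perm_big _ sE).
by rewrite in_fset; exact: FA.
Qed.
Section pi_systems.
Context (L : choiceType) (G : L -> set_system Om).
Hypothesis mG : forall l, G l `<=` measurable.
Hypothesis GI : forall l, setI_closed (G l).
Hypothesis GT : forall l, G l setT.

Let msG l A : <<s G l >> A -> measurable A.
Proof. by apply: smallest_sub => //; exact: sigma_algebra_measurable. Qed.

Let mcap (s : seq L) (A : L -> set Om) : (forall l, l \in s -> measurable (A l)) ->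
  measurable (\bigcap_(l in [set` s]) A l).
Proof. by move=> h; apply: fin_bigcap_measurable. Qed.

Let upgrade (s1 s2 : seq L) (A : L -> set Om) :
  (forall B : L -> set Om, (forall l, l \in s1 ++ s2 -> G l (B l)) ->
    P (\bigcap_(l in [set` s1 ++ s2]) B l) = \prod_(l <- s1 ++ s2) P (B l)) ->
  uniq (s1 ++ s2) ->
  (forall l, l \in s1 -> <<s G l >> (A l)) -> (forall l, l \in s2 -> G l (A l)) ->
  P (\bigcap_(l in [set` s1 ++ s2]) A l) = \prod_(l <- s1 ++ s2) P (A l).
Proof.
elim: s1 s2 A => [|l s1 IH] s2 A H u As1 As2; first by rewrite H.
have perm : perm_eq (l :: s1 ++ s2) (s1 ++ l :: s2).
  by rewrite -cat1s -(cat1s l s2) perm_catCA.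
have memE k : (k \in s1 ++ l :: s2) = (k \in l :: s1 ++ s2) by rewrite (perm_mem perm).
have capE (B : L -> set Om) : \bigcap_(k in [set` s1 ++ l :: s2]) B k =
    \bigcap_(k in [set` (l :: s1) ++ s2]) B k.
  by apply/seteqP; split => w h k /= ks; apply: h; rewrite /= ?memE// -memE.
have H' (B : L -> set Om) : (forall k, k \in s1 ++ l :: s2 -> G k (B k)) ->
    P (\bigcap_(k in [set` s1 ++ l :: s2]) B k) = \prod_(k <- s1 ++ l :: s2) P (B k).
  move=> GB; rewrite capE H; last by move=> k ks; apply: GB; rewrite memE.
  by rewrite (perm_big _ perm).
have u' : uniq (s1 ++ l :: s2) by rewrite -(perm_uniq perm).
have ls : l \notin s1 ++ s2 by move: u => /= /andP[].
pose Rest := \bigcap_(k in [set` s1 ++ s2]) A k.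
have mA k : k \in (l :: s1) ++ s2 -> measurable (A k).
  by rewrite mem_cat => /orP[/As1/msG//|/As2/mG].
have mRest : measurable Rest by apply: mcap => k ks; apply: mA; rewrite /= inE ks orbT.
have base B : G l B -> P (B `&` Rest) = P B * \prod_(k <- s1 ++ s2) P (A k).
  move=> GB; pose A' k := if k == l then B else A k.
  have A'k k : k \in s1 ++ s2 -> A' k = A k.
    by rewrite /A'; case: eqP => // -> ls'; rewrite ls' in ls.
  have A'l : A' l = B by rewrite /A' eqxx.
  have := IH (l :: s2) A' H' u'.
  have h1 k : k \in s1 -> <<s G k >> (A' k).
    by move=> ks; rewrite A'k ?mem_cat ?ks//; apply: As1; rewrite inE ks orbT.
  have h2 k : k \in l :: s2 -> G k (A' k).
    rewrite inE => /orP[/eqP ->|ks]; first by rewrite A'l.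
    by rewrite A'k ?mem_cat ?ks ?orbT//; exact: As2.
  move=> /(_ h1 h2); rewrite -(perm_big _ perm)/= big_cons A'l.
  have -> : \prod_(k <- s1 ++ s2) P (A' k) = \prod_(k <- s1 ++ s2) P (A k).
    by apply: eq_big_seq => k /A'k ->.
  move=> <-; congr (P _); rewrite capE; apply/seteqP; split => w.
    move=> [Bw Rw] k /=; rewrite inE => /orP[/eqP ->|ks]; first by rewrite A'l.
    by rewrite A'k//; exact: Rw.
  move=> h; split; first by rewrite -A'l; apply: h; rewrite /= inE eqxx.
  by move=> k ks; rewrite -(A'k k ks); apply: h; rewrite /= inE ks orbT.
have PRest : P Rest = \prod_(k <- s1 ++ s2) P (A k).
  by have := base _ (GT l); rewrite setTI probability_setT mul1e.
have fRest : P Rest \is a fin_num by exact: fin_num_measure.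
pose c : {nonneg R} := NngNum (fine_ge0 (measure_ge0 P Rest)).
pose m1 : {measure set Om -> \bar R} := mrestr P mRest.
pose m2 : {measure set Om -> \bar R} := mscale c P.
have E1 : m1 (A l) = m2 (A l).
  have cover : \bigcup_(k : nat) [set: Om] = [set: Om] by apply: bigcup_const; exists 0%N.
  have hu := @g_sigma_algebra_measure_unique _ R Om (G l) (@mG l) (fun=> setT)
    (fun=> GT l) cover m1 m2 (@GI l).
  apply: hu => //.
  - move=> B GB; have -> : m2 B = (fine (P Rest))%:E * P B by [].
    by rewrite fineK// PRest muleC; exact: base.
  - move=> _; rewrite /m1/= /mrestr setTI; apply: le_lt_trans (probability_le1 _ _) _ => //.
    exact: ltry.
  - by apply: As1; rewrite mem_head.
rewrite /= big_cons -PRest.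
have E2 : P (A l `&` Rest) = (fine (P Rest))%:E * P (A l) := E1.
move: E2; rewrite fineK// muleC => <-; congr (P _).
apply/seteqP; split => w.
  move=> h; split; first by apply: h; rewrite /= mem_head.
  by move=> k ks; apply: h; rewrite /= inE ks orbT.
move=> [Aw Rw] k /=; rewrite inE => /orP[/eqP ->//|ks]; exact: Rw.
Qed.

(** One system at a time: two finite measures that agree on a pi-system agree on
    the sigma-algebra that it generates. *)
Lemma mutually_independent_sigma (D : set L) : mutually_independent P D G ->
  mutually_independent P D (fun l => <<s G l >>).
Proof.
move=> H J JD A GA.
have := @upgrade (enum_fset J) [::] A; rewrite cats0; apply => //.
- by move=> B GB; have := H J JD B GB.
Qed.

End pi_systems.

Section grouping.
Context (K L : choiceType) (F : K -> set_system Om) (g : K -> L).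
Hypothesis mF : forall k, F k `<=` measurable.
Hypothesis FI : forall k, setI_closed (F k).
Hypothesis FT : forall k, F k setT.
Hypothesis indepF : mutually_independent P setT F.

(** Finite intersections of events of the block of l: a pi-system generating the
    sigma-algebra of the block. *)
Definition group_pi (l : L) : set_system Om :=
  [set B | exists (J : {fset K}) (A : K -> set Om),
    [/\ forall k, F k (A k), forall k, k \in J -> g k = l & B = \bigcap_(k in [set` J]) A k]].

Let group_piT l : group_pi l setT.
Proof.
exists fset0, (fun=> setT); split => //.
by apply/seteqP; split.
Qed.

Let group_piI l : setI_closed (group_pi l).
Proof.
move=> _ _ [J [A [FA gJ ->]]] [J' [A' [FA' gJ' ->]]].
pose A1 k := (if k \in J then A k else setT) `&` (if k \in J' then A' k else setT).
exists (J `|` J')%fset, A1; split.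
- by move=> k; apply: FI; case: ifP.
- by move=> k; rewrite in_fsetU => /orP[/gJ|/gJ'].
apply/seteqP; split => w.
  move=> [h h'] k _; rewrite /A1; split; case: ifPn => // kJ; [exact: h|exact: h'].
move=> h; split => k /= kJ; have := h k; rewrite /= in_fsetU kJ ?orbT => /(_ isT)[];
  by rewrite kJ.
Qed.

Let group_pi_measurable l : group_pi l `<=` measurable.
Proof.
move=> _ [J [A [FA gJ ->]]]; apply: fin_bigcap_measurable; first exact: finite_fset.
by move=> k _; exact: mF.
Qed.

Let indep_group_pi : mutually_independent P setT group_pi.
Proof.
move=> J _ B GB.
have ex l : exists JA : {fset K} * (K -> set Om), l \in J ->
    [/\ forall k, F k (JA.2 k), forall k, k \in JA.1 -> g k = l & B l = \bigcap_(k in [set` JA.1]) JA.2 k].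
  have [lJ|lJ] := boolP (l \in J); last by exists (fset0, fun=> setT).
  by have [J' [A' h]] := GB l lJ; exists (J', A').
pose S l := (projT1 (cid (ex l))).1; pose A l := (projT1 (cid (ex l))).2.
have SA l : l \in J -> [/\ forall k, F k (A l k), forall k, k \in S l -> g k = l & B l = \bigcap_(k in [set` S l]) A l k].
  exact: (projT2 (cid (ex l))).
pose A' k := if (g k \in J) && (k \in S (g k)) then A (g k) k else setT.
have FA' k : F k (A' k).
  by rewrite /A'; case: ifPn => // /andP[gJ _]; have [] := SA _ gJ.
have A'S l k : l \in J -> k \in S l -> A' k = A l k.
  by move=> lJ kS; have [_ gk _] := SA l lJ; rewrite /A' (gk k kS) lJ kS.
have PB l : l \in J -> P (B l) = \prod_(k <- S l) P (A l k).
  move=> lJ; have [FA gS ->] := SA l lJ.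
  by have := indepF (J := S l) (fun _ _ => I) (fun k _ => FA k).
pose U := flatten [seq enum_fset (S l) | l <- enum_fset J].
have uU : uniq U.
  rewrite /U; have : {subset enum_fset J <= J} by [].
  elim: (enum_fset J) (fset_uniq J) => [//|l s IH] /= /andP[ls us] sJ.
  rewrite cat_uniq fset_uniq IH//; last by move=> k ks; apply: sJ; rewrite inE ks orbT.
  rewrite andbT/=; apply/hasPn => k /flattenP[_ /mapP[l' l's ->]] kS'.
  apply/negP => kS; have [_ g1 _] := SA l (sJ l (mem_head _ _)).
  have l'J : l' \in J by apply: sJ; rewrite inE l's orbT.
  have [_ g2 _] := SA l' l'J.
  by move: ls; rewrite -(g1 k kS) (g2 k kS') l's.
have memU k : k \in U -> exists2 l, l \in J & k \in S l.
  by move=> /flattenP[_ /mapP[l lJ ->]] kS; exists l.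
have -> : \bigcap_(l in [set` J]) B l = \bigcap_(k in [set` U]) A' k.
  apply/seteqP; split => w h.
    move=> k /= /memU[l lJ kS]; rewrite (A'S l k lJ kS).
    by have := h l lJ; have [_ _ ->] := SA l lJ; exact.
  move=> l /= lJ; have [_ _ ->] := SA l lJ; move=> k /= kS.
  rewrite -(A'S l k lJ kS); apply: h => /=.
  by apply/flattenP; exists (enum_fset (S l)) => //; apply/mapP; exists l.
rewrite (mutually_independent_seq (A := A') indepF uU (fun k _ => FA' k)).
rewrite /U big_flatten/= big_map; apply: eq_big_seq => l lJ.
by rewrite PB//; apply: eq_big_seq => k kS; rewrite (A'S l k lJ kS).
Qed.

(** The pi-systems [group_pi] are independent by associativity of products. *)
Lemma mutually_independent_group :
  mutually_independent P setT (fun l => <<s \bigcup_(k in [set k | g k = l]) F k >>).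
Proof.
have := mutually_independent_sigma group_pi_measurable group_piI group_piT indep_group_pi.
move=> H J JD A FA; apply: H => // l lJ; have := FA l lJ.
apply: smallest_sub; first exact: smallest_sigma_algebra.
move=> B [k gk FB]; apply: sub_sigma_algebra.
exists [fset k]%fset, (fun k' => if k' == k then B else setT); split.
- by move=> k'; case: eqP => // ->.
- by move=> k'; rewrite in_fset1 => /eqP ->.
apply/seteqP; split => w.
  by move=> Bw k' /=; rewrite in_fset1 => /eqP ->; rewrite eqxx.
by move=> /(_ k); rewrite /= in_fset1 eqxx; exact.
Qed.

End grouping.

End independence_lemmas.

(** * Independence of the base space, the counts and the enumerated points *)
Section independent_components.
Context d (Om : measurableType d) (R : realType) (P : probability Om R).
Context d1 (E1 : measurableType d1) d2 (E2 : measurableType d2).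
Variable X : nat -> Om -> E1 * E2.
Context dT (T : measurableType dT) (lam : probability T R).
Hypothesis mX : forall k, measurable_fun setT (X k).
Variable (mu : {measure set (E1 * E2) -> \bar R}) (I : countType).
Variable color : E1 * E2 * T -> option I.
Hypothesis mcolor : forall c, measurable [set z | color z = Some c].
Variables (M : I -> R) (m1 : I -> probability E1 R) (m2 : probability E2 R).
Hypothesis M0 : forall c, 0 < M c.

Definition class_law (c : I) : probability (E1 * E2)%type R := (m1 c \x m2)%E.

Hypothesis color_intE : forall c (f : E1 * E2 -> R), measurable_fun setT f ->
  (forall e, 0 <= f e <= 1) ->
  color_int lam mu color c f = (M c * (1 - \int[class_law c]_e f e))%:E.
Variable base : set_system Om.
Hypothesis mbase : base `<=` measurable.
Hypothesis baseI : setI_closed base.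
Hypothesis baseT : base setT.
Hypothesis generating_base : forall A, base A -> generating_formula P X mu A.

Local Notation EP := (ext_prob P lam class_law).
Local Notation ES := (ext_space Om (E1 * E2)%type T).
Local Notation count := (@enum_count _ Om _ _ X _ T I color).
Local Notation value := (@enum_value _ Om _ _ X _ T I color).

Definition ext_proj (w : ES) : Om := w.1.1.

Lemma measurable_ext_proj : measurable_fun setT ext_proj.
Proof. exact: (measurableT_comp measurable_fst measurable_fst). Qed.

Lemma ext_proj_law A : measurable A -> EP (ext_proj @^-1` A) = P A.
Proof.
move=> mA.
have -> : ext_proj @^-1` A = (A `*` setT) `*` setT by apply/seteqP; split => -[[a b] c]//= [[]].
rewrite [LHS](@product_measure1E _ _ (marked_space Om T) (aux_seq_space (E1 * E2)%type)) //; last exact: measurableX.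
rewrite [X in (X * _)%E](@product_measure1E _ _ Om (seqspace T))//.
rewrite [X in (_ * X * _)%E](_ : _ = 1%E); last exact: (@probability_setT _ _ _ (marks lam)).
rewrite [X in (_ * X)%E](_ : _ = 1%E); last exact: (@probability_setT _ _ _ (aux_seq_prob class_law)).
by rewrite !mule1.
Qed.

(* the laws of the single variables are marginals of the joint law *)
Let joint := enum_joint_law mX mcolor M0 color_intE (generating_base baseT).

Lemma count_law c (D : set nat) :
  EP (count c @^-1` D) = poisson_prob (M c) 0 D.
Proof.
have := @joint (fun=> D) 0%N (fun _ _ => setT) (fun _ _ => measurableT) setT [:: c]
  measurableT (generating_base baseT) isT.
rewrite big_seq1 big_ord0 mule1 probability_setT mul1e => <-; congr (EP _).
apply/seteqP; split => w /=.
  by move=> Dw; split => // c'; rewrite inE => /eqP ->.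
by move=> [_ /(_ c (mem_head _ _))[]].
Qed.

Lemma value_law c j (B : set (E1 * E2)) : measurable B ->
  EP (value c j @^-1` B) = class_law c B.
Proof.
move=> mB.
have := @joint (fun=> setT) j.+1 (fun _ j' => if j' == j then B else setT) _ setT [:: c]
  measurableT (generating_base baseT) isT.
have mB' (c' : I) j' : measurable (if j' == j then B else setT) by case: ifP.
move=> /(_ mB').
rewrite big_seq1 big_ord_recr/= eqxx !probability_setT !mul1e big1 ?mul1e => [<-|i _]; last first.
  by rewrite ltn_eqF// probability_setT.
congr (EP _); apply/seteqP; split => w /=.
  move=> Bw; split => // c'; rewrite inE => /eqP ->; split => // j' _.
  by case: eqP => // ->.
move=> [_ /(_ c (mem_head _ _))[_ /(_ j (ltnSn j))]].
by rewrite eqxx.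
Qed.

Definition value1 c j (w : ES) : E1 := (value c j w).1.
Definition value2 c j (w : ES) : E2 := (value c j w).2.

Lemma measurable_value1 c j : measurable_fun setT (value1 c j).
Proof. exact: (measurableT_comp measurable_fst (measurable_enum_value mX mcolor c j)). Qed.

Lemma measurable_value2 c j : measurable_fun setT (value2 c j).
Proof. exact: (measurableT_comp measurable_snd (measurable_enum_value mX mcolor c j)). Qed.

Lemma value1_law c j (B : set E1) : measurable B ->
  EP (value1 c j @^-1` B) = m1 c B.
Proof.
move=> mB; have := @value_law c j (B `*` setT) (measurableX mB measurableT).
rewrite [RHS](@product_measure1E _ _ E1 E2)//.
rewrite [X in (_ * X)%E](_ : _ = 1%E) ?mule1; last exact: (@probability_setT _ _ _ m2).
by move=> <-; congr (EP _); apply/seteqP; split => w //= [].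
Qed.

Lemma value2_law c j (B : set E2) : measurable B ->
  EP (value2 c j @^-1` B) = m2 B.
Proof.
move=> mB; have := @value_law c j (setT `*` B) (measurableX measurableT mB).
rewrite [RHS](@product_measure1E _ _ E1 E2)//.
rewrite [X in (X * _)%E](_ : _ = 1%E) ?mul1e; last exact: (@probability_setT _ _ _ (m1 c)).
by move=> <-; congr (EP _); apply/seteqP; split => w //= [].
Qed.

(** Indices, in this order, of the base space, the second coordinates, the counts
    and the first coordinates: the four families of the representation. *)
Definition component : choiceType := ((unit + I * nat) + (I + I * nat))%type.

Definition component_events (k : component) : set_system ES :=
  match k with
  | inl (inl _) => [set ext_proj @^-1` A | A in base]
  | inl (inr p) => sigma_rv (value2 p.1 p.2)
  | inr (inl c) => sigma_rv (count c)
  | inr (inr p) => sigma_rv (value1 p.1 p.2)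
  end.

Lemma sigma_rvP d' (S : measurableType d') (Y : ES -> S) A :
  sigma_rv Y A -> exists2 B, measurable B & A = Y @^-1` B.
Proof. by move=> [B mB <-]; exists B => //; rewrite setTI. Qed.

Lemma sigma_rv_preimage d' (S : measurableType d') (Y : ES -> S) B :
  measurable B -> sigma_rv Y (Y @^-1` B).
Proof. by move=> mB; exists B => //; rewrite setTI. Qed.

Lemma sigma_rvT d' (S : measurableType d') (Y : ES -> S) : sigma_rv Y setT.
Proof. by exists setT => //; rewrite setTI preimage_setT. Qed.

Lemma sigma_rvI d' (S : measurableType d') (Y : ES -> S) : setI_closed (sigma_rv Y).
Proof.
move=> _ _ /sigma_rvP[B mB ->] /sigma_rvP[C mC ->].
by rewrite -preimage_setI; apply: sigma_rv_preimage; exact: measurableI.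
Qed.

Lemma sigma_rv_measurable d' (S : measurableType d') (Y : ES -> S) :
  measurable_fun setT Y -> sigma_rv Y `<=` measurable.
Proof. by move=> mY _ [B mB <-]; exact: mY. Qed.

Lemma component_measurable k : component_events k `<=` measurable.
Proof.
case: k => [[u|p]|[c|p]] /=.
- move=> _ [A bA <-]; rewrite -[X in measurable X]setTI.
  by apply: measurable_ext_proj => //; exact: mbase.
- by apply: sigma_rv_measurable; exact: measurable_value2.
- by apply: sigma_rv_measurable; exact: measurable_enum_count.
- by apply: sigma_rv_measurable; exact: measurable_value1.
Qed.

Lemma component_setI k : setI_closed (component_events k).
Proof.
case: k => [[u|p]|[c|p]] /=; try exact: sigma_rvI.
move=> _ _ [A bA <-] [B bB <-]; exists (A `&` B); first exact: baseI.
by rewrite preimage_setI.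
Qed.

Lemma component_setT k : component_events k setT.
Proof.
case: k => [[u|p]|[c|p]] /=; try exact: sigma_rvT.
by exists setT => //; rewrite preimage_setT.
Qed.

Local Open Scope ereal_scope.

(** By [mutually_independent_cofinal] it suffices to treat all the indices with
    class in a finite list C and rank below J, where the product formula is the
    joint law. *)
Theorem component_independent : mutually_independent EP setT component_events.
Proof.
apply: mutually_independent_cofinal; first exact: component_setT.
move=> K _.
pose idx (k : component) : seq (I * nat) :=
  match k with inl (inl _) => [::] | inl (inr p) => [:: p] | inr (inl c) => [:: (c, 0%N)] | inr (inr p) => [:: p] end.
have [C [J [uC psP]]] : exists (C : seq I) (J : nat), uniq C /\
    forall k p, k \in K -> p \in idx k -> p.1 \in C /\ (p.2 < J)%N.
  pose ps : seq (I * nat) := flatten [seq idx k | k <- enum_fset K].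
  exists (undup [seq p.1 | p <- ps]), (\max_(p <- ps) p.2).+1; split; first exact: undup_uniq.
  move=> k p kK pk; have pps : p \in ps by apply/flattenP; exists (idx k) => //; exact: map_f.
  by split; [rewrite mem_undup; exact: map_f|rewrite ltnS; exact: leq_bigmax_seq].
pose s2 : seq component := [seq (inl (inr (c, j)) : component) | c <- C, j <- iota 0 J].
pose s1 : seq component := [seq (inr (inr (c, j)) : component) | c <- C, j <- iota 0 J].
pose s0 : seq component := [seq (inr (inl c) : component) | c <- C].
pose s : seq component := (inl (inl tt) : component) :: s2 ++ s0 ++ s1.
have mem2 c j : (inl (inr (c, j)) \in s2) = (c \in C) && (j < J)%N.
  apply/allpairsP/andP => [[[c' j'] /= [cC jJ [-> ->]]]|[cC jJ]].
    by rewrite cC; rewrite mem_iota add0n in jJ.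
  by exists (c, j); split; rewrite // mem_iota.
have mem1 c j : (inr (inr (c, j)) \in s1) = (c \in C) && (j < J)%N.
  apply/allpairsP/andP => [[[c' j'] /= [cC jJ [-> ->]]]|[cC jJ]].
    by rewrite cC; rewrite mem_iota add0n in jJ.
  by exists (c, j); split; rewrite // mem_iota.
have mem0 c : (inr (inl c) \in s0) = (c \in C).
  by rewrite mem_map// => x y [].
exists s; split.
- rewrite /s cons_uniq !cat_uniq.
  have u2 : uniq s2.
    by apply: allpairs_uniq => //; [exact: iota_uniq|move=> [a b] [a' b'] _ _ [-> ->]].
  have u1 : uniq s1.
    by apply: allpairs_uniq => //; [exact: iota_uniq|move=> [a b] [a' b'] _ _ [-> ->]].
  have u0 : uniq s0 by rewrite map_inj_uniq// => x y [].
  rewrite u2 u1 u0/= !andbT; apply/and3P; split.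
  + rewrite !mem_cat !negb_or; apply/and3P; split.
    * by apply/negP => /allpairsP[[c j] /= [_ _]].
    * by apply/negP => /mapP[c _].
    * by apply/negP => /allpairsP[[c j] /= [_ _]].
  + apply/hasPn => k; rewrite mem_cat => /orP[/mapP[c _ ->]|/allpairsP[[c j] /= [_ _ ->]]].
      by apply/negP => /allpairsP[[c' j] /= [_ _]].
    by apply/negP => /allpairsP[[c' j'] /= [_ _]].
  + apply/hasPn => k /allpairsP[[c j] /= [_ _ ->]].
    by apply/negP => /mapP[c' _].
- move=> k kK; rewrite /s in_cons !mem_cat.
  move: k kK => [[[]|[c j]]|[c|[c j]]] kK //.
  + have [h1 h2] := psP _ (c, j) kK (mem_head _ _).
    by rewrite mem2 h1 h2 orbT.
  + have [h1 h2] := psP _ (c, 0%N) kK (mem_head _ _).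
    by rewrite mem0 h1 !orbT.
  + have [h1 h2] := psP _ (c, j) kK (mem_head _ _).
    by rewrite mem1 h1 h2 !orbT.
move=> A FA.
have [A0 bA0 A0E] : exists2 A0, base A0 & A (inl (inl tt)) = ext_proj @^-1` A0.
  by have [A0 bA0 <-] := FA (inl (inl tt)) (mem_head _ _); exists A0.
have ex2 (p : I * nat) : exists B, measurable B /\ ((p.1 \in C) && (p.2 < J)%N ->
    A (inl (inr p)) = value2 p.1 p.2 @^-1` B).
  have [h|h] := boolP ((p.1 \in C) && (p.2 < J)%N); last by exists setT.
  have ks : inl (inr p) \in s by rewrite /s in_cons mem_cat; case: (p) h => c j h; rewrite mem2 h orbT.
  by have /sigma_rvP[B mB ->] := FA _ ks; exists B.
have ex1 (p : I * nat) : exists B, measurable B /\ ((p.1 \in C) && (p.2 < J)%N ->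
    A (inr (inr p)) = value1 p.1 p.2 @^-1` B).
  have [h|h] := boolP ((p.1 \in C) && (p.2 < J)%N); last by exists setT.
  have ks : inr (inr p) \in s by rewrite /s in_cons !mem_cat; case: (p) h => c j h; rewrite mem1 h !orbT.
  by have /sigma_rvP[B mB ->] := FA _ ks; exists B.
have ex0 (c : I) : exists D : set nat, c \in C -> A (inr (inl c)) = count c @^-1` D.
  have [h|h] := boolP (c \in C); last by exists setT.
  have ks : inr (inl c) \in s by rewrite /s in_cons !mem_cat mem0 h !orbT.
  by have /sigma_rvP[D mD ->] := FA _ ks; exists D.
have [B2 B2P] := choice ex2; have [B1 B1P] := choice ex1; have [D DP] := choice ex0.
pose B c j := B1 (c, j) `*` B2 (c, j).
have mB c j : measurable (B c j).
  by apply: measurableX; [have [] := B1P (c, j)|have [] := B2P (c, j)].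
have ES_ := @joint D J B mB A0 C (mbase bA0) (generating_base bA0) uC.
have SE : \bigcap_(k in [set` s]) A k = [set w | A0 w.1.1 /\ forall c, c \in C ->
   D c (count c w) /\ forall j, (j < J)%N -> B c j (value c j w)].
  apply/seteqP; split => w /=.
    move=> h; split.
      by have := h (inl (inl tt)) (mem_head _ _); rewrite A0E.
    move=> c cC; split.
      by have := h (inr (inl c)); rewrite /= /s in_cons !mem_cat mem0 cC !orbT DP// => /(_ isT).
    move=> j jJ; split.
      have := h (inr (inr (c, j))); rewrite /= /s in_cons !mem_cat mem1 cC jJ !orbT => /(_ isT).
      by have [_ /= ->//] := B1P (c, j); rewrite cC.
    have := h (inl (inr (c, j))); rewrite /= /s in_cons !mem_cat mem2 cC jJ !orbT => /(_ isT).
    by have [_ /= ->//] := B2P (c, j); rewrite cC.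
  move=> [A0w h] k /=; rewrite /s in_cons !mem_cat => /orP[/eqP ->|]; first by rewrite A0E.
  move=> /or3P[/allpairsP[[c j] /= [cC jJ ->]]|/mapP[c cC ->]|/allpairsP[[c j] /= [cC jJ ->]]].
  - rewrite mem_iota add0n/= in jJ; have [_ ->] := B2P (c, j); last by rewrite cC.
    by have [_ /(_ j jJ)[]] := h c cC.
  - by rewrite DP//; have [] := h c cC.
  - rewrite mem_iota add0n/= in jJ; have [_ ->] := B1P (c, j); last by rewrite cC.
    by have [_ /(_ j jJ)[]] := h c cC.
rewrite SE.
rewrite ES_ /s big_cons !big_cat/= A0E ext_proj_law; last exact: mbase.
congr (_ * _).
rewrite /s2 /s1 /s0 !big_allpairs_dep big_map.
transitivity (\prod_(c <- C) ((\prod_(j <- iota 0 J) m2 (B2 (c, j))) *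
   (poisson_prob (M c) 0 (D c) * \prod_(j <- iota 0 J) m1 c (B1 (c, j))))).
  apply: eq_bigr => c _; rewrite [RHS]muleCA; congr (_ * _).
  rewrite -(big_mkord predT (fun j => class_law c (B c j))) /index_iota subn0 -big_split/=.
  apply: eq_bigr => j _; rewrite muleC [LHS](@product_measure1E _ _ E1 E2)//.
  + by have [] := B1P (c, j).
  + by have [] := B2P (c, j).
rewrite !big_split/=; congr (_ * (_ * _)).
- apply: eq_big_seq => c cC; apply: eq_big_seq => j; rewrite mem_iota add0n => /andP[_ jJ].
  have [mB2 ->] := B2P (c, j); last by rewrite cC.
  by rewrite value2_law.
- by apply: eq_big_seq => c cC; rewrite DP// count_law.
- apply: eq_big_seq => c cC; apply: eq_big_seq => j; rewrite mem_iota add0n => /andP[_ jJ].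
  have [mB1 ->] := B1P (c, j); last by rewrite cC.
  by rewrite value1_law.
Qed.

End independent_components.

(** * Measures with a density *)
Section density.
Import HBNNSimple.
Context d (T : measurableType d) (R : realType).
Variables (mu : {measure set T -> \bar R}) (g : T -> R).

Definition density_measure of measurable_fun setT g & (forall t, 0 <= g t) :
    set T -> \bar R :=
  fun A => (\int[mu]_(t in A) (g t)%:E)%E.

Hypotheses (mg : measurable_fun setT g) (g0 : forall t, 0 <= g t).
Local Open Scope ereal_scope.

Let density0 : density_measure mg g0 set0 = 0.
Proof. by rewrite /density_measure integral_set0. Qed.

Let density_ge0 A : 0 <= density_measure mg g0 A.
Proof. by apply: integral_ge0 => t _; rewrite lee_fin. Qed.

Let mEg : measurable_fun setT (EFin \o g).
Proof. exact/measurable_EFinP. Qed.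

Let density_sigma_additive : semi_sigma_additive (density_measure mg g0).
Proof.
move=> /= F mF tF mUF; rewrite /density_measure; apply: cvg_toP.
  apply: ereal_nondecreasing_is_cvgn => m n mn.
  apply: lee_sum_nneg_natr => // k _ _.
  by apply: integral_ge0 => /= x Fkx; rewrite lee_fin.
rewrite ge0_integral_bigcup//=; first exact: measurable_funTS.
by move=> x _; rewrite lee_fin.
Qed.

HB.instance Definition _ := isMeasure.Build _ _ _ (density_measure mg g0)
  density0 density_ge0 density_sigma_additive.

Lemma density_measureE A : measurable A ->
  density_measure mg g0 A = \int[mu]_t ((g t)%:E * (\1_A t)%:E).
Proof.
move=> mA; rewrite /density_measure integral_mkcond; apply: eq_integral => t _.
by rewrite patchE indicE; case: (t \in A); rewrite ?mule1 ?mule0.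
Qed.

Lemma ge0_integral_density (f : T -> \bar R) : measurable_fun setT f ->
  (forall t, 0 <= f t) ->
  \int[density_measure mg g0]_t f t = \int[mu]_t ((g t)%:E * f t).
Proof.
move=> mf f0; pose f_ := nnsfun_approx measurableT mf.
transitivity (limn (fun n => \int[density_measure mg g0]_t (f_ n t)%:E)).
  rewrite -monotone_convergence//.
  - by apply: eq_integral => y _; apply/esym/cvg_lim => //; apply: cvg_nnsfun_approx.
  - by move=> n; exact/measurable_EFinP/measurable_funP.
  - by move=> n y _; rewrite lee_fin.
  - by move=> y _ m n mn; rewrite lee_fin; exact/lefP/nd_nnsfun_approx.
rewrite [X in limn X](_ : _ = (fun n => \int[mu]_t ((g t)%:E * (f_ n t)%:E))).
  rewrite -monotone_convergence//; last 3 first.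
  - by move=> n; apply: emeasurable_funM => //; exact/measurable_EFinP/measurable_funP.
  - by move=> n y _; rewrite mule_ge0// lee_fin.
  - move=> y _ m n mn; rewrite lee_pmul//; rewrite ?lee_fin//.
    exact/lefP/nd_nnsfun_approx.
  apply: eq_integral => y _; apply/cvg_lim => //; apply: cvgeZl => //.
  exact: cvg_nnsfun_approx.
apply/funext => n.
transitivity (\sum_(k \in range (f_ n)) \int[mu]_t ((g t)%:E * (k * \1_(f_ n @^-1` [set k]) t)%:E)).
  under eq_integral do rewrite fimfunE -fsumEFin//.
  rewrite ge0_integral_fsum//; last 2 first.
  - by move=> y; exact/measurable_EFinP/measurable_funM.
  - by move=> y x _; rewrite nnfun_muleindic_ge0.
  apply: eq_fsbigr => r rf; rewrite integralZl_indic_nnsfun// integral_indic// setIT.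
  have r0 : (0 <= r)%R by move: rf; rewrite inE => -[x _ <-].
  rewrite [X in _ * X]density_measureE// -ge0_integralZl//.
  - by apply: eq_integral => t _; rewrite EFinM muleCA.
  - by apply: emeasurable_funM => //; exact/measurable_EFinP.
  - by move=> t _; rewrite mule_ge0// lee_fin.
rewrite -ge0_integral_fsum//.
- apply: eq_integral => x _; rewrite -ge0_mule_fsumr; last by move=> r; rewrite nnfun_muleindic_ge0.
  by rewrite fsumEFin// -fimfunE.
- by move=> r; apply: emeasurable_funM => //; exact/measurable_EFinP/measurable_funM.
- by move=> r x _; apply: mule_ge0; [rewrite lee_fin|exact: nnfun_muleindic_ge0].
Qed.

End density.

Section density_sigma_finite.
Context d (T : measurableType d) (R : realType).
Variables (mu : {sigma_finite_measure set T -> \bar R}) (g : T -> R).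
Hypotheses (mg : measurable_fun setT g) (g0 : forall t, 0 <= g t).
Local Open Scope ereal_scope.

(* on the sets where g <= n, the density measure is at most n times mu *)
Let density_sigma_finite : sigma_finite setT (density_measure mu mg g0).
Proof.
have [F [FT ndF mF]] := (sigma_finiteP setT mu).1 (sigma_finiteT mu).
have mgn n : measurable [set t | (g t <= n%:R)%R].
  rewrite -[X in measurable X]setTI.
  exact: (measurable_fun_ler mg (@measurable_cst _ _ T R setT n%:R) measurableT (Logic.I : measurable [set true])).
exists (fun n => F n `&` [set t | (g t <= n%:R)%R]).
  apply/seteqP; split => // t _.
  have : (\bigcup_i F i) t by rewrite -FT.
  move=> [i _ Fit]; pose k := maxn i (Num.truncn (g t)).+1.
  exists k => //; split.
    by have /subsetPset/(_ t Fit) := ndF _ _ (leq_maxl i (Num.truncn (g t)).+1).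
  apply/ltW/(lt_le_trans (truncnS_gt (g t))).
  by rewrite ler_nat leq_maxr.
move=> n; split; first by apply: measurableI => //; have [] := mF n.
have [mFn Fn] := mF n.
apply: (@le_lt_trans _ _ (\int[mu]_(t in F n `&` [set t | (g t <= n%:R)%R]) n%:R%:E)).
  apply: ge0_le_integral => //=.
  - exact: measurableI.
  - by move=> t _; rewrite lee_fin.
  - by apply: measurable_funTS; exact/measurable_EFinP.
  - by move=> t [].
rewrite integral_cst; last exact: measurableI.
rewrite lte_mul_pinfty// ?lee_fin//; apply: le_lt_trans Fn.
by apply: le_measure; rewrite ?inE//; exact: measurableI.
Qed.

HB.instance Definition _ := @Measure_isSigmaFinite.Build _ _ _ (density_measure mu mg g0)
  density_sigma_finite.

End density_sigma_finite.

(** * Coloring by a countable partition of the unit interval *)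

(** The unit interval is cut into consecutive cells of lengths [p c e], in the
    order of the codes of the c's: a uniform mark falls in the cell of c with
    probability [p c e]. *)
Section partition_color.
Context d (E : measurableType d) (R : realType) (I : countType).
Variable p : I -> E -> R.
Hypothesis mp : forall c, measurable_fun setT (p c).
Hypothesis p0 : forall c e, 0 <= p c e.

Definition coded_weight (n : nat) (e : E) : R :=
  if choice.pickle_inv n is Some c then p c e else 0.

Definition cumulative_weight (n : nat) (e : E) : R := \sum_(i < n) coded_weight i e.

Hypothesis cumulative_weight_le1 : forall n e, cumulative_weight n e <= 1.

Definition cell (c : I) : set (E * measurableTypeR R) :=
  [set z | cumulative_weight (choice.pickle c) z.1 <= z.2 < cumulative_weight (choice.pickle c).+1 z.1].

Definition partition_color (z : E * measurableTypeR R) : option I :=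
  if pselect (exists c, cell c z) is left h then Some (projT1 (cid h)) else None.

Lemma coded_weight_ge0 n e : 0 <= coded_weight n e.
Proof. by rewrite /coded_weight; case: choice.pickle_inv. Qed.

Lemma cumulative_weight_nd e : {homo cumulative_weight ^~ e : m n / (m <= n)%N >-> m <= n}.
Proof.
apply: homo_leq => [//|x y z|n]; first exact: le_trans.
by rewrite /cumulative_weight big_ord_recr/= lerDl coded_weight_ge0.
Qed.

Lemma cumulative_weight_ge0 n e : 0 <= cumulative_weight n e.
Proof. by apply: sumr_ge0 => i _; exact: coded_weight_ge0. Qed.

Lemma measurable_cumulative_weight n : measurable_fun setT (cumulative_weight n).
Proof.
apply: measurable_sum => i; rewrite /coded_weight.
by case: choice.pickle_inv => [c|] //; exact: mp.
Qed.

Lemma cell_inj c c' z : cell c z -> cell c' z -> c = c'.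
Proof.
have aux a b : cell a z -> cell b z -> (choice.pickle a <= choice.pickle b)%N.
  move=> /andP[a1 a2] /andP[b1 b2]; rewrite leqNgt; apply/negP => ba.
  have := cumulative_weight_nd z.1 ba; rewrite leNgt => /negP; apply.
  exact: le_lt_trans a1 b2.
move=> h h'; apply: (pcan_inj (@choice.pickleK I)).
by apply/eqP; rewrite eqn_leq !aux.
Qed.

Lemma partition_colorE c : colored partition_color c = cell c.
Proof.
apply/seteqP; split => z; rewrite /colored /= /partition_color; case: pselect => h //=.
  by move=> [<-]; case: cid.
- by move=> hc; congr Some; case: cid => c' hc' /=; exact: cell_inj hc' hc.
- by move=> hc; exfalso; apply: h; exists c.
Qed.

Lemma measurable_partition_color c : measurable [set z | partition_color z = Some c].
Proof.
rewrite -/(colored partition_color c) partition_colorE.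
have h n : measurable_fun setT (fun z : E * measurableTypeR R => cumulative_weight n z.1).
  exact: (measurableT_comp (measurable_cumulative_weight n) measurable_fst).
rewrite (_ : cell c =
    [set z : E * measurableTypeR R | cumulative_weight (choice.pickle c) z.1 <= z.2] `&`
    [set z : E * measurableTypeR R | z.2 < cumulative_weight (choice.pickle c).+1 z.1]).
  apply: measurableI; rewrite -[X in measurable X]setTI.
    exact: (measurable_fun_ler (h _) measurable_snd measurableT (Logic.I : measurable [set true])).
  exact: (measurable_fun_ltr measurable_snd (h _) measurableT (Logic.I : measurable [set true])).
by apply/seteqP; split => z /=; [move=> /andP[]|move=> [h1 h2]; apply/andP].
Qed.

Lemma partition_color_prob c e :
  color_prob (uniform_prob (@ltr01 R)) partition_color c e = p c e.
Proof.
have mC := measurable_partition_color c.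
apply: EFin_inj; rewrite /color_prob mark_meanE; last 2 first.
- by apply: measurable_indic; exact: mC.
- by move=> z; rewrite indicE; case: (_ \in _); rewrite /= ?lexx ler01.
set n := choice.pickle c.
have cnE : cumulative_weight n.+1 e = cumulative_weight n e + p c e.
  by rewrite /cumulative_weight big_ord_recr/= /coded_weight /n choice.pickleK_inv.
have := partition_colorE c; rewrite /colored => ->.
transitivity (\int[uniform_prob (@ltr01 R)]_t (\1_(`[cumulative_weight n e, cumulative_weight n.+1 e[%classic : set R) t)%:E)%E.
  apply: eq_integral => t _; rewrite !indicE; congr (_%:R%:E); congr nat_of_bool; apply/idP/idP; rewrite !inE.
rewrite integral_indic// setIT /uniform_prob.
transitivity (\int[@lebesgue_measure R]_(t in `[cumulative_weight n e, cumulative_weight n.+1 e[) (cst 1 t))%E.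
  apply: eq_integral => t; rewrite inE/= in_itv/= => /andP[t1 t2].
  rewrite /uniform_pdf (le_trans (cumulative_weight_ge0 n e) t1)/=.
  by rewrite (le_trans (ltW t2) (cumulative_weight_le1 _ _)) subr0 invr1.
rewrite integral_cst// mul1e.
rewrite [LHS](@lebesgue_measure_itv R (Interval (BLeft (cumulative_weight n e)) (BLeft (cumulative_weight n.+1 e))))/=.
rewrite lte_fin cnE ltrDl -EFinB addrAC subrr add0r.
by case: ltgtP (p0 c e) => // <-.
Qed.

(** The cumulative weights tend to 1, hence exceed the mark; the cell is the one
    ending at the first cumulative weight that does. *)
Lemma partition_color_some z : 0 <= z.2 < 1 ->
  (\sum_(n <oo) (coded_weight n z.1)%:E = 1)%E ->
  exists c, partition_color z = Some c.
Proof.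
move=> /andP[z0 z1] s1.
have [n zn] : exists n, z.2 < cumulative_weight n z.1.
  apply: contrapT => /forallNP h; suff : (1 <= z.2%:E)%E.
    by rewrite lee_fin leNgt z1.
  rewrite -s1; apply: lime_le; first by apply: is_cvg_nneseries => n _ _; rewrite lee_fin coded_weight_ge0.
  apply: nearW => n; rewrite big_mkord sumEFin lee_fin leNgt.
  exact/negP/h.
have [m zm minm] := ex_minnP (ex_intro (fun n => z.2 < cumulative_weight n z.1) n zn).
case: m zm minm => [|m] zm minm.
  by move: zm; rewrite /cumulative_weight big_ord0 ltNge z0.
have mz : cumulative_weight m z.1 <= z.2.
  by rewrite leNgt; apply/negP => /minm; rewrite ltnn.
have : coded_weight m z.1 != 0.
  apply: contraTneq zm => h; rewrite -leNgt.
  by move: mz; rewrite /cumulative_weight big_ord_recr/= h addr0.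
rewrite /coded_weight; case Em : choice.pickle_inv => [c|]; last by rewrite eqxx.
move=> _; exists c.
have mc : m = choice.pickle c by have := @choice.pickle_invK I m; rewrite Em /= => ->.
suff : colored partition_color c z by [].
by rewrite partition_colorE /cell/= -mc mz zm.
Qed.

End partition_color.

(** * The Gamma function and the gamma law *)
Section lebesgue_scaling.
Context (R : realType).
Local Notation leb := (@lebesgue_measure R).
Local Open Scope ereal_scope.

(** The image of the Lebesgue measure under t |-> b t is 1 / b times itself, as
    one sees on intervals. *)
Lemma ge0_integral_scaling (b : R) (f : R -> \bar R) : (0 < b)%R ->
  measurable_fun setT f -> (forall t, 0 <= f t) ->
  \int[leb]_t f t = b%:E * \int[leb]_t f (b * t)%R.
Proof.
move=> b0 mf f0.
have mb : measurable_fun setT (fun t : measurableTypeR R => (b * t)%R : measurableTypeR R).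
  exact: mulrl_measurable.
pose phi (t : measurableTypeR R) : measurableTypeR R := (b * t)%R.
pose m' := (mscale (NngNum (ltW b0)) (pushforward leb phi) :
  {measure set (measurableTypeR R) -> \bar R}).
pose m := m' mb.
have lebE A : measurable A -> leb A = m A.
  apply: lebesgue_measure_unique => /= _ [[u v]] _ <-.
  rewrite /m /m' /mscale /= /pushforward.
  have -> : phi @^-1` `]u, v] = `](u / b)%R, (v / b)%R]%classic.
    by apply/seteqP; split => t /=; rewrite !in_itv/= ltr_pdivrMr// ler_pdivlMr// mulrC.
  rewrite !lebesgue_measure_itv/= !lte_fin ltr_pM2r ?invr_gt0//.
  case: ifPn => _; last by rewrite mule0.
  by rewrite -!EFinB -EFinM -mulrBl mulrCA divff ?mulr1// gt_eqF.
rewrite (eq_measure_integral m); last by move=> A mA _; exact: lebE.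
rewrite ge0_integral_mscale//=; congr (_ * _).
by rewrite ge0_integral_pushforward.
Qed.

End lebesgue_scaling.

Section gamma_function.
Context (R : realType).
Local Notation leb := (@lebesgue_measure R).
Implicit Types a b t : R.

Definition gamma_integrand a b t : R := t `^ (a - 1) * expR (- b * t).

Lemma gamma_integrand_ge0 a b t : 0 <= gamma_integrand a b t.
Proof. by rewrite mulr_ge0 ?powR_ge0 ?expR_ge0. Qed.

Lemma measurable_expRM b : measurable_fun setT (fun t : R => expR (b * t)).
Proof. exact: (measurableT_comp (@measurable_expR R) (mulrl_measurable b)). Qed.

Lemma measurable_gamma_integrand a b : measurable_fun setT (gamma_integrand a b).
Proof.
by apply: measurable_funM; [exact: measurable_powR|exact: measurable_expRM].
Qed.

Local Open Scope ereal_scope.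

Lemma integral_powR_away a e : (0 < a)%R -> (0 < e < 1)%R ->
  \int[leb]_(t in `[e, 1%R]) (t `^ (a - 1))%:E <= (a^-1)%:E.
Proof.
move=> a0 /andP[e0 e1].
have d t : (0 < t)%R -> derivable (fun t : R => a^-1 * t `^ a)%R t 1.
  by move=> t0; apply: derivableM => //; apply: derivable_powR; rewrite in_itv/= t0.
have c t : (0 < t)%R -> {for t, continuous (fun t : R => a^-1 * t `^ a)%R}.
  by move=> t0; apply/differentiable_continuous; rewrite -derivable1_diffP; exact: d.
rewrite (@continuous_FTC2 _ _ (fun t : R => a^-1 * t `^ a)%R)//.
- rewrite powR1 mulr1 -EFinB lee_fin gerBl mulr_ge0 ?powR_ge0// invr_ge0; exact: ltW.
- apply: derivable_within_continuous => t; rewrite in_itv/= => /andP[et _].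
  by apply: derivable_powR; rewrite in_itv/= andbT (lt_le_trans e0).
- split.
  + by move=> t; rewrite in_itv/= => /andP[et _]; apply: d; exact: lt_trans et.
  + by apply: cvg_at_right_filter; exact: c.
  + by apply: cvg_at_left_filter; exact: c.
- move=> t; rewrite in_itv/= => /andP[et _]; have t0 := lt_trans e0 et.
  rewrite derive1E deriveM//; last by apply: derivable_powR; rewrite in_itv/= t0.
  rewrite derive_cst scaler0 addr0 -derive1E powR_derive1 ?in_itv/= ?t0//.
  by rewrite /GRing.scale/= mulKf// gt_eqF.
Qed.

Lemma integral_powR_01 a : (0 < a)%R ->
  \int[leb]_(t in `]0%R, 1%R]) (t `^ (a - 1))%:E <= (a^-1)%:E.
Proof.
move=> a0; pose F (i : nat) : set R := `[(i.+2%:R^-1)%R, 1%R]%classic.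
have mp D : measurable_fun D (fun t : R => (t `^ (a - 1))%:E).
  by apply/measurable_EFinP; apply: measurable_funTS; exact: measurable_powR.
have FE : \bigcup_i F i = `]0%R, 1%R]%classic.
  apply/seteqP; split => t.
    move=> [i _]; rewrite /F/= !in_itv/= => /andP[it ->]; rewrite andbT.
    by apply: lt_le_trans it; rewrite invr_gt0.
  rewrite /= in_itv/= => /andP[t0 t1]; exists (Num.truncn t^-1) => //.
  rewrite /F/= in_itv/= t1 andbT invf_ple ?posrE//.
  by rewrite ltW// (lt_trans (truncnS_gt _))// ltr_nat.
have cF : \int[leb]_(t in F i) (t `^ (a - 1))%:E @[i --> \oo] -->
    \int[leb]_(t in \bigcup_i F i) (t `^ (a - 1))%:E.
  apply: ge0_nondecreasing_set_cvg_integral => //.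
  - move=> m n mn; apply/subsetPset => t; rewrite /F/= !in_itv/= => /andP[mt ->].
    by rewrite andbT (le_trans _ mt)// lef_pV2 ?posrE// ler_nat !ltnS.
  - by move=> i; exact: measurable_itv.
  - by move=> i; exact: mp.
  - by move=> i t _; rewrite lee_fin powR_ge0.
rewrite -FE -(cvg_lim _ cF)//; apply: lime_le; first exact: cvgP cF.
apply: nearW => i; apply: integral_powR_away => //.
by rewrite invr_gt0 ltr0n/= invf_lt1 ?ltr0n// ltr1n.
Qed.

(** With n the integer part of a plus 1, t^(a-1) <= t^n = 2^n (t/2)^n
    <= 2^n n! exp(t/2). *)
Lemma gamma_integrand_tail a t : (1 <= t)%R ->
  (gamma_integrand a 1 t <=
   (Num.truncn a).+1`!%:R * 2 ^+ (Num.truncn a).+2 * exponential_pdf 2^-1 t)%R.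
Proof.
set n := (Num.truncn a).+1 => t1; have t0 : (0 <= t)%R by apply: le_trans t1.
rewrite exponential_pdfE//.
have an : (a - 1 <= n%:R)%R.
  by apply: (@le_trans _ _ a); [rewrite gerBl|rewrite ltW// truncnS_gt].
rewrite /gamma_integrand.
apply: (@le_trans _ _ (n`!%:R * 2 ^+ n * expR (t / 2) * expR (- 1 * t)))%R.
  rewrite ler_wpM2r ?expR_ge0//.
  apply: (@le_trans _ _ (t `^ n%:R)%R); first exact: ler_powR.
  rewrite powR_mulrn//.
  have t2 : (0 <= t / 2)%R by rewrite divr_ge0.
  have := expR_coeff_le n t2.
  rewrite ler_pdivrMr ?ltr0n ?fact_gt0// expr_div_n ler_pdivrMr ?exprn_gt0//.
  by move/le_trans; apply; rewrite [leRHS]mulrC mulrA.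
rewrite -(mulrA _ (expR _) (expR _)) -expRD /= le_eqVlt; apply/orP; left; apply/eqP.
have -> : (t / 2 + - 1 * t = - 2^-1 * t)%R by field.
rewrite exprSr -!mulrA; congr (_ * (_ * _))%R.
by rewrite mulrA divff ?mul1r// pnatr_eq0.
Qed.

Lemma Gamma_fun_lty a : (0 < a)%R ->
  \int[leb]_(t in `[0%R, +oo[) (gamma_integrand a 1 t)%:E < +oo.
Proof.
move=> a0; set n := (Num.truncn a).+1; pose C : R := (n`!%:R * 2 ^+ n.+1)%R.
have C0 : (0 <= C)%R by rewrite mulr_ge0// exprn_ge0.
have h0 : (0 <= 2^-1 :> R)%R by rewrite invr_ge0.
rewrite -integral_itv_obnd_cbnd; last first.
  by apply/measurable_EFinP; apply: measurable_funTS; exact: measurable_gamma_integrand.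
pose g1 : R -> R := (fun t => t `^ (a - 1))%R \_ `]0%R, 1%R].
have mg1 : measurable_fun setT g1.
  by apply/measurable_restrict => //; apply: measurable_funTS; exact: measurable_powR.
have g10 t : (0 <= g1 t)%R by rewrite /g1 patchE; case: ifP => // _; rewrite powR_ge0.
pose g2 : R -> R := (fun t => C * exponential_pdf 2^-1 t)%R.
have mg2 : measurable_fun setT g2.
  by apply: measurable_funM => //; exact: measurable_exponential_pdf.
have g20 t : (0 <= g2 t)%R by rewrite mulr_ge0// exponential_pdf_ge0.
apply: (@le_lt_trans _ _ (\int[leb]_t (g1 t + g2 t)%:E)).
  apply: (@le_trans _ _ (\int[leb]_(t in `]0%R, +oo[) (g1 t + g2 t)%:E)).
    apply: ge0_le_integral => //.
    - by move=> t _; rewrite lee_fin gamma_integrand_ge0.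
    - by apply/measurable_EFinP; apply: measurable_funTS; exact: measurable_gamma_integrand.
    - by apply/measurable_EFinP; apply: measurable_funTS; exact: measurable_funD.
    - move=> t; rewrite /= in_itv/= andbT => t0; rewrite lee_fin.
      have [t1|/ltW t1] := leP t 1%R.
        rewrite -[leLHS]addr0 lerD// /g1 patchE mem_set/= ?in_itv/= ?t0//.
        by rewrite ler_piMr ?powR_ge0// -[leRHS]expR0 ler_expR mulN1r oppr_le0 ltW.
      by rewrite -[leLHS]add0r lerD//; exact: gamma_integrand_tail.
  apply: ge0_subset_integral => //.
  - by apply/measurable_EFinP; exact: measurable_funD.
  - by move=> t _; rewrite lee_fin addr_ge0.
under eq_integral do rewrite EFinD.
rewrite ge0_integralD//; last 4 first.
- by move=> t _; rewrite lee_fin.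
- exact/measurable_EFinP.
- by move=> t _; rewrite lee_fin.
- exact/measurable_EFinP.
apply: lte_add_pinfty.
  apply: (@le_lt_trans _ _ (a^-1)%:E); last exact: ltry.
  apply: le_trans (integral_powR_01 a0); rewrite [leRHS]integral_mkcond.
  by rewrite le_eqVlt; apply/orP; left; apply/eqP/eq_integral => t _; rewrite /g1 !patchE; case: ifP.
under eq_integral do rewrite EFinM.
rewrite ge0_integralZl//.
- by rewrite integral_exponential_pdf ?mule1 ?ltry// invr_gt0.
- by apply/measurable_EFinP; exact: measurable_exponential_pdf.
- by move=> t _; rewrite lee_fin exponential_pdf_ge0.
Qed.

Lemma Gamma_funE a : (0 < a)%R ->
  (Gamma_fun a)%:E = \int[leb]_(t in `[0%R, +oo[) (gamma_integrand a 1 t)%:E.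
Proof.
move=> a0; rewrite /Gamma_fun /Rintegral.
transitivity (fine (\int[leb]_(t in `[0%R, +oo[) (gamma_integrand a 1 t)%:E))%:E.
  congr (fine _)%:E; apply: eq_integral => t _.
  by rewrite /gamma_integrand mulN1r.
rewrite fineK//.
  by rewrite ge0_fin_numE ?Gamma_fun_lty// integral_ge0// => t _; rewrite lee_fin gamma_integrand_ge0.
Qed.

Lemma Gamma_fun_gt0 a : (0 < a)%R -> (0 < Gamma_fun a)%R.
Proof.
move=> a0; rewrite -lte_fin Gamma_funE//.
have l : (2^-1 * expR (-2))%:E <= \int[leb]_(t in `[1%R, 2%R]) (gamma_integrand a 1 t)%:E.
  apply: (@le_trans _ _ (\int[leb]_(t in `[1%R, 2%R]) (cst (2^-1 * expR (-2))%:E t))).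
    rewrite integral_cst// [X in _ * X](_ : _ = 1) ?mule1//.
    rewrite [LHS](@lebesgue_measure_itv R `[1%R, 2%R])/= lte_fin ltr1n -EFinB.
    by congr EFin; ring.
  apply: ge0_le_integral => //.
  - by move=> t _; rewrite lee_fin mulr_ge0 ?invr_ge0 ?expR_ge0.
  - by apply/measurable_EFinP; apply: measurable_funTS; exact: measurable_gamma_integrand.
  - move=> t; rewrite /= in_itv/= => /andP[t1 t2]; rewrite lee_fin.
    have t0 : (0 < t)%R by apply: lt_le_trans t1.
    apply: ler_pM; rewrite ?invr_ge0 ?expR_ge0//; last first.
      by rewrite ler_expR mulN1r lerN2.
    apply: (@le_trans _ _ (t `^ (-1))%R).
      by rewrite powR_inv1 ?(ltW t0)// lef_pV2 ?posrE.
    by apply: ler_powR => //; rewrite -[leLHS]add0r lerD2r ltW.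
apply: (@lt_le_trans _ _ (2^-1 * expR (-2))%:E).
  by rewrite lte_fin mulr_gt0 ?invr_gt0 ?expR_gt0.
apply: (le_trans l); apply: ge0_subset_integral => //.
- by apply/measurable_EFinP; apply: measurable_funTS; exact: measurable_gamma_integrand.
- by move=> t _; rewrite lee_fin gamma_integrand_ge0.
- by move=> t; rewrite /= !in_itv/= => /andP[t1 _]; rewrite andbT (le_trans _ t1).
Qed.

Lemma integral_gamma_integrand a b : (0 < a)%R -> (0 < b)%R ->
  \int[leb]_(t in `[0%R, +oo[) (gamma_integrand a b t)%:E = (Gamma_fun a / b `^ a)%:E.
Proof.
move=> a0 b0.
have bb : (b `^ a = b * b `^ (a - 1))%R by rewrite mulr_powRB1// ltW.
have p0 : (b `^ a != 0)%R by rewrite gt_eqF// powR_gt0.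
have cE : \int[leb]_(t in `[0%R, +oo[) (gamma_integrand a 1 t)%:E =
    (b `^ a)%:E * \int[leb]_(t in `[0%R, +oo[) (gamma_integrand a b t)%:E.
  rewrite [LHS]integral_mkcond.
  rewrite (ge0_integral_scaling b0); last 2 first.
  - apply/measurable_restrict => //; apply/measurable_EFinP; apply: measurable_funTS.
    exact: measurable_gamma_integrand.
  - by move=> t; rewrite patchE; case: ifP => // _; rewrite lee_fin gamma_integrand_ge0.
  rewrite bb EFinM -muleA; congr (_ * _).
  rewrite [X in _ = _ * X]integral_mkcond -ge0_integralZl//; last 3 first.
  - apply/measurable_restrict => //; apply/measurable_EFinP; apply: measurable_funTS.
    exact: measurable_gamma_integrand.
  - by move=> t _; rewrite patchE; case: ifP => // _; rewrite lee_fin gamma_integrand_ge0.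
  - by rewrite lee_fin powR_ge0.
  apply: eq_integral => t _; rewrite !patchE.
  have -> : (b * t \in (`[0%R, +oo[%classic : set R))%R = (t \in (`[0%R, +oo[%classic : set R)).
    by apply/idP/idP; rewrite !inE/= !in_itv/= !andbT pmulr_rge0.
  case: ifP; rewrite ?mule0// inE/= in_itv/= andbT => t0.
  by rewrite -EFinM /gamma_integrand powRM ?(ltW b0)// mulN1r mulNr mulrA.
have := Gamma_funE a0; rewrite cE => h.
rewrite EFinM h -muleA [X in _ = X]muleC -muleA -EFinM.
by rewrite mulVf// mule1.
Qed.

End gamma_function.

Section gamma_law.
Context (R : realType).
Local Notation leb := (@lebesgue_measure R).
Implicit Types a b t : R.

Lemma gamma_pdfE a b t : gamma_pdf a b t =
  if 0 <= t then b `^ a / Gamma_fun a * gamma_integrand a b t else 0.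
Proof.
rewrite /gamma_pdf patchE.
have -> : (t \in (`[0%R, +oo[%classic : set R)) = (0 <= t).
  by apply/idP/idP; rewrite inE/= in_itv/= andbT.
by rewrite /gamma_integrand mulrA.
Qed.

Lemma gamma_norm_ge0 a b : 0 < a -> 0 <= b `^ a / Gamma_fun a.
Proof.
move=> a0; apply: divr_ge0; first exact: powR_ge0.
exact: ltW (Gamma_fun_gt0 a0).
Qed.

Lemma gamma_pdf_ge0 a b t : 0 < a -> 0 < b -> 0 <= gamma_pdf a b t.
Proof.
move=> a0 b0; rewrite gamma_pdfE; case: ifP => // _.
exact: (mulr_ge0 (gamma_norm_ge0 b a0) (gamma_integrand_ge0 a b t)).
Qed.

Lemma measurable_gamma_pdf a b : measurable_fun setT (gamma_pdf a b).
Proof.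
apply/measurable_restrict => //; apply: measurable_funTS.
apply: measurable_funM; last exact: measurable_expRM.
by apply: measurable_funM => //; exact: measurable_powR.
Qed.

Definition gamma_law a b (a0 : 0 < a) (b0 : 0 < b) :
    set (measurableTypeR R) -> \bar R :=
  density_measure leb (measurable_gamma_pdf a b) (fun t => gamma_pdf_ge0 t a0 b0).

Section gamma_law_probability.
Variables (a b : R) (a0 : 0 < a) (b0 : 0 < b).

HB.instance Definition _ := Measure.copy (gamma_law a0 b0)
  (density_measure leb (measurable_gamma_pdf a b) (fun t => gamma_pdf_ge0 t a0 b0)).

Let gamma_lawT : gamma_law a0 b0 setT = 1%E.
Proof.
rewrite /gamma_law /density_measure.
transitivity (\int[leb]_(t in `[0%R, +oo[) ((b `^ a / Gamma_fun a)%:E * (gamma_integrand a b t)%:E))%E.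
  rewrite [RHS]integral_mkcond; apply: eq_integral => t _.
  rewrite gamma_pdfE patchE.
  have -> : (t \in (`[0%R, +oo[%classic : set R)) = (0 <= t).
    by apply/idP/idP; rewrite inE/= in_itv/= andbT.
  by case: ifP.
rewrite ge0_integralZl//.
- rewrite integral_gamma_integrand// -EFinM mulrA mulfVK ?divff//.
    by rewrite gt_eqF// powR_gt0.
  by rewrite gt_eqF//; exact: Gamma_fun_gt0.
- by apply/measurable_EFinP; apply: measurable_funTS; exact: measurable_gamma_integrand.
- by move=> t _; rewrite lee_fin gamma_integrand_ge0.
- by rewrite lee_fin; exact: gamma_norm_ge0.
Qed.

HB.instance Definition _ := @Measure_isProbability.Build _ _ R (gamma_law a0 b0) gamma_lawT.

End gamma_law_probability.
End gamma_law.

(** * The classes of a gamma process *)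
Section series_facts.
Context (R : realType).
Local Open Scope ereal_scope.

Lemma esum_countType (I : countType) (g : I -> \bar R) : (forall c, 0 <= g c) ->
  \sum_(n <oo) (if choice.pickle_inv n is Some c then g c else 0) = \esum_(c in setT) g c.
Proof.
move=> g0; rewrite nneseries_esumT; last by move=> n; case: choice.pickle_inv.
transitivity (\esum_(n in range (@choice.pickle I))
    (if @choice.pickle_inv I n is Some c then g c else 0)).
  rewrite [RHS]esum_mkcond; apply: eq_esum => n _.
  case E : choice.pickle_inv => [c|]; last by case: ifP.
  rewrite mem_set//; exists c => //.
  by have := @choice.pickle_invK I n; rewrite E.
rewrite (@reindex_esum R I nat setT _ (@choice.pickle I)).
  by apply: eq_esum => c _; rewrite choice.pickleK_inv.
split => [c _|c c' _ _|n [c _ <-]]; [by exists c| |by exists c].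
exact: (pcan_inj (@choice.pickleK I)).
Qed.

Lemma esum_prod_series (g : nat * nat -> \bar R) : (forall c, 0 <= g c) ->
  \esum_(c in setT) g c = \sum_(m <oo) \sum_(x <oo) g (m, x).
Proof.
move=> g0; rewrite nneseries_esumT; last by move=> m; exact: nneseries_ge0.
transitivity (\esum_(m in [set: nat]) \esum_(x in [set: nat]) g (m, x)).
  rewrite esum_esum//.
  transitivity (\esum_(c in [set: nat] `*`` (fun=> [set: nat])) g c).
    by congr (esum _ _); apply/seteqP; split.
  by apply: eq_esum => -[].
by apply: eq_esum => m _; rewrite nneseries_esumT.
Qed.

Lemma nneseries_shift (f : nat -> \bar R) : (forall n, 0 <= f n) ->
  \sum_(1 <= n <oo) f n = \sum_(n <oo) f n.+1.
Proof.
move=> f0; rewrite -(@nneseries_addn _ f 1)//.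
by apply: eq_eseriesr => n _; rewrite addn1.
Qed.

Lemma nneseries_expR1 (x : R) : (0 <= x)%R ->
  \sum_(n <oo) (x ^+ n.+1 / n.+1`!%:R)%:E = (expR x - 1)%:E.
Proof.
move=> x0.
have h n : 0 <= (x ^+ n / n`!%:R)%:E by rewrite lee_fin divr_ge0// exprn_ge0.
have := nneseries_expR x0; rewrite nneseries_recl// nneseries_shift// expr0 fact0 divr1.
by move=> e; rewrite EFinB -e addeAC subee// add0e.
Qed.

Lemma nneseries_geometric (r : R) : (0 <= r < 1)%R ->
  \sum_(n <oo) (r ^+ n * (1 - r))%:E = 1.
Proof.
move=> /andP[r0 r1]; apply: cvg_lim => //.
rewrite (_ : (fun _ => _) = fun n => (1 - r ^+ n)%:E); last first.
  apply/funext => n; rewrite big_mkord sumEFin; congr EFin.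
  elim: n => [|n IH]; first by rewrite big_ord0 expr0 subrr.
  by rewrite big_ord_recr/= IH exprS; ring.
apply: cvg_EFin; first exact: nearW.
have h : (1 - r ^+ n)%R @[n --> \oo] --> (1 - 0 : R)%R.
  by apply: cvgB; [exact: cvg_cst|apply: cvg_expr; rewrite ger0_norm].
by rewrite subr0 in h.
Qed.

(** Class c = (m, x) of the code stands for the class (m + 1, x + 1) of the
    representation. *)
Definition gamma_weight (c : nat * nat) (t : R) : R :=
  if (0 < t)%R then (expR (- c.1.+1%:R * t) * (t ^+ c.2.+1 / c.2.+1`!%:R))%R else 0%R.

Lemma gamma_weight_ge0 c t : (0 <= gamma_weight c t)%R.
Proof.
rewrite /gamma_weight; case: ifP => // /ltW t0.
by rewrite mulr_ge0 ?expR_ge0// divr_ge0// exprn_ge0.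
Qed.

Lemma measurable_gamma_weight c : measurable_fun setT (gamma_weight c).
Proof.
apply: measurable_fun_if => //.
  exact: measurable_fun_ltr.
apply: measurable_funTS; apply: measurable_funM.
  exact: measurable_expRM.
by apply: measurable_funM => //; exact: measurable_funX.
Qed.

(** \sum_x t^x / x! = exp t - 1 over x >= 1, and then
    exp(- m t) (exp t - 1) = r^(m-1) (1 - r) with r = exp(- t). *)
Lemma gamma_weight_sum t : (0 < t)%R -> \esum_(c in setT) (gamma_weight c t)%:E = 1.
Proof.
move=> t0; rewrite esum_prod_series => [|c]; last by rewrite lee_fin gamma_weight_ge0.
rewrite -(@nneseries_geometric (expR (- t))); last first.
  by rewrite expR_ge0/= -expR0 ltr_expR oppr_lt0.
apply: eq_eseriesr => m _.
under eq_eseriesr => x _ do rewrite /gamma_weight t0/= EFinM.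
rewrite nneseriesZl; last by move=> x _; rewrite lee_fin divr_ge0// exprn_ge0// ltW.
rewrite nneseries_expR1 ?ltW// -EFinM; congr EFin.
rewrite mulrBr mulr1 -expRD -expRM_natl mulrBr mulr1 -expRD.
congr (expR _ - expR _)%R; rewrite -natr1.
  by ring.
by ring.
Qed.

End series_facts.

Section gamma_coloring.
Context (R : realType) d (Psi : measurableType d) (G : probability Psi R).
Variables (gam xi lam : R).
Hypotheses (gam0 : 0 < gam) (xi_gt : -2 < xi) (lam0 : 0 < lam).
Local Notation leb := (@lebesgue_measure R).

Definition half_line_rate (t : R) : R :=
  if 0 <= t then gamma_weight_rate gam xi lam t else 0.

Lemma half_line_rate_ge0 t : 0 <= half_line_rate t.
Proof.
rewrite /half_line_rate; case: ifP => // _.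
by rewrite /gamma_weight_rate !mulr_ge0 ?powR_ge0 ?expR_ge0// ltW.
Qed.

Lemma measurable_half_line_rate : measurable_fun setT half_line_rate.
Proof.
apply: measurable_fun_if => //; first exact: measurable_fun_ler.
apply: measurable_funTS; apply: measurable_funM; last exact: measurable_expRM.
by apply: measurable_funM => //; exact: measurable_powR.
Qed.

Definition rate_measure : {sigma_finite_measure set (measurableTypeR R) -> \bar R} :=
  density_measure leb measurable_half_line_rate half_line_rate_ge0.

Definition mean_measure : {measure set (measurableTypeR R * Psi) -> \bar R} :=
  (rate_measure \x G)%E.

Lemma mean_measureE (B : set (R * Psi)) : measurable B ->
  gamma_mean_measure gam xi lam G B = mean_measure B.
Proof.
move=> mB; rewrite /mean_measure /= /product_measure1 /=.
rewrite ge0_integral_density//; last exact: measurable_fun_xsection.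
rewrite /gamma_mean_measure [LHS]integral_mkcond.
apply: eq_integral => t _.
rewrite patchE /half_line_rate.
have -> : (t \in (`[0%R, +oo[%classic : set R)) = (0 <= t).
  by apply/idP/idP; rewrite inE/= in_itv/= andbT.
by case: ifP => // _; rewrite mul0e.
Qed.

Definition shape (c : nat * nat) : R := xi + c.2.+1%:R + 1.
Definition rate (c : nat * nat) : R := lam + c.1.+1%:R.

Lemma shape_gt0 c : 0 < shape c.
Proof.
by rewrite /shape -natr1 -addrA -addrA; have := ler0n R c.2; move: xi_gt; lra.
Qed.

Lemma rate_gt0 c : 0 < rate c.
Proof. by rewrite addr_gt0. Qed.

Definition class_mean (c : nat * nat) : R := size_biased_mean gam xi lam c.1.+1 c.2.+1.

Lemma class_mean_gt0 c : 0 < class_mean c.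
Proof.
have h1 : 0 < Gamma_fun (shape c) := Gamma_fun_gt0 (shape_gt0 c).
have h2 : 0 < (lam + c.1.+1%:R) `^ (- (xi + c.2.+1%:R + 1)) := powR_gt0 _ (rate_gt0 c).
apply: mulr_gt0 h2; apply: mulr_gt0 h1; apply: mulr_gt0 => //.
Qed.

Definition weight_law (c : nat * nat) : probability (measurableTypeR R) R :=
  gamma_law (shape_gt0 c) (rate_gt0 c).

(** The shapes and rates add up: t^xi t^x = t^(shape - 1) and
    exp(- lam t) exp(- m t) = exp(- rate t).  The point t = 0 is excluded because
    the gamma density need not vanish there. *)
Lemma rate_weightE c t : t != 0 ->
  half_line_rate t * gamma_weight c t = class_mean c * gamma_pdf (shape c) (rate c) t.
Proof.
move=> tn0; rewrite gamma_pdfE /half_line_rate /gamma_weight le_eqVlt eq_sym (negbTE tn0)/=.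
case: ifPn => t0; last by rewrite !mulr0.
rewrite /class_mean /size_biased_mean /gamma_weight_rate /gamma_integrand.
rewrite -/(shape c) -/(rate c).
have g0 : Gamma_fun (shape c) != 0 by rewrite gt_eqF//; exact: Gamma_fun_gt0 (shape_gt0 c).
have r0 : rate c `^ shape c != 0 by rewrite gt_eqF//; exact: powR_gt0 (rate_gt0 c).
have tE : t `^ (shape c - 1) = t `^ xi * t ^+ c.2.+1.
  rewrite /shape addrK powRD; last by rewrite tn0 implybT.
  by rewrite powR_mulrn// ltW.
have eE : expR (- rate c * t) = expR (- lam * t) * expR (- c.1.+1%:R * t).
  by rewrite -expRD; congr expR; rewrite /rate; ring.
rewrite powRN tE eE; set F := (c.2.+1`!%:R : R).
have F0 : F != 0 by rewrite pnatr_eq0 -lt0n fact_gt0.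
move: (Gamma_fun _) (rate c `^ _) (t `^ _) (t ^+ _) (expR _) (expR _) F g0 r0 F0 => g r u v x y F g0 r0 F0.
by field; rewrite g0 r0 F0.
Qed.

Definition weights (c : nat * nat) (e : measurableTypeR R * Psi) : R := gamma_weight c e.1.

Lemma weights_ge0 c e : 0 <= weights c e.
Proof. exact: gamma_weight_ge0. Qed.

Lemma measurable_weights c : measurable_fun setT (weights c).
Proof. exact: (measurableT_comp (measurable_gamma_weight c) measurable_fst). Qed.

Lemma coded_weights_sum e : 0 < e.1 ->
  (\sum_(n <oo) (coded_weight weights n e)%:E = 1)%E.
Proof.
move=> e0; rewrite -(gamma_weight_sum e0) -esum_countType => [|c]; last by rewrite lee_fin gamma_weight_ge0.
by apply: eq_eseriesr => n _; rewrite /coded_weight; case: choice.pickle_inv.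
Qed.

Lemma cumulative_weights_le1 n e : cumulative_weight weights n e <= 1.
Proof.
have [e0|e0] := ltP 0 e.1; last first.
  rewrite /cumulative_weight big1 ?ler01// => i _; rewrite /coded_weight.
  case: choice.pickle_inv => // c; rewrite /weights /gamma_weight.
  by rewrite ltNge e0.
rewrite -lee_fin -(coded_weights_sum e0) /cumulative_weight -sumEFin -(big_mkord predT (fun i => (coded_weight weights i e)%:E)).
by apply: nneseries_lim_ge => k _; rewrite lee_fin coded_weight_ge0//; exact: weights_ge0.
Qed.

Definition coloring := partition_color weights.

Lemma coloring_some z : 0 < z.1.1 -> 0 <= z.2 < 1 -> exists c, coloring z = Some c.
Proof.
move=> z0 z01; apply: partition_color_some => //; first exact: weights_ge0.
exact: coded_weights_sum.
Qed.

Lemma measurable_coloring c : measurable [set z | coloring z = Some c].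
Proof. exact: (measurable_partition_color measurable_weights weights_ge0). Qed.

Local Open Scope ereal_scope.

(** The mean measure of class c is [class_mean c] times [weight_law c] x G. *)
Lemma coloring_int c (f : measurableTypeR R * Psi -> R) : measurable_fun setT f ->
  (forall e, 0 <= f e <= 1)%R ->
  color_int (uniform_prob (@ltr01 R)) mean_measure coloring c f =
  (class_mean c * (1 - \int[class_law weight_law G c]_e f e))%:E.
Proof.
move=> mf f01.
have h0 e : (0 <= 1 - f e)%R by rewrite subr_ge0; have /andP[] := f01 e.
have mh : measurable_fun setT (fun e => (1 - f e)%:E).
  by apply/measurable_EFinP; apply: measurable_funB.
pose h t := \int[G]_y (1 - f (t, y))%:E.
have hE0 t : 0 <= h t by apply: integral_ge0 => y _; rewrite lee_fin.
have mhE : measurable_fun setT h by apply: (@measurable_fun_fubini_tonelli_F _ _ (measurableTypeR R) Psi R G (fun e => (1 - f e)%:E)) => // e; rewrite lee_fin.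
rewrite /color_int.
transitivity (\int[mean_measure]_e (weights c e * (1 - f e))%:E).
  apply: eq_integral => e _; rewrite (partition_color_prob measurable_weights weights_ge0 cumulative_weights_le1)//.
rewrite [LHS]fubini_tonelli1//; last 2 first.
- apply/measurable_EFinP; apply: measurable_funM; first exact: measurable_weights.
  exact: measurable_funB.
- by move=> e; rewrite lee_fin mulr_ge0// weights_ge0.
transitivity (\int[rate_measure]_t ((gamma_weight c t)%:E * h t)).
  apply: eq_integral => t _; rewrite /fubini_F/= /weights/=.
  under eq_integral do rewrite EFinM.
  rewrite ge0_integralZl//.
  - by apply: (measurableT_comp mh); exact: measurable_pair1.
  - by move=> y _; rewrite lee_fin.
  - by rewrite lee_fin gamma_weight_ge0.
have mg1 : measurable_fun setT (fun t => (gamma_weight c t)%:E * h t).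
  by apply: emeasurable_funM => //; apply/measurable_EFinP; exact: measurable_gamma_weight.
rewrite ge0_integral_density//; last first.
  by move=> t; rewrite mule_ge0// lee_fin gamma_weight_ge0.
have mg2 : measurable_fun setT (fun t => (gamma_pdf (shape c) (rate c) t)%:E * h t).
  by apply: emeasurable_funM => //; apply/measurable_EFinP; exact: measurable_gamma_pdf.
transitivity (\int[leb]_t ((class_mean c)%:E * ((gamma_pdf (shape c) (rate c) t)%:E * h t))).
  have mD : measurable ([set: measurableTypeR R] `\ 0%R) by apply: measurableD.
  transitivity (\int[leb]_(t in setT `\ 0%R) ((half_line_rate t)%:E * ((gamma_weight c t)%:E * h t))).
    apply/esym; apply: integral_setD1 => //; apply: measurable_funTS; apply: emeasurable_funM => //.
    by apply/measurable_EFinP; exact: measurable_half_line_rate.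
  transitivity (\int[leb]_(t in setT `\ 0%R) ((class_mean c)%:E * ((gamma_pdf (shape c) (rate c) t)%:E * h t))).
    apply: eq_integral => t; rewrite inE => -[_ /= /eqP t0].
    by rewrite !muleA -!EFinM rate_weightE.
  by apply: integral_setD1 => //; apply: measurable_funTS; exact: emeasurable_funM.
rewrite ge0_integralZl//; last 2 first.
- by move=> t _; rewrite mule_ge0// lee_fin; exact: gamma_pdf_ge0 (shape_gt0 c) (rate_gt0 c).
- by rewrite lee_fin; exact: ltW (class_mean_gt0 c).
rewrite [RHS]EFinM; congr (mule _ _).
transitivity (\int[class_law weight_law G c]_e (1 - f e)%:E).
  rewrite [RHS]fubini_tonelli1//.
  exact/esym/ge0_integral_density.
have fb e : (`|f e| <= 1)%R by have /andP[f0 f1] := f01 e; rewrite ger0_norm.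
rewrite EFinB (EFin_expectation _ mf fb).
have : \int[class_law weight_law G c]_e (1 - f e)%:E + \int[class_law weight_law G c]_e (f e)%:E = 1.
  rewrite -ge0_integralD//.
  - transitivity (\int[class_law weight_law G c]_e 1).
      by apply: eq_integral => e _; rewrite -EFinD subrK.
    exact: integral_prob_cst.
  - by move=> e _; rewrite lee_fin.
  - by move=> e _; rewrite lee_fin; have /andP[] := f01 e.
  - exact/measurable_EFinP.
by rewrite -(EFin_expectation _ mf fb) => <-; rewrite addeK.
Qed.

End gamma_coloring.

(** * Rearrangement of series and transfer along the extension *)
Section rearrangement.
Context (R : realType).
Local Open Scope ereal_scope.

Lemma nneseries_mem (a : nat -> \bar R) (s : seq nat) : uniq s ->
  \sum_(k <oo) (if k \in s then a k else 0) = \sum_(k <- s) a k.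
Proof.
move=> us; apply: cvg_lim => //; apply: cvg_near_cst.
exists (\max_(k <- s) k).+1 => // n /= sn.
rewrite -big_mkcond/= -big_filter; apply: perm_big; apply: uniq_perm => //.
  by apply: filter_uniq; exact: iota_uniq.
move=> k; rewrite mem_filter /index_iota subn0 mem_iota add0n/=.
case: (boolP (k \in s)) => //= ks; rewrite (leq_trans _ sn)// ltnS.
exact: leq_bigmax_seq.
Qed.

(** Each index with a nonzero term has exactly one class; then exchange the sums
    over indices and over codes of classes. *)
Lemma series_by_class (I : countType) (kappa : nat -> option I) (cls : I -> seq nat)
    (a : nat -> \bar R) :
  (forall k, 0 <= a k) -> (forall k, kappa k = None -> a k = 0) ->
  (forall c, uniq (cls c)) -> (forall c k, (k \in cls c) = (kappa k == Some c)) ->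
  \sum_(k <oo) a k = \esum_(c in setT) \sum_(k <- cls c) a k.
Proof.
move=> a0 aN ucls cls_mem.
rewrite -esum_countType => [|c]; last by rewrite sume_ge0.
pose b (n k : nat) : \bar R :=
  if @choice.pickle_inv I n is Some c then (if k \in cls c then a k else 0) else 0.
have b0 n k : 0 <= b n k by rewrite /b; case: choice.pickle_inv => // c; case: ifP.
transitivity (\sum_(k <oo) \sum_(n <oo) b n k).
  apply: eq_eseriesr => k _; case kE : (kappa k) => [c|]; last first.
    rewrite aN// nneseries_const0// => n; rewrite /b.
    by case: choice.pickle_inv => // c; rewrite cls_mem kE.
  rewrite (nneseries_single (m := choice.pickle c)); last first.
    move=> n nc; rewrite /b; case nE : choice.pickle_inv => [c'|]//.
    rewrite cls_mem kE; case: eqP => // -[cc']; rewrite -cc' in nE.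
    by move: nc; have := @choice.pickle_invK I n; rewrite nE /= => <-; rewrite eqxx.
  by rewrite /b choice.pickleK_inv cls_mem kE eqxx.
rewrite nneseries_interchange//; apply: eq_eseriesr => n _; rewrite /b.
case: choice.pickle_inv => [c|]; last exact: nneseries_const0.
by rewrite nneseries_mem.
Qed.

Lemma sum_nth_permE (s : seq nat) i (F : nat -> \bar R) :
  \sum_(j < size s) F (nth 0%N s (nth_perm (size s) i j)) = \sum_(k <- s) F k.
Proof.
rewrite [RHS](big_nth 0%N) big_mkord.
rewrite [RHS](reindex_inj (@perm_inj _ (nth 1%g (enum 'S_(size s)) i))).
by apply: eq_bigr => j _; rewrite /nth_perm valK.
Qed.

End rearrangement.

Section ae_transfer.
Context d1 (T1 : measurableType d1) d2 (T2 : measurableType d2) (R : realType).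

Lemma ae_preimage (P1 : probability T1 R) (P2 : probability T2 R) (f : T1 -> T2) (Q : T2 -> Prop) :
  measurable_fun setT f ->
  (forall A, measurable A -> P1 (f @^-1` A) = P2 A) ->
  {ae P2, forall w, Q w} -> {ae P1, forall w, Q (f w)}.
Proof.
move=> mf fP [N [mN N0 QN]]; exists (f @^-1` N); split.
- by rewrite -[X in measurable X]setTI; exact: mf.
- by rewrite fP.
- by move=> w /= Qw; apply: QN.
Qed.

End ae_transfer.

Section independence_transfer.
Context d (Om : measurableType d) (R : realType) (P : probability Om R).
Local Open Scope ereal_scope.

Lemma mutually_independent_sub (I : choiceType) (D : set I) (F G : I -> set_system Om) :
  (forall i, D i -> F i `<=` G i) ->
  mutually_independent P D G -> mutually_independent P D F.
Proof.
move=> FG H J JD A FA; apply: H => // i iJ; apply: FG; [exact: JD|exact: FA].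
Qed.

Lemma mutually_independent_reindex (I K : choiceType) (D : set I) (f : I -> K)
    (F : K -> set_system Om) : {in D &, injective f} ->
  mutually_independent P setT F -> mutually_independent P D (F \o f).
Proof.
move=> fD H J JD A FA.
have fJ : {in J &, injective f}.
  by move=> i j iJ jJ; apply: fD; rewrite inE; exact: JD.
pose A' k := \bigcap_(i in [set i | i \in J /\ f i = k]) A i.
have A'E i : i \in J -> A' (f i) = A i.
  move=> iJ; apply/seteqP; split => w; first by apply.
  by move=> Aw j [jJ /(fJ _ _ jJ iJ) ->].
have := H [fset f i | i in J]%fset (fun _ _ => Logic.I) A'.
rewrite big_imfset/=; last by move=> i j iJ jJ; exact: fJ.
have -> : \bigcap_(k in [set` [fset f i | i in J]%fset]) A' k = \bigcap_(i in [set` J]) A i.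
  apply/seteqP; split => w h k.
    by move=> kJ; rewrite -A'E//; apply: h; apply/imfsetP; exists k.
  by move=> /imfsetP[i /= iJ ->]; rewrite A'E//; exact: h.
move=> ->; first by apply: eq_big_seq => i iJ; rewrite A'E.
by move=> _ /imfsetP[i /= iJ ->]; rewrite A'E//; exact: FA.
Qed.

Lemma independent_pair (F G : set_system Om) A B :
  mutually_independent P setT (fun i : 'I_2 => tnth [tuple F; G] i) ->
  F A -> G B -> P (A `&` B) = P A * P B.
Proof.
move=> H FA GB.
have := H [fset ord0; ord_max]%fset (fun _ _ => Logic.I) (fun i => if i == ord0 then A else B).
rewrite big_fsetU1/=; last by rewrite in_fset1.
rewrite big_seq_fset1/= => <-.
  congr (P _); apply/seteqP; split => w.
    by move=> [Aw Bw] i /=; rewrite in_fset2 => /orP[/eqP|/eqP] ->.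
  move=> h; split.
    by have := h ord0; rewrite /= in_fset2 eqxx; apply.
  by have := h ord_max; rewrite /= in_fset2 eqxx orbT; apply.
by move=> i; rewrite in_fset2 => /orP[/eqP|/eqP] ->.
Qed.

End independence_transfer.

Section mfun.
Context d1 (T1 : measurableType d1) d2 (T2 : measurableType d2).

Definition mfun_of (f : T1 -> T2) (mf : measurable_fun setT f) : {mfun T1 >-> T2} :=
  mfun_Sub (mem_set mf).

End mfun.

(** * The representation of the gamma process *)
Section gamma_representation.
Context (R : realType) dPsi (Psi : measurableType dPsi) dOm (Om : measurableType dOm).
Context (P : probability Om R) (K : nat) (G : probability Psi R).
Variables (gam xi lam : R).
Hypotheses (gam0 : 0 < gam) (xi_gt : -2 < xi) (lam0 : 0 < lam).
Variables (theta_fix : 'I_K -> {RV P >-> R}) (theta_ord : nat -> {RV P >-> R}).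
Variable psi_ord : nat -> {RV P >-> Psi}.
Hypothesis ord_ge0 : forall k w, 0 <= theta_ord k w.

Local Notation U := (measurableTypeR R).
Local Notation E := (U * Psi)%type.
Local Notation I := (nat * nat)%type.
Local Notation unif := (uniform_prob (@ltr01 R)).
Local Notation mu := (mean_measure G xi lam gam0).
Local Notation color := (@coloring R _ Psi).

Definition weighted_point (k : nat) (w : Om) : E := (theta_ord k w, psi_ord k w).

Local Notation X := weighted_point.
Local Notation fix_events := (sigma_family setT theta_fix).

Hypothesis pppX : poisson_point_process P X (gamma_mean_measure gam xi lam G).
Hypothesis indep_fix : mutually_independent P setT (fun i : 'I_2 => tnth [tuple
  fix_events; sigma_family measurable (point_count R X)] i).

Lemma measurable_weighted_point k : measurable_fun setT (X k).
Proof. by have [mX _ _] := pppX; exact: mX. Qed.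

Lemma fix_events_measurable : fix_events `<=` measurable.
Proof.
apply: smallest_sub; first exact: sigma_algebra_measurable.
by move=> _ [k _ [B mB <-]]; exact: (measurable_funP (theta_fix k)).
Qed.

Lemma fix_eventsT : fix_events setT.
Proof. exact: (@measurableT _ (g_sigma_algebraType (\bigcup_(k in setT) sigma_rv (theta_fix k)))). Qed.

Lemma fix_eventsI : setI_closed fix_events.
Proof. by move=> A B; exact: (@measurableI _ (g_sigma_algebraType (\bigcup_(k in setT) sigma_rv (theta_fix k)))). Qed.

Local Open Scope ereal_scope.

(** The fixed weights are independent of all the counts, so their events may be
    used in [poisson_generating]. *)
Lemma generating_fix A : fix_events A -> generating_formula P X mu A.
Proof.
move=> FA f mf f01; have [mX poisX indX] := pppX.
apply: poisson_generating => //.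
- exact: fix_events_measurable.
- by move=> B mB; have := poisX B mB; rewrite (mean_measureE G xi lam gam0 mB).
move=> L B n J uJ mB tB.
have cE i : sigma_rv (point_count R X (B i)) (count_event R X (B i) (n i)).
  by exists [set (n i)%:R%:E] => //; rewrite setTI.
rewrite -(mutually_independent_seq (indX L B mB tB) uJ (fun i _ => cE i)).
apply: (independent_pair indep_fix FA).
set C : set_system Om := \bigcup_(B in measurable) sigma_rv (point_count R X B).
rewrite bigcap_seq; apply: (@bigsetI_measurable _ (g_sigma_algebraType C)) => i _.
by apply: sub_sigma_algebra; exists (B i).
Qed.

Local Notation m1 := (weight_law xi_gt lam0).
Local Notation EP := (ext_prob P unif (class_law m1 G)).
Local Notation ES := (ext_space Om E U).

Let mX := measurable_weighted_point.
Let mcolor := @measurable_coloring R _ Psi.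
Let M0 := class_mean_gt0 gam0 xi_gt lam0.
Let colorE := coloring_int G gam0 xi_gt lam0.

Lemma mark_law k (B : set U) : measurable B ->
  EP [set w : ES | B (w.1.2 k)] = unif B.
Proof.
move=> mB; pose D i := if i == k then B else setT.
have mD i : measurable (D i) by rewrite /D; case: ifP.
have -> : [set w : ES | B (w.1.2 k)] = (setT `*` box k.+1 D) `*` setT.
  apply/seteqP; split => -[[a b] c] /=.
    by move=> Bk; split => //; split => // i _; rewrite /D; case: eqP => // ->.
  by move=> [[_ /(_ k (ltnSn k))]]; rewrite /D eqxx.
rewrite [LHS](@product_measure1E _ _ (marked_space Om U) (aux_seq_space E))//; last first.
  by apply: measurableX => //; exact: measurable_box.
rewrite [X in (X * _)](@product_measure1E _ _ Om (seqspace U))//; last exact: measurable_box.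
rewrite [X in (_ * X)](_ : _ = 1); last exact: (@probability_setT _ _ _ (aux_seq_prob (class_law m1 G))).
rewrite [X in (X * _ * _)](_ : _ = 1); last exact: (@probability_setT _ _ _ P).
rewrite mule1 mul1e.
transitivity (\prod_(i < k.+1) unif (D i)); first exact: (seqlaw_box (fun=> unif) k.+1 mD).
rewrite big_ord_recr/= {2}/D eqxx big1 ?mul1e// => i _.
rewrite /D ltn_eqF//.
exact: (@probability_setT _ _ _ unif).
Qed.

(** The uniform law on [0, 1] gives mass 0 to the endpoint 1, the only mark in its
    support that lies in no cell whatever the point. *)
Lemma ae_unit_mark : {ae EP, forall w, forall k, (0 <= (w.1.2 k : R) < 1)%R}.
Proof.
apply: ae_foralln => k.
apply: (@ae_preimage _ _ _ _ _ EP unif (fun w : ES => w.1.2 k) (fun u : U => 0 <= (u : R) < 1)%R).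
- exact: (measurableT_comp (measurable_coord k) (measurableT_comp measurable_snd measurable_fst)).
- by move=> A mA; exact: mark_law.
exists (~` `[0%R, 1%R[); split.
- exact: measurableC.
- rewrite /= /uniform_prob integral_uniform_pdf.
  have -> : ~` `[0%R, 1%R[ `&` `[0%R, 1%R] = [set 1%R] :> set U.
    apply/seteqP; split => u /=; rewrite !in_itv/=.
      move=> [/negP h /andP[u0 u1]]; move: h; rewrite u0/= -leNgt => u1'.
      by apply/eqP; rewrite eq_le u1 u1'.
    by move=> ->; rewrite ltxx ler01 lexx.
  exact: integral_set1.
- by move=> u h /=; rewrite in_itv.
Qed.

Lemma ae_classes_finite : {ae EP, forall w, forall c,
  fin_hits (marked_point X (T := U)) (colored color c) w.1}.
Proof.
have : {ae marked_prob P unif, forall w, forall m, forall x,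
    fin_hits (marked_point X (T := U)) (colored color (m, x)) w}.
  apply: ae_foralln => m; apply: ae_foralln => x.
  apply: (ae_fin_hits mX mcolor (generating_fix fix_eventsT)).
  have m0 : measurable_fun [set: E] (fun=> 0%R : R) by exact: measurable_cst.
  have h := colorE (m, x) m0 (fun=> introT andP (conj (lexx 0%R) ler01)).
  apply: (@le_lt_trans _ _ (color_int unif mu color (m, x) (fun=> 0%R))).
    by rewrite le_eqVlt; apply/orP; left; apply/eqP/eq_integral => e _; rewrite subr0 mulr1.
  by rewrite h ltry.
move=> h; have := @ae_preimage _ _ _ _ _ EP _ (fun w : ES => w.1) _ measurable_fst _ h.
move=> H; have {}H := H _.
apply: filterS (H _) => [w hw [m x]|A mA]; first exact: hw.
have -> : [eta fst] @^-1` A = A `*` setT :> set ES.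
  by apply/seteqP; split => -[a b] //= [].
rewrite [LHS](@product_measure1E _ _ (marked_space Om U) (aux_seq_space E))//.
by rewrite [X in (_ * X)](_ : _ = 1) ?mule1//; exact: (@probability_setT _ _ _ (aux_seq_prob (class_law m1 G))).
Qed.

Definition atom (A : set Psi) (e : E) : \bar R := e.1%:E * \d_(e.2) A.

Lemma atom_ge0 A k w : 0 <= atom A (X k w).
Proof. by apply: mule_ge0; rewrite lee_fin ?ord_ge0. Qed.

(** Points of null weight have no class but contribute nothing; every other point
    is in one class, and each class is summed in another order. *)
Lemma ordinary_part_by_class (w : ES) (A : set Psi) :
  (forall k, (0 <= (w.1.2 k : R) < 1)%R) ->
  (forall c, fin_hits (marked_point X (T := U)) (colored color c) w.1) ->
  ordinary_part theta_ord psi_ord (ext_proj w) A =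
  \sum_(1 <= m <oo) \sum_(1 <= x <oo)
    \sum_(1 <= j < (enum_count X color (m.-1, x.-1) w).+1)
      atom A (enum_value X color (m.-1, x.-1) j.-1 w).
Proof.
move=> marks01 fin.
pose kappa k := color (X k w.1.1, w.1.2 k).
pose a k := atom A (X k w.1.1).
rewrite /ordinary_part -/(ext_proj w).
transitivity (\esum_(c in [set: I]) \sum_(k <- color_class X color c w.1) a k).
  apply: (@series_by_class _ _ kappa).
  - by move=> k; exact: atom_ge0.
  - move=> k kN; have := ord_ge0 k w.1.1; rewrite le_eqVlt => /orP[/eqP t0|t0].
      by rewrite /a /atom/= -t0 mul0e.
    by have [c] := @coloring_some R _ Psi (X k w.1.1, w.1.2 k) t0 (marks01 k); rewrite -/(kappa k) kN.
  - by move=> c; exact: uniq_hits.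
  - move=> c k; rewrite /color_class mem_hits//.
    by apply/idP/eqP; rewrite inE.
have cE c : \sum_(k <- color_class X color c w.1) a k =
    \sum_(j < enum_count X color c w) atom A (enum_value X color c j w).
  rewrite -(sum_nth_permE _ ((w.2 (choice.pickle c)).1 (size (color_class X color c w.1))) a).
  by apply: eq_bigr => j _; rewrite /enum_value ltn_ord.
have s0 c : 0 <= \sum_(k <- color_class X color c w.1) a k.
  by apply: sume_ge0 => k _; exact: atom_ge0.
rewrite esum_prod_series// nneseries_shift; last first.
  move=> m; apply: nneseries_ge0 => x _ _; rewrite big_add1/= big_mkord -cE; exact: s0.
apply: eq_eseriesr => m _; rewrite nneseries_shift; last first.
  by move=> x; rewrite big_add1/= big_mkord -cE; exact: s0.
by apply: eq_eseriesr => x _; rewrite cE big_add1/= big_mkord.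
Qed.

End gamma_representation.

Theorem corollary5p4 (R : realType)
    (dPsi : measure_display) (Psi : measurableType dPsi)
    (measurable_singleton : forall y : Psi, measurable [set y])
    (dOm : measure_display) (Om : measurableType dOm) (P : probability Om R)
    (K : nat) (psi_fix : 'I_K -> Psi) (xi_fix lam_fix : 'I_K -> R)
    (gam xi lam : R) (G : probability Psi R) (Theta : R.-ker Om ~> Psi)
    (psi_fix_inj : injective psi_fix)
    (xi_fix_gt : forall k, -1 < xi_fix k)
    (lam_fix_gt0 : forall k, 0 < lam_fix k)
    (gam_gt0 : 0 < gam) (xi_gt : -2 < xi) (xi_le : xi <= -1) (lam_gt0 : 0 < lam)
    (G_diffuse : forall y : Psi, G [set y] = 0%E)
    (Theta_gamma : gamma_process P psi_fix xi_fix lam_fix gam xi lam G Theta) :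
  exists (dOm' : measure_display) (Om' : measurableType dOm')
         (P' : probability Om' R) (pi : {mfun Om' >-> Om})
         (theta_fix : 'I_K -> {RV P' >-> R})
         (psi : nat -> nat -> nat -> {RV P' >-> Psi})
         (rho : nat -> nat -> {RV P' >-> nat})
         (theta : nat -> nat -> nat -> {RV P' >-> R}),
    has_law P' pi P /\
    {ae P', forall w, forall A : set Psi, measurable A ->
      Theta (pi w) A =
        (fixed_part psi_fix theta_fix w A +
         \sum_(1 <= m <oo) \sum_(1 <= x <oo) \sum_(1 <= j < (rho m x w).+1)
           (theta m x j w)%:E * \d_(psi m x j w) A)%E} /\
    ((forall k,
        has_law P' (theta_fix k) (gamma_prob (xi_fix k + 1) (lam_fix k))) /\
     mutually_independent P' setT (fun k => sigma_rv (theta_fix k))) /\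
    ((forall m x j, (0 < m)%N -> (0 < x)%N -> (0 < j)%N ->
        has_law P' (psi m x j) G) /\
     mutually_independent P' pos_index3
       (fun p => sigma_rv (psi p.1.1 p.1.2 p.2))) /\
    ((forall m x, (0 < m)%N -> (0 < x)%N ->
        has_law P' (rho m x) (poisson_prob (size_biased_mean gam xi lam m x) 0)) /\
     mutually_independent P' pos_index2 (fun p => sigma_rv (rho p.1 p.2))) /\
    ((forall m x j, (0 < m)%N -> (0 < x)%N -> (0 < j)%N ->
        has_law P' (theta m x j) (gamma_prob (xi + x%:R + 1) (lam + m%:R))) /\
     mutually_independent P' pos_index3
       (fun p => sigma_rv (theta p.1.1 p.1.2 p.2))) /\
    mutually_independent P' setT (fun i : 'I_4 => tnth [tuple
      sigma_family setT theta_fix;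
      sigma_family pos_index3 (fun p => psi p.1.1 p.1.2 p.2);
      sigma_family pos_index2 (fun p => rho p.1 p.2);
      sigma_family pos_index3 (fun p => theta p.1.1 p.1.2 p.2)] i).
Proof.
have [_ [fix0 [ord [psi0 [[fix_law fix_indep] ord_ge0 ppp indep2 ThetaE]]]]] := Theta_gamma.
pose U := measurableTypeR R; pose E := (U * Psi)%type; pose I := (nat * nat)%type.
pose X : nat -> Om -> E := weighted_point ord psi0.
have pppX : poisson_point_process P X (gamma_mean_measure gam xi lam G) := ppp.
have indepX : mutually_independent P setT (fun i : 'I_2 => tnth [tuple
  sigma_family setT fix0; sigma_family measurable (point_count R X)] i) := indep2.
pose base := sigma_family setT fix0.
pose unif : probability U R := uniform_prob (@ltr01 R).
pose m1 : I -> probability U R := weight_law xi_gt lam_gt0.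
pose col := @coloring R _ Psi.
pose EP := ext_prob P unif (class_law m1 G).
have mX := measurable_weighted_point pppX.
have mcol := @measurable_coloring R _ Psi.
have M0 := class_mean_gt0 gam_gt0 xi_gt lam_gt0.
have colE := coloring_int G gam_gt0 xi_gt lam_gt0.
have baseT : base setT by exact: fix_eventsT.
have baseM : base `<=` measurable by exact: fix_events_measurable.
have baseI : setI_closed base by exact: fix_eventsI.
have gen A (bA : base A) : generating_formula P X (mean_measure G xi lam gam_gt0) A.
  exact: (generating_fix pppX indepX bA).
have ind : mutually_independent EP setT (component_events X col base) :=
  component_independent mX mcol M0 colE baseM baseT gen.
pose ES : measurableType _ := ext_space Om E U.
pose pr : {mfun ES >-> Om} := mfun_of (measurable_ext_proj (Om := Om) (E1 := U) (E2 := Psi) (T := U)).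
have prE A : measurable A -> EP (pr @^-1` A) = P A by move=> mA; exact: ext_proj_law.
have mth k : measurable_fun setT (fun w : ES => fix0 k (pr w)).
  by apply: measurableT_comp.
pose th k : {RV EP >-> R} := mfun_of (mth k).
pose cl (m x : nat) : I := (m.-1, x.-1).
pose psi m x j : {RV EP >-> Psi} := mfun_of (measurable_value2 mX mcol (cl m x) j.-1).
pose rho m x : {RV EP >-> nat} := mfun_of (measurable_enum_count mX mcol (cl m x)).
have mv1 c j : measurable_fun setT (value1 X col c j : ES -> R) := measurable_value1 mX mcol c j.
pose theta m x j : {RV EP >-> R} := mfun_of (mv1 (cl m x) j.-1).
have fixE k A : sigma_rv (th k) A -> exists2 B, sigma_rv (fix0 k) B & A = pr @^-1` B.
  by move=> [B mB <-]; exists (fix0 k @^-1` B); [exists B; rewrite ?setTI|rewrite setTI].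
have fix_base k B : sigma_rv (fix0 k) B -> base B.
  by move=> kB; rewrite /base /sigma_family; apply: sub_sigma_algebra; exists k.
exists _, ES, EP, pr, th, psi, rho, theta.
split; first by move=> A mA; exact: prE.
split.
  have h1 : {ae EP, forall w, forall A, measurable A -> Theta (pr w) A =
      (fixed_part psi_fix fix0 (pr w) A + ordinary_part ord psi0 (pr w) A)%E}.
    exact: (@ae_preimage _ _ _ _ _ EP P pr _ (measurable_funP pr) prE ThetaE).
  have h2 := ae_unit_mark P G xi_gt lam_gt0.
  have h3 := ae_classes_finite gam_gt0 xi_gt lam_gt0 pppX indepX.
  apply: filterS3 h1 h2 h3 => w w1 w2 w3 A mA.
  rewrite w1//; congr (_ + _)%E.
  exact: (ordinary_part_by_class ord_ge0 A w2 w3).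
split.
  split.
    by move=> k A mA; rewrite -fix_law//; apply: prE; exact: measurable_funPTI.
  move=> J JD A FA.
  have [B BE] : exists B, forall k, k \in J -> sigma_rv (fix0 k) (B k) /\ A k = pr @^-1` (B k).
    suff : forall k, exists B, k \in J -> sigma_rv (fix0 k) B /\ A k = pr @^-1` B.
      by move=> /choice[B BE]; exists B.
    move=> k; have [kJ|] := boolP (k \in J); last by exists set0.
    by have [B kB ->] := fixE _ _ (FA k kJ); exists B.
  have mB k : k \in J -> measurable (B k).
    by move=> kJ; have [kB _] := BE k kJ; exact: (baseM _ (fix_base k _ kB)).
  have -> : \bigcap_(k in [set` J]) A k = pr @^-1` (\bigcap_(k in [set` J]) B k).
    apply/seteqP; split => w h k kJ; have [_ AE] := BE k kJ; have := h k kJ; by rewrite AE.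
  rewrite prE; last by apply: fin_bigcap_measurable => // k; exact: mB.
  rewrite fix_indep// => [|k kJ]; last by have [] := BE k kJ.
  by apply: eq_big_seq => k kJ; have [_ ->] := BE k kJ; rewrite prE//; exact: mB.
(* positive indices are determined by their predecessors *)
have inj3 (f : I * nat -> component I) : injective f ->
    {in pos_index3 &, injective (fun p : nat * nat * nat => f (cl p.1.1 p.1.2, p.2.-1))}.
  move=> finj [[m x] j] [[m' x'] j']; rewrite !inE => -[/= m0 x0 j0] [/= m0' x0' j0'].
  move=> /finj; move: m0 x0 j0 m0' x0' j0'; rewrite /cl.
  by case: m m' x x' j j' => [//|m] [//|m'] [//|x] [//|x'] [//|j] [//|j'] /= _ _ _ _ _ _ [-> -> ->].
have inj2 : {in pos_index2 &, injective (fun p : nat * nat => inr (inl (cl p.1 p.2)) : component I)}.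
  move=> [m x] [m' x']; rewrite !inE => -[/= m0 x0] [/= m0' x0'] -[].
  by case: m m' x x' m0 x0 m0' x0' => [//|m] [//|m'] [//|x] [//|x'] /= _ _ _ _ -> ->.
split.
  split; first by move=> m x j _ _ _ A mA; exact: (value2_law mX mcol M0 colE baseT gen).
  apply: (mutually_independent_reindex _ ind (f := fun p : nat * nat * nat => inl (inr (cl p.1.1 p.1.2, p.2.-1)) : component I)).
  by apply: (inj3 (fun q => inl (inr q) : component I)) => p q [].
split.
  split.
    case=> [//|m] [//|x] _ _ A mA; exact: (count_law mX mcol M0 colE baseT gen).
  exact: (mutually_independent_reindex inj2 ind).
split.
  split.
    case=> [//|m] [//|x] j _ _ _ A mA; exact: (value1_law mX mcol M0 colE baseT gen).
  apply: (mutually_independent_reindex _ ind (f := fun p : nat * nat * nat => inr (inr (cl p.1.1 p.1.2, p.2.-1)) : component I)).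
  by apply: (inj3 (fun q => inr (inr q) : component I)) => p q [].
(* the four families are blocks of the independent family [ind] *)
pose g (k : component I) : 'I_4 :=
  match k with
  | inl (inl _) => inord 0 | inl (inr _) => inord 1
  | inr (inl _) => inord 2 | inr (inr _) => inord 3
  end.
have cM k : component_events X col base k `<=` measurable.
  exact: component_measurable.
have cI k : setI_closed (component_events X col base k) by exact: component_setI.
have cT k : component_events X col base k setT by exact: component_setT.
have grp := mutually_independent_group (g := g) cM cI cT ind.
apply: mutually_independent_sub grp => i _.
have blk (k : component I) (C : set_system ES) (i0 : 'I_4) : g k = i0 -> C `<=` component_events X col base k ->
    C `<=` <<s \bigcup_(k in [set k | g k = i0]) component_events X col base k >>.
  by move=> gk CF B CB; apply: sub_sigma_algebra; exists k => //; exact: CF.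
have gen_sub (C : set_system ES) (i0 : 'I_4) :
    C `<=` <<s \bigcup_(k in [set k | g k = i0]) component_events X col base k >> ->
    <<s C >> `<=` <<s \bigcup_(k in [set k | g k = i0]) component_events X col base k >>.
  by move=> h; apply: smallest_sub => //; exact: smallest_sigma_algebra.
case: i => -[|[|[|[|//]]]] i4; rewrite (tnth_nth set0)/=; apply: gen_sub => B [p _ pB].
- apply: (blk (inl (inl tt)) _ _ _ (fun C h => h)); first by apply: val_inj; rewrite /= inordK.
  by have [D kD ->] := fixE _ _ pB; exists D => //; exact: fix_base kD.
- apply: (blk (inl (inr (cl p.1.1 p.1.2, p.2.-1))) _ _ _ (fun C h => h)) => //.
  by apply: val_inj; rewrite /= inordK.
- apply: (blk (inr (inl (cl p.1 p.2))) _ _ _ (fun C h => h)) => //.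
  by apply: val_inj; rewrite /= inordK.
- apply: (blk (inr (inr (cl p.1.1 p.1.2, p.2.-1))) _ _ _ (fun C h => h)) => //.
  by apply: val_inj; rewrite /= inordK.
Qed.
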